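(* Let $d \in \mathbb{N}$ and let $\alpha > -1$. Then, for all $u\in \mathrm{H}^1_\alpha$ and all integers $N\geq 2$, $$\lVert u - S^{\alpha,1}_N(u)\rVert_\alpha \leq \left( (\lambda^{(\alpha)}_{N+1})^{-1/2} + (\lambda^{(\alpha)}_{N-1})^{-1/2} \right) \lVert u - S^{\alpha,1}_N(u)\rVert_{\alpha,1}.$$
   Context: $\mathbb{N}$ is the set of positive integers. $B^d$ is the open unit ball of $\mathbb{R}^d$ and functions are complex-valued. $\mathrm{L}^2_\alpha$ is the weighted $L^2$ space on $B^d$ with inner product $\langle u,v\rangle_\alpha=\int_{B^d}u\,\overline{v}\,(1-\lVert x\rVert^2)^\alpha\,dx$ and norm $\lVert\cdot\rVert_\alpha$, also used for vector-valued functions (summing over components). $\mathrm{H}^1_\alpha$ is the weighted Sobolev space of $u\in\mathrm{L}^2_\alpha$ with weak gradient in $\mathrm{L}^2_\alpha$. $\Pi^d_N$ is the space of $d$-variate polynomials of total degree at most $N$. On $\mathrm{H}^1_\alpha$ consider the inner product $\langle u,v\rangle_{\alpha,1}=\langle\nabla u,\nabla v\rangle_\alpha+c_\alpha^{-1}\langle u,1\rangle_\alpha\overline{\langle v,1\rangle_\alpha}$, $c_\alpha=\langle1,1\rangle_\alpha$ (equivalent to the standard one), with norm $\lVert\cdot\rVert_{\alpha,1}$; $S^{\alpha,1}_N$ is the orthogonal projection from $\mathrm{H}^1_\alpha$ onto $\Pi^d_N$ with respect to it. $\lambda^{(\alpha)}_n=n(n+d+2\alpha)$. *)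

(* Defs.v *)
From HB Require Import structures.
From mathcomp Require Import all_boot all_order all_algebra.
From mathcomp Require Import -(notations) mpoly.
From mathcomp Require Import all_classical all_reals all_analysis.
From mathcomp Require Import complex.

Set Implicit Arguments.
Unset Strict Implicit.
Unset Printing Implicit Defensive.

Import Order.TTheory GRing.Theory Num.Theory.
Import numFieldNormedType.Exports.

Local Open Scope classical_set_scope.
Local Open Scope ring_scope.
Local Open Scope complex_scope.

(* Lebesgue measure on R^d.  The measure is built on [d.-tuple] by iterating
   the binary product of the library, and then carried over to ['rV[R]_d],
   the type with the topology and the derivatives, whose sigma-algebra is the
   one generated by the coordinates, that is, the Borel one. *)
Section lebesgue_tuple.
Context {R : realType}.
Local Notation mR := (measurableTypeR R).

Section step.
Variables (d : nat) (m : {sigma_finite_measure set (d.-tuple mR) -> \bar R}).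

Definition consT (p : mR * d.-tuple mR) : d.+1.-tuple mR :=
  [tuple of p.1 :: p.2].
Definition unconsT (t : d.+1.-tuple mR) : mR * d.-tuple mR :=
  (thead t, [tuple of behead t]).

Lemma consTK : cancel consT unconsT.
Proof. by move=> [x t]; congr pair; apply: val_inj. Qed.

Lemma measurable_consT : measurable_fun setT consT.
Proof. exact: measurable_cons measurable_fst measurable_snd. Qed.

Lemma measurable_unconsT : measurable_fun setT unconsT.
Proof.
apply: measurable_fun_pair; first exact: measurable_tnth.
exact: measurable_behead.
Qed.

Definition lebesgue_cons : set (d.+1.-tuple mR) -> \bar R :=
  pushforward (@lebesgue_measure R \x m)%E consT.

Let lebesgue_cons0 : lebesgue_cons set0 = 0%E.
Proof. by rewrite /lebesgue_cons measure0 //; exact: measurable_consT. Qed.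

Let lebesgue_cons_ge0 A : (0 <= lebesgue_cons A)%E.
Proof. by apply: measure_ge0; exact: measurable_consT. Qed.

Let lebesgue_cons_sigma_additive : semi_sigma_additive lebesgue_cons.
Proof. by apply: measure_semi_sigma_additive; exact: measurable_consT. Qed.

HB.instance Definition _ := isMeasure.Build _ _ _ lebesgue_cons
  lebesgue_cons0 lebesgue_cons_ge0 lebesgue_cons_sigma_additive.

Lemma lebesgue_cons_sigma_finite : sigma_finite setT lebesgue_cons.
Proof.
have /sigma_finiteP[F [TF ndF Foo]] := sigma_finiteT (@lebesgue_measure R).
have /sigma_finiteP[G [TG ndG Goo]] := sigma_finiteT m.
have FGT : [set: mR * d.-tuple mR] = \bigcup_n (F n `*` G n).
  rewrite -setXTT TF TG predeqE => -[x y]; split.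
    move=> [/= [n _ Fnx] [k _ Gky]]; exists (maxn n k) => //; split.
    - by move: x Fnx; exact/subsetPset/ndF/leq_maxl.
    - by move: y Gky; exact/subsetPset/ndG/leq_maxr.
  by move=> [n _ []/= ? ?]; split; exists n.
exists (fun n => unconsT @^-1` (F n `*` G n)).
  by rewrite -preimage_bigcup -FGT preimage_setT.
move=> n; have [mF Fn] := Foo n; have [mG Gn] := Goo n; split.
  rewrite -[X in measurable X]setTI.
  by apply: measurable_unconsT => //; exact: measurableX.
rewrite /lebesgue_cons /pushforward (_ : _ @^-1` _ = F n `*` G n); last first.
  rewrite -comp_preimage (_ : _ \o _ = id)//; apply/funext => p.
  exact: consTK.
by rewrite product_measure1E// lte_mul_pinfty// ge0_fin_numE.
Qed.

HB.instance Definition _ :=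
  @Measure_isSigmaFinite.Build _ _ _ lebesgue_cons lebesgue_cons_sigma_finite.
End step.

Fixpoint lebesgue_tuple (d : nat) :
    {sigma_finite_measure set (d.-tuple mR) -> \bar R} :=
  if d is d'.+1 then lebesgue_cons (lebesgue_tuple d')
  else \d_([tuple] : 0.-tuple mR).
End lebesgue_tuple.

Section lebesgue_rV.
Context {R : realType} {d : nat}.
Local Notation mR := (measurableTypeR R).

Definition tuple_of_rV (x : 'rV[R]_d) : d.-tuple mR := [tuple x ord0 i | i < d].
Definition rV_of_tuple (t : d.-tuple mR) : 'rV[R]_d := \row_i tnth t i.

HB.instance Definition _ := Measurable.copy 'rV[R]_d
  (g_sigma_algebra_preimageType tuple_of_rV).

Lemma rV_of_tupleK : cancel rV_of_tuple tuple_of_rV.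
Proof.
by move=> t; apply: eq_from_tnth => i; rewrite tnth_mktuple mxE.
Qed.

Lemma tuple_of_rVK : cancel tuple_of_rV rV_of_tuple.
Proof. by move=> x; apply/rowP => i; rewrite mxE tnth_mktuple. Qed.

Lemma measurable_rV_of_tuple : measurable_fun setT rV_of_tuple.
Proof.
move=> _ _ [B mB <-]; rewrite !setTI -comp_preimage.
rewrite (_ : _ \o _ = id)//; apply/funext => t /=; exact: rV_of_tupleK.
Qed.

Definition lebesgue_rV : set 'rV[R]_d -> \bar R :=
  pushforward (lebesgue_tuple d) rV_of_tuple.

Let lebesgue_rV0 : lebesgue_rV set0 = 0%E.
Proof. by rewrite /lebesgue_rV measure0 //; exact: measurable_rV_of_tuple. Qed.

Let lebesgue_rV_ge0 A : (0 <= lebesgue_rV A)%E.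
Proof. by apply: measure_ge0; exact: measurable_rV_of_tuple. Qed.

Let lebesgue_rV_sigma_additive : semi_sigma_additive lebesgue_rV.
Proof. by apply: measure_semi_sigma_additive; exact: measurable_rV_of_tuple. Qed.

HB.instance Definition _ := isMeasure.Build _ _ _ lebesgue_rV
  lebesgue_rV0 lebesgue_rV_ge0 lebesgue_rV_sigma_additive.
End lebesgue_rV.

Section weighted_sobolev_ball.
Context {R : realType} {d : nat}.
Local Notation V := 'rV[R]_d.
Implicit Types (u v p q : V -> R[i]) (U W : 'I_d -> V -> R[i]).
Implicit Types (phi : V -> R) (alpha : R) (N : nat).

(* The library norm on ['rV[R]_d] is the maximum norm, hence this definition. *)
Definition sqnorm (x : V) : R := \sum_(i < d) x ord0 i ^+ 2.

Definition unit_ball : set V := [set x | sqnorm x < 1].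

Definition cmeasurable u : Prop :=
  measurable_fun unit_ball (fun x => complex.Re (u x)) /\
  measurable_fun unit_ball (fun x => complex.Im (u x)).

(* The integral over the ball of a complex-valued function. *)
Definition cintegral u : R[i] :=
  Complex (\int[lebesgue_rV]_(x in unit_ball) complex.Re (u x))
          (\int[lebesgue_rV]_(x in unit_ball) complex.Im (u x)).

Definition weight alpha (x : V) : R := (1 - sqnorm x) `^ alpha.

Definition L2 alpha u : Prop :=
  cmeasurable u /\
  (\int[lebesgue_rV]_(x in unit_ball)
     (Normc.normc (u x) ^+ 2 * weight alpha x)%:E < +oo)%E.

Definition ip alpha u v : R[i] :=
  cintegral (fun x => u x * (v x)^* * (weight alpha x)%:C).

Definition ipv alpha U W : R[i] := \sum_(j < d) ip alpha (U j) (W j).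

Definition nrm alpha u : R := Num.sqrt (complex.Re (ip alpha u u)).

(* All iterated partial derivatives exist and are differentiable, which is
   the same as phi being infinitely differentiable. *)
Definition smooth phi : Prop :=
  forall (s : seq 'I_d) (x : V),
    differentiable
      (foldr (fun (j : 'I_d) (f : V -> R) => (fun y => 'D_'e_j f y)) phi s) x.

Definition test_function phi : Prop :=
  [/\ smooth phi,
      compact (closure [set x | phi x != 0]) &
      closure [set x | phi x != 0] `<=` unit_ball].

Definition L1loc u : Prop :=
  cmeasurable u /\
  forall K : set V, compact K -> K `<=` unit_ball ->
    (\int[lebesgue_rV]_(x in K) (Normc.normc (u x))%:E < +oo)%E.

Definition is_weak_deriv (j : 'I_d) u (g : V -> R[i]) : Prop :=
  [/\ L1loc u, L1loc g &
      forall phi, test_function phi ->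
        cintegral (fun x => u x * ('D_'e_j phi x)%:C) =
        - cintegral (fun x => g x * (phi x)%:C)].

(* A weak derivative is determined up to a null set only; the gradient
   operator chooses a representative. *)
Definition wgrad u (j : 'I_d) : V -> R[i] :=
  xget (cst 0) [set g | is_weak_deriv j u g].

Definition H1 alpha u : Prop :=
  L2 alpha u /\
  forall j, exists2 g, is_weak_deriv j u g & L2 alpha g.

Definition one : V -> R[i] := cst 1.

Definition ip1 alpha u v : R[i] :=
  ipv alpha (wgrad u) (wgrad v)
  + (ip alpha one one)^-1 * ip alpha u one * (ip alpha v one)^*.

Definition nrm1 alpha u : R := Num.sqrt (complex.Re (ip1 alpha u u)).

(* [msize] is the total degree plus one, and 0 for the polynomial 0. *)
Definition polyspace N : set (V -> R[i]) :=
  [set p | exists2 P : mpoly d R[i], (msize P <= N.+1)%N &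
     p = fun x : V => meval (fun i => (x ord0 i)%:C) P].

(* The orthogonal projection onto the polynomials of degree at most N: the
   polynomial p of that space with u - p orthogonal to the space. *)
Definition proj1 alpha N u : V -> R[i] :=
  xget (cst 0)
    [set p | polyspace N p /\
             forall q, polyspace N q -> ip1 alpha (u \- p) q = 0].

End weighted_sobolev_ball.

Definition lambda {R : realType} (d : nat) (alpha : R) (n : nat) : R :=
  n%:R * (n%:R + d%:R + 2 * alpha).

(* Main.v *)
(* Write [s = 1 - |x|^2] and let [e] be [u] minus its projection; the real and the
   imaginary part of [e] are treated separately.  Testing with [1] gives [e] mean
   zero, whence [grad e] is orthogonal to the gradients of all polynomials of degree
   at most [N].  For [w] homogeneous of degree [n <= N - 2] the radial derivative of
   [q = w + n/2 s w] vanishes on the sphere, so integration by parts turns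
   [<grad e, grad q> = 0] into [<e, T w> = 0] with [T w] a polynomial of degree [n];
   the polynomials [T w] span everything of degree at most [N - 2], hence [e] is
   orthogonal to those polynomials.

   The elliptic operator of the form
   [a(f, g) = <grad f, grad g> - <x . grad f, x . grad g>] preserves the degree and
   acts on the polynomials of degree [n] as [lambda_n] modulo lower degree.  So
   [a(p, p) >= lambda_(N-1) <p, p>] for every polynomial [p] orthogonal to degree
   [N - 2], and, [a] being nonnegative and polynomials being dense in the weighted
   [L^2], the same holds for [e].  Since [a(e, e) <= <grad e, grad e>], already the
   second term of the constant suffices.

   Integrations by parts are done with the explicit test functions
   [p(x) s^b exp(- dl / (s - dl))], supported in [s >= dl], as [dl] tends to [0]. *)

From HB Require Import structures.
Require Import Defs.
From mathcomp Require Import all_boot all_order all_algebra.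
From mathcomp Require Import -(notations) mpoly.
From mathcomp Require Import all_classical all_reals all_analysis.
From mathcomp Require Import measurable_realfun complex.
From mathcomp Require Import ring lra zify.

Set Implicit Arguments.
Unset Strict Implicit.
Unset Printing Implicit Defensive.

Import Order.TTheory GRing.Theory Num.Theory.
Import numFieldNormedType.Exports.

Local Open Scope classical_set_scope.
Local Open Scope ring_scope.

(** * Translation invariance of Lebesgue measure *)

Section translation_invariance.
Context {R : realType}.
Local Notation mR := (measurableTypeR R).

(** For [alpha] in (-1, 0] the weight does not vanish at the sphere, so integration by parts against
    a polynomial field [F] leaves no boundary term only if the radial component [x . F] carries a
    factor [s]. This constraint shapes both operators. For [F = grad q] it dictates the correction:
    on the sphere the radial derivative of [w + k s w] is [(n - 2 k) w], whence [k = n/2], at the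
    price of raising the degree by two; this is the origin of [N - 2]. In the form [a], subtracting
    the radial part multiplies the radial contribution by [s], so the factor is there for every
    polynomial; its operator is the one whose eigenpolynomials are the orthogonal polynomials of the
    ball for the weight.

    The gradient of [e] is a chosen representative, so weak derivatives must be shown unique almost
    everywhere before any inner product can be computed. Density of polynomials yields this too,
    which is why it is proved for an arbitrary integrable weight. Forms on polynomials are treated
    as semidefinite: a projection exists as soon as the functional to be represented vanishes on
    null vectors. *)

Lemma measurable_addr (b : R) : measurable_fun setT (fun x : mR => (x + b : mR)).
Proof. by apply: measurable_funD. Qed.

(** The image measure under the translation gives half-open intervals their length, which
    characterises Lebesgue measure. *)
Lemma lebesgue_measure_addr (b : R) (A : set mR) : measurable A ->
  lebesgue_measure ((fun x : mR => x + b) @^-1` A) = lebesgue_measure A.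
Proof.
move=> mA; pose mf := isMeasurableFun.Build _ _ _ _ _ (measurable_addr b).
pose f : {mfun mR >-> mR} := HB.pack (fun x : mR => (x + b : mR)) mf.
rewrite -[LHS]/(pushforward lebesgue_measure f A).
apply/esym/lebesgue_measure_unique => //= _ [[x y]] _ <-.
rewrite /pushforward (_ : f @^-1` _ = `]x - b, y - b]%classic); last first.
  by apply/seteqP; split => z /=; rewrite !in_itv/= ltrBlDr lerBrDr.
rewrite !lebesgue_measure_itv/= !lte_fin ltrD2r.
by case: ifP => // _; rewrite -!EFinB opprB addrA subrK.
Qed.

Definition tuple_add d (v x : d.-tuple mR) : d.-tuple mR :=
  [tuple tnth x k + tnth v k | k < d].

(** Induction on the dimension through sections: the induction hypothesis moves the tail inside each
    section, and what remains is a change of variable in the first coordinate. *)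
Lemma lebesgue_tuple_add d (v : d.-tuple mR) A : measurable A ->
  lebesgue_tuple d (tuple_add v @^-1` A) = lebesgue_tuple d A.
Proof.
elim: d v A => [|d IH] v A mA.
  by congr (lebesgue_tuple 0 _); apply/seteqP; split=> x /=; rewrite [tuple_add _ _]tuple0 [x]tuple0.
have mC : measurable (@consT R d @^-1` A).
  by rewrite -[X in measurable X]setTI; exact: measurable_consT.
rewrite /= /lebesgue_cons /pushforward /product_measure1.
pose F (a : mR) := lebesgue_tuple d (xsection (@consT R d @^-1` A) a).
have mF : measurable_fun setT F by exact: measurable_fun_xsection.
transitivity (\int[@lebesgue_measure R]_a F (a + thead v)%R)%E.
  apply: eq_integral => a _ /=; rewrite /F.
  rewrite -(IH [tuple of behead v]); last exact: measurable_xsection.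
  congr (lebesgue_tuple d _).
  have E x : tuple_add v (consT (a, x)) =
      consT (a + thead v, tuple_add [tuple of behead v] x).
    apply: eq_from_tnth => i; rewrite tnth_mktuple.
    case: (unliftP ord0 i) => [j|] ->; last by rewrite /consT /= !tnth0.
    rewrite /consT /= !tnthS tnth_mktuple; congr (_ + _).
    by rewrite tnth_behead; congr (tnth v _); apply: val_inj; rewrite /= inordK ?ltnS.
  by apply/seteqP; split => x; rewrite /xsection /= !inE /= E.
pose mf := isMeasurableFun.Build _ _ _ _ _ (measurable_addr (thead v)).
pose f : {mfun mR >-> mR} := HB.pack (fun x : mR => (x + thead v : mR)) mf.
rewrite -(@ge0_integral_pushforward _ _ _ _ _ f _ lebesgue_measure setT F)//.
by apply: eq_measure_integral => //= B mB _; exact: lebesgue_measure_addr.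
Qed.

End translation_invariance.

(** * Measurability and Lebesgue measure on row vectors *)

Section measure_rV.
Context {R : realType} {d : nat}.
Local Notation mR := (measurableTypeR R).
Local Notation V := 'rV[R]_d.
Local Notation mu := (@lebesgue_rV R d).

Lemma measurable_tuple_of_rV : measurable_fun setT (@tuple_of_rV R d).
Proof. by move=> _ B mB; rewrite setTI; exists B => //; rewrite setTI. Qed.

Lemma measurable_coord (i : 'I_d) : measurable_fun setT (fun x : V => x ord0 i).
Proof.
rewrite (_ : (fun _ => _) = (@tnth d mR ^~ i) \o @tuple_of_rV R d); last first.
  by apply/funext => x /=; rewrite tnth_mktuple.
by apply: measurableT_comp; [exact: measurable_tnth | exact: measurable_tuple_of_rV].
Qed.

Lemma measurable_fun_rV d' (T : measurableType d') (f : T -> V) :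
  (forall i, measurable_fun setT (fun t => f t ord0 i)) -> measurable_fun setT f.
Proof.
move=> mf; have mtf : measurable_fun setT (@tuple_of_rV R d \o f).
  apply/measurable_fun_tnthP => i.
  rewrite (_ : (fun t => tnth t i) \o (@tuple_of_rV R d \o f) = fun t => f t ord0 i); first exact: mf.
  by apply/funext => t /=; rewrite tnth_mktuple.
by move=> _ _ [B mB <-]; rewrite !setTI -comp_preimage -[X in measurable X]setTI; exact: mtf.
Qed.

Lemma measurable_translate (v : V) : measurable_fun setT (fun x : V => x + v).
Proof.
apply: measurable_fun_rV => i; under eq_fun do rewrite mxE.
by apply: measurable_funD => //; exact: measurable_coord.
Qed.

Lemma lebesgue_rV_translate (v : V) A : measurable A ->
  mu ((fun x : V => x + v) @^-1` A) = mu A.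
Proof.
move=> mA; rewrite /lebesgue_rV /pushforward.
have mB : measurable (@rV_of_tuple R d @^-1` A).
  by rewrite -[X in measurable X]setTI; exact: measurable_rV_of_tuple.
rewrite -[RHS](lebesgue_tuple_add (tuple_of_rV v) mB).
have E x : rV_of_tuple (tuple_add (tuple_of_rV v) x) = rV_of_tuple x + v.
  by apply/rowP => i; rewrite !mxE !tnth_mktuple.
by congr (lebesgue_tuple d _); apply/seteqP; split => x; rewrite /= E.
Qed.

Lemma ge0_integral_translate (v : V) (f : V -> \bar R) :
  measurable_fun setT f -> (forall x, 0 <= f x)%E ->
  (\int[mu]_x f (x + v)%R = \int[mu]_x f x)%E.
Proof.
move=> mf f0; pose mt := isMeasurableFun.Build _ _ _ _ _ (measurable_translate v).
pose t : {mfun V >-> V} := HB.pack (fun x : V => x + v) mt.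
rewrite -(@ge0_integral_pushforward _ _ _ _ _ t _ mu setT f)//.
by apply: eq_measure_integral => //= B mB _; exact: lebesgue_rV_translate.
Qed.

Lemma Rintegral_translate (v : V) (f : V -> R) :
  measurable_fun setT f -> \int[mu]_x f (x + v) = \int[mu]_x f x.
Proof.
move=> mf; rewrite /Rintegral; congr fine; have meF : measurable_fun setT (EFin \o f).
  exact/measurable_EFinP.
rewrite integralE [in RHS]integralE; congr (_ - _)%E.
  transitivity (\int[mu]_x (EFin \o f)^\+ (x + v)%R)%E.
    by apply: eq_integral => x _; rewrite !funeposE.
  by apply: ge0_integral_translate => //; exact: measurable_funepos.
transitivity (\int[mu]_x (EFin \o f)^\- (x + v)%R)%E.
  by apply: eq_integral => x _; rewrite !funenegE.
by apply: ge0_integral_translate => //; exact: measurable_funeneg.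
Qed.

(** Countably many boxes forming a base of the topology; they link the topology of the maximum norm
    to the sigma-algebra generated by the coordinates. *)
Definition rat_box (q : 'rV[rat]_d) (n : nat) : set V :=
  [set x | forall i, `|x ord0 i - ratr (q ord0 i)| < n.+1%:R^-1].

Lemma measurable_rat_box q n : measurable (rat_box q n).
Proof.
rewrite (_ : rat_box q n = \bigcap_(i in [set: 'I_d])
    [set x : V | `|x ord0 i - ratr (q ord0 i)| < n.+1%:R^-1]); last first.
  by apply/seteqP; split => x /= h; [move=> i _; exact: h | move=> i; exact: h].
apply: fin_bigcap_measurable => // i _.
rewrite (_ : [set _ | _] = (fun x : V => x ord0 i) @^-1` ball (ratr (q ord0 i) : R) n.+1%:R^-1); last first.
  by apply/seteqP; split => x; rewrite /ball/= distrC.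
by rewrite -[X in measurable X]setTI; apply: measurable_coord => //; exact: measurable_ball.
Qed.

Lemma open_measurable_rV (U : set V) : open U -> measurable U.
Proof.
move=> oU.
have -> : U = \bigcup_(p in [set: 'rV[rat]_d * nat])
    (if `[< rat_box p.1 p.2 `<=` U >] then rat_box p.1 p.2 else set0).
  apply/seteqP; split => x; last first.
    by move=> [p _]; case: asboolP => // sU /sU.
  move=> Ux; have /nbhs_ballP[e /= e0 exU] : nbhs x U by exact: open_nbhs_nbhs.
  (* Twice this radius stays below [e]: once for the distance from [x] to the centre, once for the
     distance from the centre to another point of the box. *)
  have [n ne] : exists n, n.+1%:R^-1 < e / 2.
    exists (Num.bound (e / 2)^-1); have e20 : 0 < e / 2 by rewrite divr_gt0.
    rewrite invf_plt ?posrE ?ltr0n//; apply: lt_le_trans (archi_boundP _) _.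
      by rewrite invr_ge0 ltW.
    by rewrite ler_nat.
  have n0 : 0 < n.+1%:R^-1 :> R by rewrite invr_gt0.
  have hq i : exists q : rat, `|x ord0 i - ratr q| < n.+1%:R^-1.
    have [|q] := @rat_in_itvoo R (x ord0 i - n.+1%:R^-1) (x ord0 i + n.+1%:R^-1).
      by rewrite ltrD2l (lt_trans _ n0)// oppr_lt0.
    by rewrite in_itv /= => /andP[h1 h2]; exists q; rewrite ltr_distlC h1 h2.
  have [q xq] := choice hq.
  have xb : rat_box (\row_i q i) n x by move=> i; rewrite mxE.
  exists (\row_i q i, n) => //=; case: asboolP => // -[] y yb; apply: exU.
  split => // i j; rewrite ord1 /ball/=.
  have := xq j; have := yb j; rewrite mxE => h1 h2.
  rewrite (le_lt_trans (ler_distD (ratr (q j)) _ _))//.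
  by rewrite (splitr e) ltrD//; [exact: lt_trans h2 ne|rewrite distrC (lt_trans h1 ne)].
apply: countable_bigcupT_measurable; first exact: countableP.
by move=> p; case: ifP => // _; exact: measurable_rat_box.
Qed.

Lemma continuous_measurable_rV (f : V -> R) :
  continuous f -> measurable_fun setT f.
Proof.
move=> /continuousP cf; apply: (measurability _ (RGenOpens.measurableE R)).
move=> _ [_ [a [b ->] <-]]; rewrite setTI; apply: open_measurable_rV.
exact/cf/interval_open.
Qed.

Lemma measurable_sqnorm : measurable_fun setT (@sqnorm R d).
Proof.
rewrite /sqnorm (_ : (fun _ => _) = \sum_(i < d) (fun x : V => x ord0 i ^+ 2)); last first.
  by apply/funext => x; rewrite fct_sumE.
apply: (big_ind (fun f : V -> R => measurable_fun setT f)).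
- exact: measurable_cst.
- by move=> f g mf mg; exact: measurable_funD.
- by move=> i _; apply: measurable_funX; exact: measurable_coord.
Qed.

Lemma measurable_unit_ball : measurable (@unit_ball R d).
Proof.
rewrite (_ : unit_ball = @sqnorm R d @^-1` `]-oo, 1[%classic); last first.
  by apply/seteqP; split => x; rewrite /unit_ball /= in_itv.
by rewrite -[X in measurable X]setTI; exact: measurable_sqnorm.
Qed.

Lemma measurable_weight alpha : measurable_fun setT (@weight R d alpha).
Proof.
apply: (measurableT_comp (f := fun t : R => t `^ alpha)); first exact: measurable_powR.
by apply: measurable_funB => //; exact: measurable_sqnorm.
Qed.

End measure_rV.

(** The box is the product of an interval and a box of one dimension less; dimension 0 carries a
    Dirac mass. *)
Lemma lebesgue_tuple_box {R : realType} (d : nat) (c : R) :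
  (lebesgue_tuple d [set t : d.-tuple (measurableTypeR R) |
     forall i, (`|tnth t i : R| <= c)%R] < +oo)%E.
Proof.
elim: d => [|d IH].
  by rewrite /= diracE; case: (_ \in _); rewrite ltry.
rewrite /= /lebesgue_cons /pushforward.
rewrite (_ : _ @^-1` _ = `[- c, c]%classic `*` [set t | forall i, (`|tnth t i : R| <= c)%R]).
  rewrite product_measure1E//; last first.
    rewrite (_ : [set _ | _] = \bigcap_(i in [set: 'I_d])
       ((@tnth d (measurableTypeR R) ^~ i) @^-1` `[- c, c]%classic)).
      apply: fin_bigcap_measurable => // i _.
      by rewrite -[X in measurable X]setTI; apply: measurable_tnth.
    apply/seteqP; split => t /= h; first by move=> i _; rewrite /= in_itv/= -ler_norml.
    by move=> i; have := h i I; rewrite /= in_itv/= -ler_norml.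
  apply: lte_mul_pinfty; [exact: measure_ge0| |exact: IH].
  by rewrite /= lebesgue_measure_itv/=; case: ifP => //; rewrite -EFinB.
apply/seteqP; split => -[a t] /=; rewrite in_itv/= -ler_norml.
  move=> h; split; first by have := h ord0; rewrite /consT tnth0.
  by move=> i; have := h (lift ord0 i); rewrite /consT tnthS.
by move=> [h1 h2] i; case: (unliftP ord0 i) => [j|] ->; rewrite /consT ?tnth0 ?tnthS.
Qed.

Definition box {R : realType} {d} (c : R) : set 'rV[R]_d :=
  [set x | forall i, `|x ord0 i| <= c].

Lemma measurable_box {R : realType} {d} (c : R) : measurable (@box R d c).
Proof.
rewrite (_ : box c = \bigcap_(i in [set: 'I_d])
   ((fun x : 'rV[R]_d => x ord0 i) @^-1` `[- c, c]%classic)).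
  apply: fin_bigcap_measurable => // i _.
  by rewrite -[X in measurable X]setTI; exact: measurable_coord.
apply/seteqP; split => t /= h; first by move=> i _; rewrite /= in_itv/= -ler_norml.
by move=> i; have := h i I; rewrite /= in_itv/= -ler_norml.
Qed.

Lemma lebesgue_rV_box {R : realType} {d} (c : R) : (lebesgue_rV (@box R d c) < +oo)%E.
Proof.
rewrite /lebesgue_rV /pushforward; apply: le_lt_trans (lebesgue_tuple_box d c).
rewrite le_eqVlt; apply/orP; left; apply/eqP; congr (lebesgue_tuple d _).
by apply/seteqP; split => t /= h i; have := h i; rewrite mxE.
Qed.

Lemma sqnorm_ge0 {R : realType} {d} (x : 'rV[R]_d) : 0 <= sqnorm x.
Proof. by apply: sumr_ge0 => i _; exact: sqr_ge0. Qed.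

Lemma sqr_coord_le {R : realType} {d} (x : 'rV[R]_d) i : x ord0 i ^+ 2 <= sqnorm x.
Proof.
by rewrite /sqnorm (bigD1 i)//= lerDl; apply: sumr_ge0 => j _; exact: sqr_ge0.
Qed.

Lemma unit_ball_coord {R : realType} {d} (x : 'rV[R]_d) i :
  unit_ball x -> `|x ord0 i| < 1.
Proof.
rewrite /unit_ball /= => x1; rewrite -(@ltr_pXn2r _ 2)//; last by rewrite nnegrE.
by rewrite real_normK ?num_real// expr1n (le_lt_trans (sqr_coord_le _ _)).
Qed.

Lemma unit_ball_box {R : realType} {d} : @unit_ball R d `<=` box 1.
Proof. by move=> x x1 i; exact/ltW/unit_ball_coord. Qed.

Lemma lebesgue_rV_ball {R : realType} {d} : (lebesgue_rV (@unit_ball R d) < +oo)%E.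
Proof.
apply: le_lt_trans (@lebesgue_rV_box R d 1); apply: le_measure; rewrite ?inE.
- exact: measurable_unit_ball.
- exact: measurable_box.
- exact: unit_ball_box.
Qed.

(** * Integrability and convergence for real-valued functions *)

Section real_dominated_convergence.
Context dT (T : measurableType dT) (R : realType) (mu : {measure set T -> \bar R}).

Lemma dominated_convergence_Rintegral (D : set T) (f_ : nat -> T -> R) (f g : T -> R) :
  measurable D -> (forall n, measurable_fun D (f_ n)) ->
  (forall x, D x -> f_ ^~ x @ \oo --> f x) ->
  mu.-integrable D (EFin \o g) -> (forall n x, D x -> `|f_ n x| <= g x) ->
  mu.-integrable D (EFin \o f) /\
  \int[mu]_(x in D) f_ n x @[n --> \oo] --> \int[mu]_(x in D) f x.
Proof.
move=> mD mf_ ff ig fg.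
have mf : measurable_fun D f by exact: (measurable_fun_cvg _ ff).
have [//|||||if_ _ cf] := @dominated_convergence _ _ _ mu D mD
  (fun n => EFin \o f_ n) (EFin \o f) (EFin \o g) => //.
- by move=> n; exact/measurable_EFinP.
- exact/measurable_EFinP.
- by apply: aeW => x Dx; apply: cvg_EFin; [exact: nearW|exact: ff].
- by apply: aeW => x n Dx; rewrite /= lee_fin; exact: fg.
split=> //; apply: fine_cvg; rewrite fineK//.
exact: integrable_fin_num.
Qed.

Lemma bounded_integrable (D : set T) (f : T -> R) (M : R) : measurable D ->
  (mu D < +oo)%E -> measurable_fun D f -> (forall x, D x -> `|f x| <= M) ->
  mu.-integrable D (EFin \o f).
Proof.
move=> mD Dfin mf fM; apply: measurable_bounded_integrable => //.
exists M; split; first exact: num_real.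
by move=> N MN x Dx; exact/ltW/(le_lt_trans (fM _ Dx)).
Qed.

Lemma integrable_le (D : set T) (f g : T -> R) : measurable D ->
  measurable_fun D f -> mu.-integrable D (EFin \o g) ->
  (forall x, D x -> `|f x| <= g x) -> mu.-integrable D (EFin \o f).
Proof.
move=> mD mf ig fg; apply: (le_integrable mD _ _ ig); first exact/measurable_EFinP.
by move=> x Dx /=; rewrite lee_fin (le_trans (fg x Dx))// ler_norm.
Qed.

Lemma integrable_sum_EFin (D : set T) (I : Type) (s : seq I) (f : I -> T -> R) :
  measurable D -> (forall i, mu.-integrable D (EFin \o f i)) ->
  mu.-integrable D (EFin \o (fun x => \sum_(i <- s) f i x)).
Proof.
move=> mD fi; have := @integrable_sum _ _ _ mu D mD _ s xpredT (fun i => EFin \o f i).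
move=> /(_ (fun i _ => fi i)); congr (is_true (mu.-integrable D _)).
by apply/funext => x /=; rewrite sumEFin.
Qed.

Lemma Rintegral_sum (D : set T) (I : Type) (s : seq I) (f : I -> T -> R) :
  measurable D -> (forall i, mu.-integrable D (EFin \o f i)) ->
  \int[mu]_(x in D) (\sum_(i <- s) f i x) = \sum_(i <- s) \int[mu]_(x in D) f i x.
Proof.
move=> mD fi; elim: s => [|i s IH].
  by under eq_Rintegral do rewrite big_nil; rewrite big_nil Rintegral_cst// mul0r.
under eq_Rintegral do rewrite big_cons.
rewrite RintegralD//; last exact: integrable_sum_EFin.
by rewrite IH big_cons.
Qed.

Lemma integrable_EFinZ (D : set T) (k : R) (f : T -> R) : measurable D ->
  mu.-integrable D (EFin \o f) -> mu.-integrable D (EFin \o (fun x => k * f x)).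
Proof. by move=> mD fi; exact: (integrableZl mD k fi). Qed.

Lemma integrable_EFinD (D : set T) (f g : T -> R) : measurable D ->
  mu.-integrable D (EFin \o f) -> mu.-integrable D (EFin \o g) ->
  mu.-integrable D (EFin \o (fun x => f x + g x)).
Proof. by move=> mD fi gi; exact: (integrableD mD fi gi). Qed.

Lemma integrable_EFinB (D : set T) (f g : T -> R) : measurable D ->
  mu.-integrable D (EFin \o f) -> mu.-integrable D (EFin \o g) ->
  mu.-integrable D (EFin \o (fun x => f x - g x)).
Proof. by move=> mD fi gi; exact: (integrableB mD fi gi). Qed.

End real_dominated_convergence.

(** The sequence [1/(n+1)] tends to 0 without reaching it, so a derivative, which is a limit at
    [0^'], becomes the limit of a sequence and dominated convergence applies. *)
Lemma cvg_harmonic_dnbhs {R : realType} : @harmonic R @ \oo --> 0^'.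
Proof.
move=> A /(@cvg_harmonic R) hA.
apply: (@filterS _ \oo _ (fun n => @harmonic R n != 0 -> A (harmonic n))) hA => n.
by apply; rewrite /harmonic /= invr_eq0 pnatr_eq0.
Qed.

Lemma integrable_box {R : realType} {d} (c : R) :
  (@lebesgue_rV R d).-integrable setT (EFin \o \1_(@box R d c)).
Proof.
apply/integrableP; split.
  by apply/measurable_EFinP; apply: measurable_indic; exact: measurable_box.
under eq_integral do rewrite /= ger0_norm//.
by rewrite integral_indic ?setIT//; [exact: lebesgue_rV_box|exact: measurable_box].
Qed.

(** * The integral of a partial derivative over the ball *)

Section integral_of_derivative.
Context {R : realType} {d : nat}.
Local Notation V := 'rV[R]_d.
Local Notation mu := (@lebesgue_rV R d).
Local Notation B := (@unit_ball R d).

Lemma derivable_line (psi : V -> R) (v x : V) (s : R) :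
  derivable psi (s *: v + x) v ->
  is_derive s 1 (fun t : R => psi (t *: v + x)) ('D_v psi (s *: v + x)).
Proof.
move=> h.
have E : (fun h : R => h^-1 *: (((fun t : R => psi (t *: v + x)) \o shift s) (h *: (1 : R)) - psi (s *: v + x)))
   = (fun h : R => h^-1 *: ((psi \o shift (s *: v + x)) (h *: v) - psi (s *: v + x))).
  by apply/funext => t /=; rewrite [t *: 1]mulr1 scalerDl addrA.
by split; rewrite /derivable /derive E.
Qed.

(** The mean value theorem along a segment; it bounds all difference quotients by one constant. *)
Lemma lipschitz_line (psi : V -> R) (v : V) (M : R) :
  (forall x, derivable psi x v) -> (forall x, `|'D_v psi x| <= M) ->
  forall x (t : R), 0 <= t -> `|psi (x + t *: v) - psi x| <= M * t.
Proof.
move=> dpsi DM x t t0.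
pose f (s : R) := psi (s *: v + x).
have df (s : R) : is_derive s (1 : R) f ('D_v psi (s *: v + x)) by exact: derivable_line.
have [|c _] := @MVT_segment _ f (fun s => 'D_v psi (s *: v + x)) 0 t t0.
  apply: continuous_subspaceT => s; apply: differentiable_continuous.
  by apply/derivable1_diffP; have [] := df s.
rewrite /f scale0r add0r subr0 [_ *: v + x]addrC => ->.
by rewrite normrM (ger0_norm t0) ler_wpM2r.
Qed.

(* Translation invariance makes every difference quotient integrate to [0]. *)
Lemma Rintegral_derive0 (psi : V -> R) (j : 'I_d) (M : R) :
  (forall x, derivable psi x 'e_j) -> measurable_fun setT psi ->
  (forall x, `|'D_'e_j psi x| <= M) ->
  (forall x, ~ B x -> psi x = 0) -> (forall x, ~ B x -> 'D_'e_j psi x = 0) ->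
  mu.-integrable B (EFin \o (fun x => 'D_'e_j psi x)) /\
  \int[mu]_(x in B) 'D_'e_j psi x = 0.
Proof.
move=> dpsi mpsi DM psi0 Dpsi0.
pose v : V := 'e_j.
have lip := lipschitz_line dpsi DM.
have M0 : 0 <= M by apply: le_trans (DM 0); rewrite normr_ge0.
have vj : v ord0 j = 1 by rewrite /v mxE !eqxx.
(* A step of length 2 along ['e_j] changes the coordinate [j] by 2 and so leaves the ball, where
   [psi] is 0. *)
have psiM x : `|psi x| <= M * 2.
  have [Bx|/psi0 ->] := pselect (B x); last by rewrite normr0 mulr_ge0.
  have := lip x 2 (ler0n _ _); rewrite psi0 ?sub0r ?normrN// => B2.
  have := unit_ball_coord j B2; have := unit_ball_coord j Bx.
  by rewrite !mxE -/v !eqxx mulr1 !ltr_norml => /andP[? ?] /andP[? ?]; lra.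
pose h n (x : V) : R := n.+1%:R * (psi (x + n.+1%:R^-1 *: v) - psi x).
have mtr n : measurable_fun setT (fun x : V => psi (x + n.+1%:R^-1 *: v)).
  by apply: (measurableT_comp mpsi); exact: measurable_translate.
have mh n : measurable_fun setT (h n).
  by apply: measurable_funM => //; exact: measurable_funB.
have hcvg x : h ^~ x @ \oo --> 'D_v psi x.
  have /cvg_ex[l hl] := dpsi x.
  have -> : 'D_v psi x = l by apply/cvg_lim.
  rewrite (_ : h ^~ x =
    (fun t : R => t^-1 *: ((psi \o shift x) (t *: v) - psi x)) \o @harmonic R).
    exact: cvg_comp cvg_harmonic_dnbhs hl.
  by apply/funext => n /=; rewrite /h /harmonic /= invrK [_ + x]addrC.
(* The steps have length at most 1 and [psi] vanishes outside the unit box, so every difference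
   quotient vanishes outside the box of radius 2. *)
pose g := fun x : V => M * \1_(@box R d 2) x.
have hg n x : setT x -> `|h n x| <= g x.
  move=> _; have n0 : (0 : R) <= n.+1%:R^-1 by rewrite invr_ge0.
  have n1 : n.+1%:R^-1 <= 1 :> R by rewrite invf_le1 ?ler1n ?ltr0n.
  rewrite /g indicE; case: (boolP (x \in _)) => xb.
    rewrite mulr1 /h normrM ger0_norm//.
    by rewrite mulrC -ler_pdivlMr ?ltr0n//; exact: lip.
  rewrite mulr0 /h !psi0 ?subrr ?mulr0 ?normr0//.
    move=> /unit_ball_box xb1; move: xb; rewrite notin_setE; apply => i.
    by apply: le_trans (xb1 i) _; rewrite ler1n.
  move=> xb1; move: xb; rewrite notin_setE; apply => i.
  have := unit_ball_coord i xb1; rewrite !mxE /=; set e := _^-1 * _ => xe.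
  have /andP[e0 e1] : 0 <= e <= 1.
    by rewrite /e; case: eqP => _; rewrite ?mulr1 ?mulr0 ?n0 ?n1 ?lexx ?ler01.
  by move: xe; rewrite ltr_norml ler_norml => /andP[? ?]; apply/andP; split; lra.
have ig : mu.-integrable setT (EFin \o g).
  apply: integrable_EFinZ => //.
  exact: integrable_box.
have ipsi : mu.-integrable setT (EFin \o psi).
  apply: (@integrable_le _ _ _ mu setT psi (fun x => M * 2 * \1_(@box R d 2) x)) => //.
    apply: integrable_EFinZ => //.
    exact: integrable_box.
  move=> x _; rewrite indicE; case: (boolP (x \in _)) => xb; first by rewrite mulr1.
  rewrite mulr0 psi0 ?normr0// => /unit_ball_box xb1; move: xb; rewrite notin_setE; apply => i.
  by apply: le_trans (xb1 i) _; rewrite ler1n.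
have itr n : mu.-integrable setT (EFin \o (fun x : V => psi (x + n.+1%:R^-1 *: v))).
  have E : (\int[mu]_x `|(psi (x + n.+1%:R^-1 *: v))%:E| = \int[mu]_x `|(psi x)%:E|)%E.
    apply: (@ge0_integral_translate R d _ (fun x => `|(psi x)%:E|)%E) => //.
    by apply: measurableT_comp => //; exact/measurable_EFinP.
  apply/integrableP; split; first exact/measurable_EFinP.
  by rewrite /= E; have /integrableP[_] := ipsi.
have h0 n : \int[mu]_x h n x = 0.
  rewrite /h RintegralZl//; last exact: integrable_EFinB.
  by rewrite RintegralB// Rintegral_translate// subrr mulr0.
have [iD cD] := dominated_convergence_Rintegral (mu := mu) measurableT mh (fun x _ => hcvg x) ig hg.
have D0 : \int[mu]_x 'D_v psi x = 0.
  rewrite -(cvg_lim _ cD)//; under eq_fun do rewrite h0.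
  by rewrite lim_cst.
split; first by apply: (integrableS measurableT _ _ iD) => //; exact: measurable_unit_ball.
rewrite Rintegral_mkcond -[RHS]D0; apply: eq_Rintegral => x _.
by rewrite patchE; case: ifPn => //; rewrite notin_setE => /Dpsi0.
Qed.

End integral_of_derivative.

(** * Polynomials as functions on row vectors *)

Section polynomial_functions.
Context {R : realType} {d : nat}.
Local Notation V := 'rV[R]_d.
Local Notation poly := (mpoly d R).
Local Notation "'X_ i" := (@mpolyX d R (mnm1 i)) (at level 8, i at level 2).

(** Building monomials one variable at a time reduces analytic facts about [peval] to the product
    rule with a coordinate. *)
Lemma mpoly_indX (K : poly -> Prop) :
  (forall c, K (mpolyC _ c)) -> (forall i p, K p -> K ('X_i * p)) ->
  (forall p q, K p -> K q -> K (p + q)) -> forall p, K p.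
Proof.
move=> KC KX KD; have KZ (m : multinom d) c : K (c *: mpolyX _ m).
  elim: {m}(mdeg m) {-2}m (erefl (mdeg m)) => [|k IH] m mk.
    move/eqP: mk; rewrite mdeg_eq0 => /eqP ->.
    by rewrite mpolyX0 alg_mpolyC; exact: KC.
  have [i mi] : exists i, (0 < m i)%N.
    apply/existsP; apply: contra_eqT mk; rewrite negb_exists => /forallP h.
    rewrite mdegE big1 // => i _; by have := h i; rewrite -eqn0Ngt => /eqP.
  have mE : m = mnm_add (mnm1 i) (mnm_sub m (mnm1 i)).
    by rewrite addmC submK// lep1mP -lt0n.
  rewrite mE mpolyXD -mul_mpolyC mulrCA mul_mpolyC; apply/KX/IH.
  by move: mk; rewrite {1}mE mdegD mdeg1 add1n => -[].
elim/mpolyind => [|c m p _ _ Kp]; first by rewrite -mpolyC0; exact: KC.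
by apply: KD.
Qed.

Lemma mderivXU (i k : 'I_d) : mderiv i ('X_k) = (i == k)%:R :> poly.
Proof.
rewrite mderivX mnm1E eq_sym; case: eqVneq => [->|ij]; last by rewrite scale0r.
by rewrite -{1}[mnm1 k]add0m addmK mpolyX0 scale1r.
Qed.

Definition peval (p : poly) (x : V) : R := meval (fun i => x ord0 i) p.

Lemma pevalD p q x : peval (p + q) x = peval p x + peval q x.
Proof. exact: mevalD. Qed.
Lemma pevalM p q x : peval (p * q) x = peval p x * peval q x.
Proof. exact: mevalM. Qed.
Lemma pevalN p x : peval (- p) x = - peval p x.
Proof. exact: mevalN. Qed.
Lemma pevalB p q x : peval (p - q) x = peval p x - peval q x.
Proof. exact: mevalB. Qed.
Lemma pevalZ c p x : peval (c *: p) x = c * peval p x.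
Proof. exact: mevalZ. Qed.
Lemma pevalC c x : peval (mpolyC _ c) x = c.
Proof. exact: mevalC. Qed.
Lemma peval0 x : peval 0 x = 0.
Proof. exact: meval0. Qed.
Lemma peval1 x : peval 1 x = 1.
Proof. exact: meval1. Qed.
Lemma pevalX i x : peval ('X_i) x = x ord0 i.
Proof. exact: mevalXU. Qed.
Lemma peval_sum (I : Type) (r : seq I) (P : pred I) (F : I -> poly) x :
  peval (\sum_(i <- r | P i) F i) x = \sum_(i <- r | P i) peval (F i) x.
Proof. exact: (big_morph (fun p => peval p x) (fun p q => pevalD p q x) (peval0 x)). Qed.

Definition pevalE := (pevalD, pevalM, pevalN, pevalB, pevalZ, pevalC, peval0, peval1, pevalX).

Lemma is_derive_coord (i : 'I_d) (x v : V) :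
  is_derive x v (fun y : V => y ord0 i) (v ord0 i).
Proof.
have dx : derivable (@id V) x v by exact: derivable_id.
have := (derivable_mxP id x v).1 dx ord0 i; split=> //.
by have := derive_mx dx; rewrite derive_id => {2}->; rewrite mxE.
Qed.

Lemma is_derive_peval (p : poly) (j : 'I_d) (x : V) :
  is_derive x 'e_j (peval p) (peval (mderiv j p) x).
Proof.
elim/mpoly_indX: p => [c|i p IH|p q IHp IHq].
- rewrite mderivC peval0 (_ : peval _ = cst c); first exact: is_derive_cst.
  by apply/funext => y; rewrite pevalC.
- rewrite (_ : peval ('X_i * p) = (fun y : V => y ord0 i) * peval p); last first.
    by apply/funext => y; rewrite pevalM pevalX.
  apply: is_derive_eq; first exact: (is_deriveM (is_derive_coord i x 'e_j)).
  rewrite mderivM mderivXU !pevalE addrC; congr (_ + _).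
  rewrite mxE eqxx /= [in LHS]eq_sym.
  by case: (j == i); rewrite ?peval0 ?peval1 ?mul0r ?mul1r [_ *: _]mulrC ?mul0r ?mul1r.
- rewrite (_ : peval (p + q) = peval p + peval q); last first.
    by apply/funext => y; rewrite pevalD.
  by rewrite mderivD pevalD; exact: is_deriveD.
Qed.

Lemma differentiable_peval (p : poly) (x : V) : differentiable (peval p) x.
Proof.
elim/mpoly_indX: p => [c|i p IH|p q IHp IHq].
- by rewrite (_ : peval _ = cst c)//; apply/funext => y; rewrite pevalC.
- rewrite (_ : peval ('X_i * p) = (fun y : V => y ord0 i) * peval p); last first.
    by apply/funext => y; rewrite pevalM pevalX.
  by apply: differentiableM => //; exact: differentiable_coord.
- rewrite (_ : peval (p + q) = peval p + peval q); last first.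
    by apply/funext => y; rewrite pevalD.
  exact: differentiableD.
Qed.

Lemma continuous_peval (p : poly) : continuous (peval p).
Proof. by move=> x; exact/differentiable_continuous/differentiable_peval. Qed.

Lemma measurable_peval (p : poly) : measurable_fun setT (peval p).
Proof. exact/continuous_measurable_rV/continuous_peval. Qed.

Lemma compact_box (c : R) : compact (@box R d c).
Proof.
have := @rV_compact R d (fun=> `[- c, c]%classic) (fun=> @segment_compact _ _ _).
congr compact; apply/seteqP; split => x /= h i; have := h i;
  by rewrite /= in_itv/= -ler_norml.
Qed.

Lemma continuous_bounded_box (f : V -> R) c : 0 <= c -> continuous f ->
  exists M, forall x, box c x -> `|f x| <= M.
Proof.
move=> c0 cf; have [||a _ h] := @EVT_max_rV _ _ (fun x => `|f x|) _ _ (@compact_box c).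
- by exists 0 => i; rewrite mxE normr0.
- apply: continuous_subspaceT => x; apply: continuous_comp; first exact: cf.
  exact: norm_continuous.
by exists `|f a| => x xc; apply: h; rewrite inE.
Qed.

Lemma peval_bounded (p : poly) :
  exists M, forall x, unit_ball x -> `|peval p x| <= M.
Proof.
have [M h] := continuous_bounded_box ler01 (@continuous_peval p).
by exists M => x /unit_ball_box; exact: h.
Qed.

Definition psq : poly := \sum_(i < d) 'X_i * 'X_i.

Lemma peval_psq x : peval psq x = sqnorm x.
Proof. by rewrite peval_sum; apply: eq_bigr => i _; rewrite !pevalE. Qed.

Lemma mderiv_psq j : mderiv j psq = 2 *: 'X_j.
Proof.
rewrite /psq (big_morph _ (mderivD j) (mderiv0 _ j)) (bigD1 j)//= big1 => [|i ij].
  by rewrite mderivM !mderivXU eqxx mul1r mulr1 addr0 scaler_nat mulr2n.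
by rewrite mderivM !mderivXU eq_sym (negPf ij) mul0r mulr0 addr0.
Qed.

End polynomial_functions.

(** * Flat functions and cutoffs *)

Section cutoff.
Context {R : realType}.
Implicit Types (dl b s t : R) (n k : nat).

(** With [y = dl / t] this is the [k]-th power of [y / k <= expR (y / k)]. *)
Lemma powV_expR_le dl k t : 0 < dl -> 0 < t ->
  t^-1 ^+ k * expR (- (dl / t)) <= (k%:R / dl) ^+ k.
Proof.
move=> dl0 t0; case: k => [|k].
  by rewrite !expr0 mul1r -expR0 ler_expR oppr_le0 divr_ge0 ?ltW.
have x0 : 0 < dl / t by rewrite divr_gt0.
have h : t^-1 <= k.+1%:R / dl * expR (dl / t / k.+1%:R).
  apply: (@le_trans _ _ (k.+1%:R / dl * (dl / t / k.+1%:R))).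
    rewrite le_eqVlt; apply/orP; left; apply/eqP; field.
    by rewrite !gt_eqF ?ltr0n// addrC natr1 pnatr_eq0.
  apply: ler_wpM2l; first by rewrite divr_ge0 ?ltW.
  by apply: le_trans (expR_ge1Dx _); rewrite lerDr.
rewrite expRN ler_pdivrMr ?expR_gt0//.
have -> : expR (dl / t) = expR (dl / t / k.+1%:R) ^+ k.+1.
  by rewrite -expRM_natr divfK// pnatr_eq0.
rewrite -exprMn; apply: lerXn2r => //; rewrite nnegrE; first by rewrite invr_ge0 ltW.
by apply: le_trans h; rewrite invr_ge0 ltW.
Qed.

(** The classical function that is flat at 0, with a negative power of [t] carried along:
    differentiation leads from exponent [n] to [n.+1] and [n.+2], so the family is closed under
    it. *)
Definition flat dl n t : R := if 0 < t then t^-1 ^+ n * expR (- (dl / t)) else 0.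

(** The exponential absorbs [k] further negative powers, and these are traded for the factor
    [t ^+ k]; the case [k = 2] settles differentiability at 0. *)
Lemma flat_le dl n k t : 0 < dl -> 0 <= t ->
  flat dl n t <= ((n + k)%:R / dl) ^+ (n + k) * t ^+ k.
Proof.
move=> dl0 t0; rewrite /flat; case: ifPn => [tp|_]; last first.
  by rewrite mulr_ge0 ?exprn_ge0 ?divr_ge0// ?ltW.
have := powV_expR_le (n + k) dl0 tp.
rewrite -(ler_pM2r (exprn_gt0 k tp)); apply: le_trans.
rewrite le_eqVlt; apply/orP; left; apply/eqP.
have tk : t^-1 ^+ k * t ^+ k = 1 by rewrite -exprMn mulVf ?gt_eqF// expr1n.
by rewrite -[LHS]mulr1 -tk exprD; ring.
Qed.

Lemma flat_ge0 dl n t : 0 <= flat dl n t.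
Proof.
rewrite /flat; case: ifP => // t0.
by rewrite mulr_ge0 ?expR_ge0// exprn_ge0// invr_ge0 ltW.
Qed.

Lemma flat_npos dl n t : t <= 0 -> flat dl n t = 0.
Proof. by rewrite leNgt /flat => /negbTE ->. Qed.

Lemma is_derive_flat dl n t : 0 < dl ->
  is_derive t 1 (flat dl n) (- n%:R * flat dl n.+1 t + dl * flat dl n.+2 t).
Proof.
move=> dl0; have [t0|t0|t0] := ltgtP 0 t.
- apply: (@near_eq_is_derive _ _ _ ((fun y : R => y^-1) ^+ n * (expR \o (fun y : R => - dl *: y^-1)))).
    near=> y; rewrite /flat ifT; last by near: y; exact: lt_nbhsr.
    by rewrite [LHS]/(_ * _) fctE; congr (_ * expR _); rewrite scaleNr.
  have tn0 : t != 0 by rewrite gt_eqF.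
  have dV : is_derive t 1 (fun y : R => y^-1) (- t ^- 2 *: 1).
    exact: is_deriveV.
  apply: is_derive_eq.
  rewrite /flat t0 !fctE /= scaleNr -[dl *: _]/(dl / t).
  set E := expR _; rewrite -!exprVn; set u := t^-1.
  by rewrite /GRing.scale /=; case: n => [|n] /=; rewrite ?[_ ^+ _.+2]exprS !exprS; ring.
- apply: (@near_eq_is_derive _ _ _ (cst 0)).
    near=> y; rewrite flat_npos//; apply/ltW.
    by near: y; exact: lt_nbhsl.
  rewrite !(flat_npos _ _ (ltW t0)) !mulr0 addr0; exact: is_derive_cst.
- have f0 k : flat dl k 0 = 0 by rewrite flat_npos.
  rewrite -t0 !f0 !mulr0 addr0.
  (* At 0 the bound [C * h ^+ 2] on the function makes the difference quotient at most [C * h]. *)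
  have cv : (fun h : R => h^-1 *: ((flat dl n \o shift 0) (h *: (1 : R)) - flat dl n 0)) @ 0^' --> (0 : R).
    set C := ((n + 2)%:R / dl) ^+ (n + 2).
    have C0 : 0 <= C by rewrite exprn_ge0 ?divr_ge0// ?ltW.
    apply/cvgrPdist_le => e e0 /=.
    have eC : 0 < e / (C + 1) by rewrite divr_gt0// ltr_wpDl.
    near=> h; rewrite sub0r normrN addr0 f0 subr0.
    rewrite [h *: 1]mulr1 -[X in `|X|]/(h^-1 * flat dl n h).
    have he : `|h| <= e / (C + 1) by near: h; apply: dnbhs0_le.
    have [h0|h0] := leP h 0; first by rewrite flat_npos// mulr0 normr0 ltW.
    rewrite normrM gtr0_norm ?invr_gt0// ger0_norm ?flat_ge0//.
    rewrite mulrC ler_pdivrMr//; apply: le_trans (flat_le n 2 dl0 (ltW h0)) _.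
    rewrite -/C expr2 mulrA ler_pM2r//.
    move: he; rewrite gtr0_norm// ler_pdivlMr ?ltr_wpDl//.
    by apply: le_trans; rewrite mulrC ler_pM2l// lerDl.
  by split; [apply/cvg_ex; exists 0 | apply/cvg_lim].
Unshelve. all: by end_near. Qed.

(* [exp (- dl / (s - dl))] cuts the singularity of [s `^ b] at [0] off and
   converges to [1] for every [0 < s] as [dl] decreases to [0]. *)
Definition cutoff dl b n s : R := s `^ b * flat dl n (s - dl).

Lemma cutoff_le dl b n s : s <= dl -> cutoff dl b n s = 0.
Proof. by move=> sdl; rewrite /cutoff flat_npos ?mulr0// subr_le0. Qed.

(** The real power is differentiated at positive [s] only: since [dl] is positive, the cutoff
    vanishes identically near every [s <= 0]. *)
Lemma is_derive_cutoff dl b n s : 0 < dl ->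
  is_derive s 1 (cutoff dl b n)
    (b * cutoff dl (b - 1) n s - n%:R * cutoff dl b n.+1 s + dl * cutoff dl b n.+2 s).
Proof.
move=> dl0; have [s0|s0] := ltP 0 s.
  have d1 := is_derive1_powR b s0.
  have d2 : is_derive s 1 (flat dl n \o (fun y => y - dl))
      ((- n%:R * flat dl n.+1 (s - dl) + dl * flat dl n.+2 (s - dl)) * 1).
    apply: is_derive1_comp; first exact: is_derive_flat.
    exact: (is_derive_shift s 1 (- dl)).
  rewrite (_ : cutoff dl b n = (@powR R ^~ b) * (flat dl n \o (fun y => y - dl)))//.
  apply: is_derive_eq.
  by rewrite /cutoff /GRing.scale /=; ring.
apply: (@near_eq_is_derive _ _ _ (cst 0)).
  near=> y; rewrite cutoff_le//; apply/ltW.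
  by near: y; apply: lt_nbhsl; exact: le_lt_trans dl0.
have sdl : s <= dl by apply: le_trans (ltW dl0).
by rewrite !cutoff_le// !mulr0 subr0 addr0; exact: is_derive_cst.
Unshelve. all: by end_near. Qed.

End cutoff.

(** * The explicit test functions *)

Section test_functions.
Context {R : realType} {d : nat}.
Local Notation V := 'rV[R]_d.
Local Notation poly := (mpoly d R).
Local Notation "'X_ i" := (@mpolyX d R (mnm1 i)) (at level 8, i at level 2).
Local Notation mu := (@lebesgue_rV R d).
Local Notation B := (@unit_ball R d).

Lemma is_derive_compR (g : R -> R) (h : V -> R) (x v : V) (dg dh : R) :
  differentiable h x -> is_derive x v h dh -> is_derive (h x) 1 g dg ->
  is_derive x v (g \o h) (dg * dh).
Proof.
move=> diffh Dh Dg; have dg1 : derivable g (h x) 1 by have [] := Dg.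
have diffg : differentiable g (h x) by apply/derivable1_diffP.
have diffgh : differentiable (g \o h) x by exact: differentiable_comp.
split; first exact: diff_derivable.
rewrite deriveE// diff_comp//= deriv1E// -deriveE//.
by rewrite derive1E (@derive_val _ _ _ _ _ _ _ Dg) (@derive_val _ _ _ _ _ _ _ Dh) [_ *: _]mulrC.
Qed.

(** The polynomial and both exponents are parameters because a partial derivative changes all of
    them, while [dl] stays fixed. *)
Definition bump dl (p : poly) b n (x : V) : R :=
  peval p x * cutoff dl b n (1 - sqnorm x).

Lemma sqnorm_peval (x : V) : 1 - sqnorm x = peval (1 - psq) x.
Proof. by rewrite !pevalE peval_psq. Qed.

Lemma bumpE dl (p : poly) b n :
  bump dl p b n = peval p * (cutoff dl b n \o peval (1 - psq)).
Proof. by apply/funext => y; rewrite /bump sqnorm_peval. Qed.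

Lemma differentiable_bump dl (p : poly) b n x : 0 < dl ->
  differentiable (bump dl p b n) x.
Proof.
move=> dl0; rewrite bumpE; apply: differentiableM; first exact: differentiable_peval.
apply: differentiable_comp; first exact: differentiable_peval.
have D := is_derive_cutoff b n (peval (1 - psq) x) dl0.
by apply/derivable1_diffP; have [] := D.
Qed.

Lemma is_derive_bump dl (p : poly) b n (j : 'I_d) (x : V) : 0 < dl ->
  is_derive x 'e_j (bump dl p b n)
   (bump dl (mderiv j p) b n x + bump dl ((- 2 * b) *: ('X_j * p)) (b - 1) n x
    + bump dl ((2 * n%:R) *: ('X_j * p)) b n.+1 x
    + bump dl ((- 2 * dl) *: ('X_j * p)) b n.+2 x).
Proof.
move=> dl0.
have D1 := is_derive_compR (differentiable_peval (1 - psq) x)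
   (is_derive_peval (1 - psq) j x) (is_derive_cutoff b n (peval (1 - psq) x) dl0).
have Dp := is_derive_peval p j x.
rewrite bumpE; apply: is_derive_eq.
rewrite /bump /= -!sqnorm_peval mderivB mderiv_psq.
rewrite (_ : mderiv j 1 = 0); last by rewrite -mpolyC1 mderivC.
rewrite !pevalE /GRing.scale /=.
move: (cutoff _ _ _ _) (cutoff _ _ _ _) (cutoff _ _ _ _) (cutoff _ _ _ _) => c1 c2 c3 c4.
move: (peval _ x) (peval _ x) (x ord0 j) => P P' X.
by ring.
Qed.

(** A class of differentiable functions closed under partial derivatives, so that differentiability
    of all iterated derivatives follows by induction. *)
Inductive bumpy dl : (V -> R) -> Prop :=
| bumpy_bump p b n : bumpy dl (bump dl p b n)
| bumpy_add f g : bumpy dl f -> bumpy dl g -> bumpy dl (f + g).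

Lemma differentiable_bumpy dl f : 0 < dl -> bumpy dl f -> forall x, differentiable f x.
Proof.
move=> dl0; elim=> [p b n x|g h _ IHg _ IHh x]; last exact: differentiableD.
exact: differentiable_bump.
Qed.

Lemma bumpy_derive dl f (j : 'I_d) : 0 < dl -> bumpy dl f ->
  exists2 g, bumpy dl g & (fun x => 'D_'e_j f x) = g.
Proof.
move=> dl0; elim=> [p b n|g h bg [g' bg' E1] bh [h' bh' E2]].
  exists (bump dl (mderiv j p) b n + bump dl ((- 2 * b) *: ('X_j * p)) (b - 1) n
    + bump dl ((2 * n%:R) *: ('X_j * p)) b n.+1
    + bump dl ((- 2 * dl) *: ('X_j * p)) b n.+2).
    by do !apply: bumpy_add; exact: bumpy_bump.
  by apply/funext => x; have D := is_derive_bump p b n j x dl0; rewrite derive_val.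
exists (g' + h'); first exact: bumpy_add.
rewrite -E1 -E2; apply/funext => x; rewrite deriveD//.
  exact/diff_derivable/(differentiable_bumpy dl0).
exact/diff_derivable/(differentiable_bumpy dl0).
Qed.

Lemma bumpy_supp dl f x : bumpy dl f -> 1 - sqnorm x <= dl -> f x = 0.
Proof.
move=> bf xdl; elim: bf => [p b n|g h _ IHg _ IHh]; last by rewrite -[LHS]/(g x + h x) IHg IHh addr0.
by rewrite /bump cutoff_le// mulr0.
Qed.

(** Compact sets that exhaust the ball as [dl] decreases to 0; supports and local integrability are
    measured against them. *)
Definition inner_ball (dl : R) : set V := [set x | dl <= 1 - sqnorm x].

Lemma closed_inner_ball dl : closed (inner_ball dl).
Proof.
rewrite (_ : inner_ball dl = peval (1 - psq) @^-1` [set t | dl <= t]); last first.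
  by apply/seteqP; split => x; rewrite /inner_ball /= -sqnorm_peval.
by apply: closed_comp; [move=> x _; exact: continuous_peval | exact: closed_ge].
Qed.

Lemma inner_ball_unit_ball dl : 0 < dl -> inner_ball dl `<=` B.
Proof. by move=> dl0 x; rewrite /inner_ball /unit_ball /=; lra. Qed.

Lemma compact_inner_ball dl : 0 < dl -> compact (inner_ball dl).
Proof.
move=> dl0; apply: (subclosed_compact (@closed_inner_ball dl) (@compact_box _ d 1)).
by move=> x /(inner_ball_unit_ball dl0)/unit_ball_box.
Qed.

Lemma test_function_bumpy dl f : 0 < dl -> bumpy dl f -> test_function f.
Proof.
move=> dl0 bf; have sub : closure [set x | f x != 0] `<=` inner_ball dl.
  rewrite [X in _ `<=` X](closure_id _).1; last exact: closed_inner_ball.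
  apply: closure_subset => x /= fx; rewrite /inner_ball /= leNgt.
  by apply: contra fx => /ltW h; rewrite (bumpy_supp bf h).
split.
- move=> s x; suff : bumpy dl (foldr (fun (j : 'I_d) (f : V -> R) => (fun y => 'D_'e_j f y)) f s).
    by move/(differentiable_bumpy dl0).
  by elim: s => //= j s IH; have [g bg ->] := bumpy_derive j dl0 IH.
- exact: (subclosed_compact (@closed_closure _ _) (compact_inner_ball dl0) sub).
- exact: subset_trans sub (inner_ball_unit_ball dl0).
Qed.

Section test_function_props.
Variables (phi : V -> R) (tphi : test_function phi).

Lemma test_function_differentiable x : differentiable phi x.
Proof. by have [/(_ [::])] := tphi. Qed.

Lemma test_function_derive_continuous j : continuous (fun x => 'D_'e_j phi x).
Proof.
by move=> x; apply: differentiable_continuous; have [/(_ [:: j])] := tphi.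
Qed.

Lemma test_function_continuous : continuous phi.
Proof. by move=> x; apply/differentiable_continuous/test_function_differentiable. Qed.

(** The closed support lies in the open ball, so even at a point of the sphere [phi] vanishes on a
    neighbourhood, and its derivatives vanish with it. *)
Lemma test_function_near0 x : ~ B x -> \forall y \near x, phi y = 0.
Proof.
have [_ _ sB] := tphi => nBx.
have : nbhs x (~` closure [set x | phi x != 0]).
  apply: open_nbhs_nbhs; split; last by move=> /sB.
  by apply: closed_openC; exact: closed_closure.
apply: filterS => y ny; apply: contrapT => py; apply: ny.
by apply: subset_closure => /=; exact/eqP.
Qed.

Lemma test_function_out x : ~ B x -> phi x = 0.
Proof. by move/test_function_near0/nbhs_singleton. Qed.

Lemma test_function_derive_out j x : ~ B x -> 'D_'e_j phi x = 0.
Proof.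
move/test_function_near0 => h.
by rewrite (@near_eq_derive _ _ _ phi (cst 0))// derive_cst.
Qed.

Lemma test_function_bounded : exists M, forall x, `|phi x| <= M.
Proof.
have [M h] := continuous_bounded_box ler01 test_function_continuous.
exists (Num.max M 0) => x; rewrite le_max; have [Bx|nB] := pselect (B x).
  by rewrite h//; exact: unit_ball_box.
by rewrite test_function_out// normr0 lexx orbT.
Qed.

Lemma test_function_derive_bounded j : exists M, forall x, `|'D_'e_j phi x| <= M.
Proof.
have [M h] := continuous_bounded_box ler01 (@test_function_derive_continuous j).
exists (Num.max M 0) => x; rewrite le_max; have [Bx|nB] := pselect (B x).
  by rewrite h//; exact: unit_ball_box.
by rewrite test_function_derive_out// normr0 lexx orbT.
Qed.

(** The derivative of the product [peval p * phi] has integral 0. In other words, the formal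
    derivative of a polynomial is its weak derivative. *)
Lemma peval_test_function_ibp (p : poly) (j : 'I_d) :
  \int[mu]_(x in B) (peval p x * 'D_'e_j phi x) =
  - \int[mu]_(x in B) (peval (mderiv j p) x * phi x).
Proof.
pose psi := peval p * phi.
have Dpsi x : is_derive x 'e_j psi (peval p x * 'D_'e_j phi x + peval (mderiv j p) x * phi x).
  have D1 := is_derive_peval p j x.
  have D2 : is_derive x 'e_j phi ('D_'e_j phi x).
    exact/derivableP/diff_derivable/test_function_differentiable.
  by apply: is_derive_eq; rewrite /GRing.scale /= [X in _ + X]mulrC.
have psiE x : 'D_'e_j psi x = peval p x * 'D_'e_j phi x + peval (mderiv j p) x * phi x.
  by have D := Dpsi x; rewrite derive_val.
have [Mp hp] := @peval_bounded _ _ p; have [Mdp hdp] := @peval_bounded _ _ (mderiv j p).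
have [M hM] := test_function_bounded; have [M' hM'] := test_function_derive_bounded j.
have mB := @measurable_unit_ball R d.
have mphi := continuous_measurable_rV test_function_continuous.
have mdphi := continuous_measurable_rV (@test_function_derive_continuous j).
have Bfin := @lebesgue_rV_ball R d.
have i1 : mu.-integrable B (EFin \o (fun x => peval p x * 'D_'e_j phi x)).
  apply: (@bounded_integrable _ _ _ mu B _ (Mp * M')) => //.
    by apply: measurable_funTS; apply: measurable_funM => //; exact: measurable_peval.
  by move=> x Bx; rewrite normrM ler_pM ?hp ?hM'.
have i2 : mu.-integrable B (EFin \o (fun x => peval (mderiv j p) x * phi x)).
  apply: (@bounded_integrable _ _ _ mu B _ (Mdp * M)) => //.
    by apply: measurable_funTS; apply: measurable_funM => //; exact: measurable_peval.
  by move=> x Bx; rewrite normrM ler_pM ?hdp ?hM.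
have [||||_] := @Rintegral_derive0 _ _ psi j (`|Mp * M'| + `|Mdp * M|)
  (fun x => (@ex_derive _ _ _ _ _ _ _ (Dpsi x))).
- by apply: measurable_funM => //; exact: measurable_peval.
- move=> x; rewrite psiE; have [Bx|nB] := pselect (B x); last first.
    by rewrite test_function_out// test_function_derive_out// !mulr0 addr0 normr0 addr_ge0.
  apply: le_trans (ler_normD _ _) _; apply: lerD.
    by rewrite normrM (le_trans _ (ler_norm _))// ler_pM ?hp ?hM'.
  by rewrite normrM (le_trans _ (ler_norm _))// ler_pM ?hdp ?hM.
- by move=> x nB; rewrite /psi fctE test_function_out ?mulr0.
- by move=> x nB; rewrite psiE test_function_out// test_function_derive_out// !mulr0 addr0.
under eq_Rintegral do rewrite psiE.
by rewrite RintegralD// => /eqP; rewrite addr_eq0 => /eqP.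
Qed.

End test_function_props.
End test_functions.

(** Fatou's lemma turns a bound uniform in [n] into integrability of the limit; no dominating
    function is at hand when the singular weight itself is the limit. *)
Lemma fatou_integrable dT (T : measurableType dT) (R : realType)
    (mu : {measure set T -> \bar R}) (D : set T) (f_ : nat -> T -> R) (f : T -> R) (C : R) :
  measurable D -> (forall n x, D x -> 0 <= f_ n x) ->
  (forall n, mu.-integrable D (EFin \o f_ n)) ->
  (forall n, \int[mu]_(x in D) f_ n x <= C) ->
  (forall x, D x -> f_ ^~ x @ \oo --> f x) -> mu.-integrable D (EFin \o f).
Proof.
move=> mD f0 if_ fC ff.
have mf_ n : measurable_fun D (f_ n) by apply/measurable_EFinP; case/integrableP: (if_ n).
have mf : measurable_fun D f by exact: (measurable_fun_cvg _ ff).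
apply/integrableP; split; first exact/measurable_EFinP.
apply: (@le_lt_trans _ _ C%:E); last exact: ltry.
have -> : (\int[mu]_(x in D) `|(EFin \o f) x| = \int[mu]_(x in D) limn_einf (fun n => (f_ n x)%:E))%E.
  apply: eq_integral => x /[!inE] Dx.
  have c : (fun n => (f_ n x)%:E) @ \oo --> (f x)%:E.
    by apply: cvg_EFin; [exact: nearW|exact: ff].
  rewrite is_cvg_limn_einfE; last by apply/cvg_ex; exists (f x)%:E.
  rewrite (cvg_lim _ c)//= ger0_norm//.
  have <- : limn (f_ ^~ x) = f x by apply/cvg_lim => //; exact: ff.
  by apply: limr_ge; [apply/cvg_ex; exists (f x); exact: ff|apply: nearW => n; exact: f0].
apply: le_trans (fatou _ mD _ _) _.
- by move=> n; exact/measurable_EFinP.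
- by move=> n x Dx; rewrite lee_fin f0.
rewrite limn_einf_lim; apply: lime_le; first exact: is_cvg_einfs.
apply: nearW => n; apply: (@le_trans _ _ (\int[mu]_(x in D) (f_ n x)%:E)%E).
  by apply: ereal_inf_lbound; exists n => //=.
by rewrite -[X in (X <= _)%E]fineK ?lee_fin//; [exact: fC|exact: (integrable_fin_num mD (if_ n))].
Qed.

(** * Limits and bounds of the cutoffs *)

Section cutoff_limits.
Context {R : realType}.
Implicit Types (s b dl : R).
Local Notation h := (@harmonic R).

Lemma harmonic_gt0 n : 0 < h n.
Proof. by rewrite /harmonic /= invr_gt0. Qed.

Lemma flat_cvg k s : 0 < s -> flat (h n) k (s - h n) @[n --> \oo] --> s^-1 ^+ k.
Proof.
move=> s0; have ch : h @ \oo --> (0 : R) := @cvg_harmonic R.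
have cs : s - h n @[n --> \oo] --> s.
  suff : s - h n @[n --> \oo] --> s - 0 by rewrite subr0.
  by apply: cvgB => //; exact: cvg_cst.
have cv : (s - h n)^-1 @[n --> \oo] --> s^-1 by apply: cvgV => //; rewrite gt_eqF //.
apply: (@cvg_trans _ ((s - h n)^-1 ^+ k * expR (- (h n / (s - h n))) @[n --> \oo])).
  apply: near_eq_cvg; near=> n; rewrite /flat ifT// subr_gt0.
  by near: n; apply: (cvgr_lt _ ch).
have c0 : - (h n / (s - h n)) @[n --> \oo] --> (0 : R).
  suff : - (h n / (s - h n)) @[n --> \oo] --> - (0 * s^-1) by rewrite mul0r oppr0.
  by apply: cvgN; exact: cvgM.
suff : (s - h n)^-1 ^+ k * expR (- (h n / (s - h n))) @[n --> \oo] --> s^-1 ^+ k * expR 0.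
  by rewrite expR0 mulr1.
apply: cvgM.
  by apply: (@continuous_cvg _ _ _ _ _ _ (fun x : R => x ^+ k)) => //; exact: exprn_continuous.
by apply: (@continuous_cvg _ _ _ _ _ _ (@expR R)) => //; exact: continuous_expR.
Unshelve. all: by end_near. Qed.

Lemma cutoff_cvg b k s : 0 < s -> cutoff (h n) b k s @[n --> \oo] --> s `^ b * s^-1 ^+ k.
Proof. by move=> s0; apply: cvgMl_tmp; exact: flat_cvg. Qed.

Lemma cutoff_ge0 dl b k s : 0 <= cutoff dl b k s.
Proof. by rewrite mulr_ge0 ?powR_ge0 ?flat_ge0. Qed.

Lemma flat0_le1 dl s : 0 < dl -> flat dl 0 s <= 1.
Proof.
move=> dl0; rewrite /flat; case: ifP => // s0; rewrite mul1r -expR0 ler_expR oppr_le0.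
by rewrite divr_ge0 ?ltW.
Qed.

Lemma cutoff_le_powR dl b s : 0 < dl -> cutoff dl b 0 s <= s `^ b.
Proof. by move=> dl0; rewrite ler_piMr ?powR_ge0// flat0_le1. Qed.

(** The error created by differentiating the exponential is controlled by the weight once a factor
    [s] is available. With [s = t + dl] it splits into [dl / t] and [(dl / t) ^+ 2] times the
    exponential, bounded by 1 and 4 through [powV_expR_le]. *)
Lemma cutoff2_le dl b s : 0 < dl -> s * (dl * cutoff dl b 2 s) <= 5 * s `^ b.
Proof.
move=> dl0; rewrite /cutoff; set t := s - dl; rewrite mulrCA [s * _]mulrCA [dl * _]mulrCA.
rewrite [5 * _]mulrC ler_wpM2l ?powR_ge0//.
have [t0|t0] := leP t 0; first by rewrite flat_npos// !mulr0.
have E : s * flat dl 2 t = flat dl 1 t + dl * flat dl 2 t.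
  by rewrite /flat t0 (_ : s = t + dl); [field; rewrite gt_eqF|rewrite /t; ring].
rewrite E mulrDr (_ : 5 = 1 + 4); last by ring.
have f1 := powV_expR_le 1 dl0 t0; have f2 := powV_expR_le 2 dl0 t0.
rewrite /flat t0; apply: lerD.
  apply: le_trans (ler_wpM2l (ltW dl0) f1) _.
  by rewrite expr1 mulrCA mulfV ?mulr1 ?gt_eqF.
rewrite mulrA -expr2; apply: le_trans (ler_wpM2l (exprn_ge0 2 (ltW dl0)) f2) _.
by rewrite exprMn exprVn mulrCA mulfV ?mulr1 ?expf_neq0 ?gt_eqF// -natrX.
Qed.

End cutoff_limits.

(** * Integrability of the weight *)

Section weight_integrable.
Context {R : realType} {d : nat} (alpha : R).
Hypothesis alpha_gtN1 : -1 < alpha.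
Local Notation V := 'rV[R]_d.
Local Notation mu := (@lebesgue_rV R d).
Local Notation B := (@unit_ball R d).
Local Notation h := (@harmonic R).
Let mB := @measurable_unit_ball R d.

Lemma ball_ge0 (x : V) : B x -> 0 < 1 - sqnorm x <= 1.
Proof. by rewrite /unit_ball /= => x1; rewrite subr_gt0 x1 gerBl sqnorm_ge0. Qed.

Lemma continuous_bump dl (p : mpoly d R) b n : 0 < dl -> continuous (bump dl p b n).
Proof. by move=> dl0 x; apply/differentiable_continuous/differentiable_bump. Qed.

Lemma integrable_bump dl (p : mpoly d R) b n : 0 < dl ->
  mu.-integrable B (EFin \o bump dl p b n).
Proof.
move=> dl0; have t := test_function_bumpy dl0 (bumpy_bump dl p b n).
have [M hM] := test_function_bounded t.
apply: (@bounded_integrable _ _ _ mu B _ M) => //; first exact: lebesgue_rV_ball.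
exact/measurable_funTS/continuous_measurable_rV/continuous_bump.
Qed.

(** Integration by parts of [x_j] against the cutoff of exponent [alpha + 1]: differentiating the
    power produces [- 2 (alpha + 1) x_j] times the cutoff of exponent [alpha], and [alpha + 1] is
    positive. The bound does not depend on [dl]. *)
Lemma Rintegral_sqnorm_cutoff dl : 0 < dl ->
  \int[mu]_(x in B) (sqnorm x * cutoff dl alpha 0 (1 - sqnorm x)) <=
  d%:R * fine (mu B) / (2 * (alpha + 1)).
Proof.
move=> dl0; have a1 : 0 < alpha + 1 by rewrite -ltrBlDr sub0r.
have a2 : 0 < 2 * (alpha + 1) by rewrite mulr_gt0.
pose X (j : 'I_d) := @mpolyX d R (mnm1 j).
have ball1 j : 2 * (alpha + 1) *
    \int[mu]_(x in B) bump dl (X j * X j) alpha 0 x <= fine (mu B).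
  have := peval_test_function_ibp (test_function_bumpy dl0 (bumpy_bump dl 1 (alpha + 1) 0)) (X j) j.
  have E x : peval (X j) x * 'D_'e_j (bump dl 1 (alpha + 1) 0) x =
      - ((2 * (alpha + 1)) * bump dl (X j * X j) alpha 0 x
         + (2 * dl) * bump dl (X j * X j) (alpha + 1) 2 x).
    have D := is_derive_bump 1 (alpha + 1) 0 j x dl0; rewrite derive_val addrK.
    rewrite (_ : mderiv j 1 = 0); last by rewrite -mpolyC1 mderivC.
    by rewrite /bump !pevalE; ring.
  under eq_Rintegral do rewrite E.
  have -> : \int[mu]_(x in B) (peval (mderiv j (X j)) x * bump dl 1 (alpha + 1) 0 x) =
      \int[mu]_(x in B) bump dl 1 (alpha + 1) 0 x.
    by apply: eq_Rintegral => x _; rewrite mderivXU eqxx peval1 mul1r.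
  under eq_Rintegral do rewrite -mulN1r.
  have i1 := integrable_bump (X j * X j) alpha 0 dl0.
  have i2 := integrable_bump (X j * X j) (alpha + 1) 2 dl0.
  have i1' := integrable_EFinZ (2 * (alpha + 1)) mB i1.
  have i2' := integrable_EFinZ (2 * dl) mB i2.
  rewrite RintegralZl//; last exact: integrable_EFinD.
  rewrite mulN1r => /oppr_inj; rewrite RintegralD// RintegralZl// RintegralZl// => eqn.
  have p2 : 0 <= \int[mu]_(x in B) bump dl (X j * X j) (alpha + 1) 2 x.
    apply: Rintegral_ge0 => x _; rewrite /bump !pevalE mulr_ge0 ?cutoff_ge0//.
    by rewrite -expr2 sqr_ge0.
  apply: (@le_trans _ _ (\int[mu]_(x in B) bump dl 1 (alpha + 1) 0 x)).
    by rewrite -eqn lerDl mulr_ge0// mulr_ge0// ltW.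
  rewrite (_ : fine (mu B) = \int[mu]_(x in B) 1); last by rewrite Rintegral_cst// mul1r.
  apply: le_Rintegral => //; first exact: integrable_bump.
    apply: (@bounded_integrable _ _ _ mu B _ 1) => //; first exact: lebesgue_rV_ball.
    by move=> x _; rewrite normr1.
  move=> x Bx; have /andP[s0 s1] := ball_ge0 Bx.
  rewrite /bump peval1 mul1r; apply: le_trans (cutoff_le_powR _ _ dl0) _.
  by rewrite -[leRHS](powRr0 (1 - sqnorm x)) ger_powR ?s0 ?s1 ?ltW.
rewrite ler_pdivlMr// mulrC.
have -> : \int[mu]_(x in B) (sqnorm x * cutoff dl alpha 0 (1 - sqnorm x)) =
    \sum_j \int[mu]_(x in B) bump dl (X j * X j) alpha 0 x.
  rewrite -Rintegral_sum//; last by move=> j; exact: integrable_bump.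
  apply: eq_Rintegral => x _; rewrite /sqnorm mulr_suml; apply: eq_bigr => j _.
  by rewrite /bump !pevalE expr2.
rewrite mulr_sumr; apply: (@le_trans _ _ (\sum_(j < d) fine (mu B))).
  by apply: ler_sum => j _; exact: ball1.
by rewrite sumr_const card_ord mulr_natl.
Qed.

Lemma integrable_weight : mu.-integrable B (EFin \o weight alpha).
Proof.
have i1 : mu.-integrable B (EFin \o (fun x => sqnorm x * weight alpha x)).
  apply: (@fatou_integrable _ _ _ mu B
    (fun n x => sqnorm x * cutoff (h n) alpha 0 (1 - sqnorm x)) _
    (d%:R * fine (mu B) / (2 * (alpha + 1)))) => //.
  - by move=> n x _; rewrite mulr_ge0 ?sqnorm_ge0 ?cutoff_ge0.
  - move=> n; have := integrable_bump psq alpha 0 (@harmonic_gt0 R n).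
    by congr (is_true (mu.-integrable B _)); apply/funext => x; rewrite /= /bump peval_psq.
  - by move=> n; exact: Rintegral_sqnorm_cutoff (harmonic_gt0 n).
  - move=> x Bx; apply: cvgMl_tmp; have /andP[s0 _] := ball_ge0 Bx.
    by have := @cutoff_cvg R alpha 0 _ s0; rewrite expr0 mulr1.
(* Where [sqnorm x > 1/2] the first summand dominates; elsewhere [1 - sqnorm x >= 1/2], and
   [alpha >= -1] bounds the weight by 2. *)
apply: (@integrable_le _ _ _ mu B _ (fun x => 2 * (sqnorm x * weight alpha x) + 2)) => //.
- exact/measurable_funTS/measurable_weight.
- apply: integrable_EFinD => //; first exact: integrable_EFinZ.
  apply: (@bounded_integrable _ _ _ mu B _ 2) => //; first exact: lebesgue_rV_ball.
  by move=> x _; rewrite ger0_norm.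
move=> x Bx; have /andP[s0 s1] := ball_ge0 Bx.
rewrite ger0_norm /weight ?powR_ge0//.
have w0 := powR_ge0 (1 - sqnorm x) alpha.
have [s2|s2] := leP (sqnorm x) (2^-1).
  apply: (@le_trans _ _ 2); last by rewrite lerDr mulr_ge0// mulr_ge0// sqnorm_ge0.
  apply: (@le_trans _ _ ((1 - sqnorm x) `^ (-1))).
    by apply: ger_powR; rewrite ?s0 ?s1 ?ltW.
  rewrite powR_inv1; last exact: ltW.
  rewrite -[leRHS]invrK lef_pV2 ?posrE ?invr_gt0//; lra.
rewrite -[leLHS]addr0 lerD//; rewrite mulrA ler_peMl//; lra.
Qed.

End weight_integrable.

(** The degenerate case of Cauchy-Schwarz: when the quadratic coefficient of a nonnegative form
    vanishes, the form is affine in [t] and its linear coefficient must vanish. *)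
Lemma affine_ge0_eq0 (R : realFieldType) (a l : R) :
  (forall t, 0 <= a - t * l) -> l = 0.
Proof.
move=> h; apply/eqP; apply: contraT => l0; have := h ((a + 1) / l).
by rewrite divfK// opprD addrA subrr sub0r oppr_ge0 ler10.
Qed.

(** * Real weighted square-integrable functions *)

Section weighted_L2.
Context dT (T : measurableType dT) (R : realType) (mu : {measure set T -> \bar R}).
Variables (D : set T) (w : T -> R).
Implicit Types f g h : T -> R.

(** The weight is arbitrary because the density theorem is used with the weight of the ball and also
    with [|f|] times a cutoff. *)
Definition L2w f : Prop :=
  measurable_fun D f /\ mu.-integrable D (EFin \o (fun x => f x ^+ 2 * w x)).

Definition dot f g : R := \int[mu]_(x in D) (f x * g x * w x).

Hypotheses (mD : measurable D) (mw : measurable_fun D w).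
Hypothesis w_ge0 : forall x, D x -> 0 <= w x.

Lemma L2w_le f g : measurable_fun D f -> L2w g ->
  (forall x, D x -> `|f x| <= `|g x|) -> L2w f.
Proof.
move=> mf [mg ig] fg; split=> //; apply: (integrable_le _ _ ig) => //.
  by apply: measurable_funM => //; exact: measurable_funX.
move=> x Dx; rewrite normrM normrX (ger0_norm (w_ge0 Dx)) ler_wpM2r ?w_ge0//.
by rewrite -[leRHS]ger0_norm ?sqr_ge0// normrX lerXn2r ?nnegrE// fg.
Qed.

Lemma integrable_dot f g : L2w f -> L2w g ->
  mu.-integrable D (EFin \o (fun x => f x * g x * w x)).
Proof.
move=> [mf fi] [mg gi]; apply: (integrable_le _ _ (integrable_EFinD mD fi gi)) => //.
  by apply: measurable_funM => //; exact: measurable_funM.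
move=> x Dx; rewrite normrM (ger0_norm (w_ge0 Dx)) -mulrDl ler_wpM2r ?w_ge0//.
rewrite normrM -[f x ^+ 2]ger0_norm ?sqr_ge0// -[g x ^+ 2]ger0_norm ?sqr_ge0// !normrX.
have := sqr_ge0 (`|f x| - `|g x|); have := mulr_ge0 (normr_ge0 (f x)) (normr_ge0 (g x)); nra.
Qed.

Lemma L2wZ c f : L2w f -> L2w (fun x => c * f x).
Proof.
move=> [mf fi]; split; first exact: measurable_funM.
have := integrable_EFinZ (c ^+ 2) mD fi; congr (is_true (mu.-integrable D _)).
by apply/funext => x /=; rewrite exprMn mulrA.
Qed.

Lemma L2wD f g : L2w f -> L2w g -> L2w (fun x => f x + g x).
Proof.
move=> Lf Lg; have [mf fi] := Lf; have [mg gi] := Lg; split; first exact: measurable_funD.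
have := integrable_EFinD mD (integrable_EFinD mD fi gi) (integrable_EFinZ 2 mD (integrable_dot Lf Lg)).
by congr (is_true (mu.-integrable D _)); apply/funext => x /=; congr EFin; ring.
Qed.

Lemma L2wB f g : L2w f -> L2w g -> L2w (fun x => f x - g x).
Proof.
move=> Lf Lg; rewrite (_ : (fun _ => _) = (fun x => f x + -1 * g x)).
  by apply: L2wD => //; exact: L2wZ.
by apply/funext => x; rewrite mulN1r.
Qed.

Lemma L2w_sum (I : Type) (s : seq I) (f : I -> T -> R) :
  L2w (cst 0) -> (forall i, L2w (f i)) -> L2w (fun x => \sum_(i <- s) f i x).
Proof.
move=> L0 Lf; elim: s => [|i s IH].
  by under eq_fun do rewrite big_nil.
by under eq_fun do rewrite big_cons; exact: L2wD.
Qed.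

Lemma L2w0 : L2w (cst 0).
Proof.
split; first exact: measurable_cst.
have : mu.-integrable D (cst 0%E) by exact: integrable0.
congr (is_true (mu.-integrable D _)).
by apply/funext => x; rewrite /= expr0n mul0r.
Qed.

Lemma dotC f g : dot f g = dot g f.
Proof. by apply: eq_Rintegral => x _; rewrite [f x * _]mulrC. Qed.

Lemma dotDl f g h : L2w f -> L2w g -> L2w h ->
  dot (fun x => f x + g x) h = dot f h + dot g h.
Proof.
move=> Lf Lg Lh; rewrite /dot -RintegralD//; [|exact: integrable_dot..].
by apply: eq_Rintegral => x _; ring.
Qed.

Lemma dotZl c f h : L2w f -> L2w h -> dot (fun x => c * f x) h = c * dot f h.
Proof.
move=> Lf Lh; rewrite /dot -RintegralZl//; last exact: integrable_dot.
by apply: eq_Rintegral => x _; ring.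
Qed.

Lemma dotBl f g h : L2w f -> L2w g -> L2w h ->
  dot (fun x => f x - g x) h = dot f h - dot g h.
Proof.
move=> Lf Lg Lh; rewrite /dot -RintegralB//; [|exact: integrable_dot..].
by apply: eq_Rintegral => x _; ring.
Qed.

Lemma dotDr f g h : L2w f -> L2w g -> L2w h ->
  dot h (fun x => f x + g x) = dot h f + dot h g.
Proof. by move=> Lf Lg Lh; rewrite dotC dotDl// ![dot _ h]dotC. Qed.

Lemma dotZr c f h : L2w f -> L2w h -> dot h (fun x => c * f x) = c * dot h f.
Proof. by move=> Lf Lh; rewrite dotC dotZl// dotC. Qed.

Lemma dotBr f g h : L2w f -> L2w g -> L2w h ->
  dot h (fun x => f x - g x) = dot h f - dot h g.
Proof. by move=> Lf Lg Lh; rewrite dotC dotBl// ![dot _ h]dotC. Qed.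

Lemma dot_ge0 f : 0 <= dot f f.
Proof. by apply: Rintegral_ge0 => x Dx; rewrite -expr2 mulr_ge0 ?sqr_ge0 ?w_ge0. Qed.

Lemma dot_null f g : L2w f -> L2w g -> dot g g = 0 -> dot f g = 0.
Proof.
move=> Lf Lg g0; apply: (@affine_ge0_eq0 _ (dot f f)) => t.
have Lt : L2w (fun x => (t / 2) * g x) by exact: L2wZ.
have := dot_ge0 (fun x => f x - t / 2 * g x).
rewrite dotBl//; last exact: L2wB.
rewrite !dotBr// (dotC _ f) !dotZr// dotZl// g0.
by congr (0 <= _); field.
Qed.

(** The parallelogram identity with the square of [f - g] dropped; it serves as a triangle
    inequality without square roots. *)
Lemma dot_sqrD_le f g : L2w f -> L2w g ->
  dot (fun x => f x + g x) (fun x => f x + g x) <= 2 * dot f f + 2 * dot g g.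
Proof.
move=> Lf Lg; have LD := L2wD Lf Lg; have LB := L2wB Lf Lg.
have := dot_ge0 (fun x => f x - g x).
by rewrite dotBl// !dotBr// dotDl// !dotDr// (dotC g f); lra.
Qed.

Lemma dot_cvg0 (f_ : nat -> T -> R) f g : (forall n, measurable_fun D (f_ n)) ->
  L2w g -> (forall n x, D x -> `|f_ n x| <= g x) ->
  (forall x, D x -> f_ ^~ x @ \oo --> f x) ->
  L2w f /\ dot (fun x => f x - f_ n x) (fun x => f x - f_ n x) @[n --> \oo] --> 0.
Proof.
move=> mf_ Lg fg ff.
have mf : measurable_fun D f by exact: (measurable_fun_cvg _ ff).
have fg' x : D x -> `|f x| <= g x.
  move=> Dx; have cn : `|f_ n x| @[n --> \oo] --> `|f x| by apply: cvg_norm; exact: ff.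
  rewrite -(cvg_lim _ cn)//; apply: limr_le; first by apply/cvg_ex; exists `|f x|.
  by apply: nearW => n; exact: fg.
have Lf : L2w f.
  by apply: L2w_le Lg _ => // x Dx; rewrite (le_trans (fg' _ Dx))// ler_norm.
split=> //; have [|||||_] := @dominated_convergence_Rintegral _ _ _ mu D
   (fun n x => (f x - f_ n x) * (f x - f_ n x) * w x) (cst 0) (fun x => 4 * (g x ^+ 2 * w x)) => //.
- move=> n; apply: measurable_funM => //.
  by apply: measurable_funM; apply: measurable_funB.
- move=> x Dx; have c : f x - f_ n x @[n --> \oo] --> 0.
    suff : f x - f_ n x @[n --> \oo] --> f x - f x by rewrite subrr.
    by apply: cvgB; [exact: cvg_cst|exact: ff].
  suff : (f x - f_ n x) * (f x - f_ n x) * w x @[n --> \oo] --> 0 * 0 * w x by rewrite !mul0r.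
  by apply: cvgMr_tmp; exact: cvgM.
- by apply: integrable_EFinZ => //; case: Lg.
- move=> n x Dx; rewrite normrM (ger0_norm (w_ge0 Dx)) mulrA ler_wpM2r ?w_ge0//.
  rewrite normrM -expr2; have /andP[a b] : 0 <= `|f x - f_ n x| <= 2 * g x.
    rewrite normr_ge0/=; apply: le_trans (ler_normB _ _) _.
    by have := fg' _ Dx; have := fg n _ Dx; lra.
  by rewrite (_ : 4 * g x ^+ 2 = (2 * g x) ^+ 2); [rewrite lerXn2r ?nnegrE//; lra|ring].
by rewrite Rintegral_cst// mul0r.
Qed.

End weighted_L2.

(** * Polynomials approaching indicators of half-spaces *)

Section smoothstep.
Context {R : realType}.

(** A cubic with fixed points 0, 1/2 and 1, of which 0 and 1 attract and 1/2 repels: its iterates on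
    the unit interval approach a step function while remaining polynomials. *)
Definition smoothstep (t : R) : R := 3 * t ^+ 2 - 2 * t ^+ 3.

Lemma smoothstep_itv t : 0 <= t <= 1 -> 0 <= smoothstep t <= 1.
Proof.
move=> /andP[t0 t1]; rewrite /smoothstep; apply/andP; split.
  rewrite (_ : _ - _ = t ^+ 2 * (3 - 2 * t)); last by ring.
  by rewrite mulr_ge0 ?sqr_ge0//; lra.
rewrite -subr_ge0 (_ : _ - _ = (1 - t) ^+ 2 * (1 + 2 * t)); last by ring.
by rewrite mulr_ge0 ?sqr_ge0//; lra.
Qed.

Lemma iter_smoothstep_itv k t : 0 <= t <= 1 -> 0 <= iter k smoothstep t <= 1.
Proof. by move=> t01; elim: k => //= k; exact: smoothstep_itv. Qed.

Lemma iter_smoothstep_cvg0 t : 0 <= t < 2^-1 -> iter k smoothstep t @[k --> \oo] --> 0.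
Proof.
(* The quotient [smoothstep y / y] is [3 y - 2 y ^+ 2], which for [0 <= y <= t] is at most its value
   [c] at [t]; and [1 - c = (1 - t) (1 - 2 t)] is positive. Hence geometric decay. *)
move=> /andP[t0 t1]; pose c := 3 * t - 2 * t ^+ 2.
have c0 : 0 <= c by rewrite /c; nra.
have c1 : c < 1.
  have : 0 < (1 - t) * (1 - 2 * t) by apply: mulr_gt0; lra.
  by rewrite /c; nra.
have bnd k : 0 <= iter k smoothstep t <= c ^+ k * t.
  elim: k => [|k /andP[IH0 IH1]]; first by rewrite expr0 mul1r /= t0 lexx.
  rewrite iterS; set y := iter _ _ _ in IH0 IH1 *.
  have yt : y <= t by apply: le_trans IH1 _; rewrite ler_piMl// exprn_ile1// ltW.
  have y1 : 0 <= y <= 1 by rewrite IH0/=; lra.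
  have /andP[-> _] := smoothstep_itv y1; rewrite /=.
  apply: (@le_trans _ _ (c * y)); last by rewrite exprS -mulrA ler_wpM2l.
  rewrite -subr_ge0 (_ : _ - _ = y * ((t - y) * (3 - 2 * (t + y)))).
    by rewrite mulr_ge0// mulr_ge0//; lra.
  by rewrite /c /smoothstep; ring.
apply: (@squeeze_cvgr _ _ _ _ (cst 0) (fun k => c ^+ k * t)).
- by apply: nearW => k; exact: bnd.
- exact: cvg_cst.
suff : c ^+ k * t @[k --> \oo] --> 0 * t by rewrite mul0r.
by apply: cvgMr_tmp; apply: cvg_expr; rewrite ger0_norm.
Qed.

Lemma iter_smoothstep_onem k t : iter k smoothstep (1 - t) = 1 - iter k smoothstep t.
Proof. by elim: k => //= k ->; rewrite /smoothstep; ring. Qed.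

Lemma iter_smoothstep_cvg1 t : 2^-1 < t <= 1 -> iter k smoothstep t @[k --> \oo] --> (1 : R).
Proof.
move=> /andP[t0 t1]; have : 0 <= 1 - t < 2^-1 by apply/andP; split; lra.
move=> /iter_smoothstep_cvg0 c.
rewrite (_ : (fun k => _) = (fun k => 1 - iter k smoothstep (1 - t))); last first.
  by apply/funext => k; rewrite iter_smoothstep_onem opprB addrC subrK.
suff : 1 - iter k smoothstep (1 - t) @[k --> \oo] --> (1 - 0 : R) by rewrite subr0.
by apply: cvgB => //; exact: cvg_cst.
Qed.

Lemma iter_smoothstep_half k : iter k smoothstep (2^-1) = 2^-1.
Proof. by elim: k => //= k ->; rewrite /smoothstep; field. Qed.

End smoothstep.

Section polynomials_approach_halfspaces.
Context {R : realType} {d : nat}.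
Local Notation V := 'rV[R]_d.
Local Notation poly := (mpoly d R).
Local Notation B := (@unit_ball R d).

(* [2 q ^+ 2 - q] sends the limits [0], [1/2], [1] of the iterated smoothstep to
   [0], [0], [1]. *)
Lemma halfspace_poly (i : 'I_d) (a : R) :
  exists r : nat -> poly, (forall k x, B x -> `|peval (r k) x| <= 1) /\
    forall x, B x -> peval (r k) x @[k --> \oo] --> (\1_[set y : V | a < y ord0 i] x : R).
Proof.
(* On the ball [|x_i - a|] is at most [1 + |a|], so with this scaling the starting polynomial takes
   values in the unit interval, with value 1/2 on the hyperplane. *)
pose c : R := (2 * (1 + `|a|))^-1.
have a1 : 0 < 1 + `|a| by rewrite ltr_pwDl.
have c0 : 0 < c by rewrite invr_gt0 mulr_gt0.
pose q0 : poly := c *: (@mpolyX d R (mnm1 i) - mpolyC d a) + mpolyC d 2^-1.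
pose q k : poly := iter k (fun p : poly => 3%:R *: (p * p) - 2%:R *: (p * p * p)) q0.
have q0E x : peval q0 x = c * (x ord0 i - a) + 2^-1 by rewrite /q0 !pevalE.
have qE k x : peval (q k) x = iter k smoothstep (c * (x ord0 i - a) + 2^-1).
  elim: k => [|k IH]; first by rewrite /q /= q0E.
  by rewrite iterS -IH /q iterS !pevalE /smoothstep; ring.
have q01 x : B x -> 0 <= c * (x ord0 i - a) + 2^-1 <= 1.
  move=> Bx; have := unit_ball_coord i Bx; rewrite ltr_norml => /andP[x1 x2].
  have := ler_norm a; have := ler_norm (- a); rewrite normrN => a2 a3.
  have e : c * (2 * (1 + `|a|)) = 1 by rewrite mulVf// gt_eqF// mulr_gt0.
  have h1 : c * (x ord0 i - a) <= c * (1 + `|a|) by rewrite ler_pM2l//; lra.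
  have h2 : c * (- (1 + `|a|)) <= c * (x ord0 i - a) by rewrite ler_pM2l//; lra.
  by apply/andP; split; lra.
exists (fun k => 2%:R *: (q k * q k) - q k); split=> [k x Bx|x Bx].
  have /andP[y0 y1] := iter_smoothstep_itv k (q01 _ Bx).
  rewrite !pevalE qE; set y := iter _ _ _ in y0 y1 *.
  by rewrite ler_norml; apply/andP; split; nra.
have cE (l : R) : iter k smoothstep (c * (x ord0 i - a) + 2^-1) @[k --> \oo] --> l ->
    peval (2%:R *: (q k * q k) - q k) x @[k --> \oo] --> (2 * (l * l) - l : R).
  move=> cl; under eq_fun do rewrite !pevalE qE.
  by apply: cvgB => //; apply: cvgMl_tmp; exact: cvgM.
have /andP[y0 y1] := q01 _ Bx.
rewrite indicE; have [xa|ax|xa] := ltgtP (x ord0 i) a.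
- rewrite memNset/=; last by rewrite /= => h; have := lt_trans h xa; rewrite ltxx.
  have := cE 0; rewrite !mulr0 subr0; apply; apply: iter_smoothstep_cvg0.
  by rewrite y0 /= gtrDr pmulr_rlt0// subr_lt0.
- rewrite mem_set//=; have := cE 1; rewrite !mulr1 (_ : 2 - 1 = 1 :> R); last by ring.
  by apply; apply: iter_smoothstep_cvg1; rewrite y1 andbT ltrDr pmulr_rgt0// subr_gt0.
- rewrite memNset/=; last by rewrite /= xa ltxx.
  have := cE 2^-1; rewrite (_ : 2 * (2^-1 * 2^-1) - 2^-1 = 0 :> R); last by field.
  apply; rewrite xa subrr mulr0 add0r.
  by under eq_fun do rewrite iter_smoothstep_half; exact: cvg_cst.
Qed.

End polynomials_approach_halfspaces.

(** * Density of polynomials in weighted spaces *)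

Section density_of_polynomials.
Context {R : realType} {d : nat}.
Local Notation V := 'rV[R]_d.
Local Notation poly := (mpoly d R).
Local Notation mu := (@lebesgue_rV R d).
Local Notation B := (@unit_ball R d).
Variable w : V -> R.
Hypotheses (mw : measurable_fun B w) (w_ge0 : forall x, B x -> 0 <= w x).
Hypothesis iw : mu.-integrable B (EFin \o w).
Let mB := @measurable_unit_ball R d.
Local Notation L2 := (L2w mu B w).
Local Notation dot := (dot mu B w).

Lemma L2w_bounded (f : V -> R) M : measurable_fun B f ->
  (forall x, B x -> `|f x| <= M) -> L2 f.
Proof.
move=> mf fM; apply: (@L2w_le _ _ _ mu B w mB mw w_ge0 f (fun x => M * 1)) => //.
  apply: L2wZ => //; split; first exact: measurable_cst.
  have := iw; congr (is_true (mu.-integrable B _)).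
  by apply/funext => x; rewrite /= expr1n mul1r.
by move=> x Bx; rewrite mulr1 (le_trans (fM x Bx))// ler_norm.
Qed.

Lemma L2w_peval (p : poly) : L2 (peval p).
Proof.
have [M hM] := peval_bounded p; apply: (@L2w_bounded _ M) => //.
exact/measurable_funTS/measurable_peval.
Qed.

Definition approx_poly (f : V -> R) : Prop := L2 f /\
  forall e, 0 < e -> exists p : poly,
    dot (fun x => f x - peval p x) (fun x => f x - peval p x) < e.

(** The class is closed in norm. Each of the two errors is doubled by [dot_sqrD_le], hence
    [e / 4]. *)
Lemma approx_poly_close f : L2 f ->
  (forall e, 0 < e -> exists2 g, approx_poly g & dot (fun x => f x - g x) (fun x => f x - g x) < e) ->
  approx_poly f.
Proof.
move=> Lf h; split=> // e e0; have e4 : 0 < e / 4 by rewrite divr_gt0.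
have [g [Lg Ag] fg] := h _ e4; have [p gp] := Ag _ e4; exists p.
have Lp := L2w_peval p.
have := dot_sqrD_le mB mw w_ge0 (L2wB mB mw w_ge0 Lf Lg) (L2wB mB mw w_ge0 Lg Lp).
rewrite (_ : (fun x => f x - g x + (g x - peval p x)) = fun x => f x - peval p x); last first.
  by apply/funext => x; ring.
by move=> /le_lt_trans; apply; lra.
Qed.

Lemma dot00 : dot (cst 0) (cst 0) = 0.
Proof.
rewrite /dot -[RHS](mul0r (fine (mu B))) -Rintegral_cst//.
by apply: eq_Rintegral => x _; rewrite !mul0r.
Qed.

Lemma approx_poly_peval p : approx_poly (peval p).
Proof.
split; first exact: L2w_peval.
move=> e e0; exists p; rewrite (_ : (fun x => _) = cst 0) ?dot00//.
by apply/funext => x; rewrite subrr.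
Qed.

Lemma approx_polyD f g : approx_poly f -> approx_poly g -> approx_poly (fun x => f x + g x).
Proof.
move=> [Lf Af] [Lg Ag]; split; first exact: L2wD.
move=> e e0; have e4 : 0 < e / 4 by rewrite divr_gt0.
have [p fp] := Af _ e4; have [q gq] := Ag _ e4; exists (p + q).
have := dot_sqrD_le mB mw w_ge0 (L2wB mB mw w_ge0 Lf (L2w_peval p)) (L2wB mB mw w_ge0 Lg (L2w_peval q)).
rewrite (_ : (fun x => f x - peval p x + (g x - peval q x)) = fun x => f x + g x - peval (p + q) x); last first.
  by apply/funext => x; rewrite pevalD; ring.
by move=> /le_lt_trans; apply; lra.
Qed.

(** A polynomial is bounded on the ball, so multiplication by it is continuous in norm; [M ^+ 2 + 1]
    is a positive bound for the square of its operator norm. *)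
Lemma approx_polyM p f : approx_poly f -> approx_poly (fun x => peval p x * f x).
Proof.
move=> [Lf Af]; have [M hM] := peval_bounded p.
have L h : L2 h -> L2 (fun x => peval p x * h x).
  move=> Lh; apply: (@L2w_le _ _ _ mu B w mB mw w_ge0 _ (fun x => M * h x)).
  - by apply: measurable_funM; [exact/measurable_funTS/measurable_peval|case: Lh].
  - exact: L2wZ.
  - by move=> x Bx; rewrite !normrM ler_wpM2r// (le_trans (hM x Bx))// ler_norm.
split; first exact: L.
move=> e e0; have M0 : 0 < M ^+ 2 + 1 by rewrite ltr_wpDl ?sqr_ge0.
have [q fq] := Af (e / (M ^+ 2 + 1)) (divr_gt0 e0 M0).
exists (p * q); rewrite (_ : (fun x => _) = fun x => peval p x * (f x - peval q x)); last first.
  by apply/funext => x; rewrite pevalM; ring.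
have Lq := L2wB mB mw w_ge0 Lf (L2w_peval q).
apply: (@le_lt_trans _ _ ((M ^+ 2 + 1) * dot (fun x => f x - peval q x) (fun x => f x - peval q x))).
  rewrite /dot -RintegralZl//; last exact: integrable_dot.
  apply: le_Rintegral => //; first exact: integrable_dot (L _ Lq) (L _ Lq).
    by apply: integrable_EFinZ => //; exact: integrable_dot.
  move=> x Bx; set y := f x - _; rewrite (_ : _ * _ * _ = peval p x ^+ 2 * (y ^+ 2 * w x)); last by ring.
  rewrite -expr2; apply: ler_wpM2r; first by rewrite mulr_ge0 ?sqr_ge0 ?w_ge0.
  rewrite -[leLHS]ger0_norm ?sqr_ge0// normrX.
  have := hM x Bx; have := normr_ge0 (peval p x); nra.
by rewrite mulrC -ltr_pdivlMr.
Qed.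

Lemma approx_polyZ c f : approx_poly f -> approx_poly (fun x => c * f x).
Proof. by move/(approx_polyM (mpolyC d c)); under eq_fun do rewrite pevalC. Qed.

Lemma approx_poly_sum (I : Type) (s : seq I) (F : I -> V -> R) :
  (forall i, approx_poly (F i)) -> approx_poly (fun x => \sum_(i <- s) F i x).
Proof.
move=> AF; elim: s => [|i s IH].
  have := approx_poly_peval 0.
  by congr approx_poly; apply/funext => x; rewrite big_nil peval0.
by under eq_fun do rewrite big_cons; exact: approx_polyD.
Qed.

Lemma approx_poly_lim (f_ : nat -> V -> R) f g : (forall n, approx_poly (f_ n)) ->
  L2 g -> (forall n x, B x -> `|f_ n x| <= g x) ->
  (forall x, B x -> f_ ^~ x @ \oo --> f x) -> approx_poly f.
Proof.
move=> Af Lg fg ff.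
have [|Lf cf] := dot_cvg0 mB mw w_ge0 _ Lg fg ff; first by move=> n; have [[]] := Af n.
apply: approx_poly_close => // e e0.
have [n _ hn] : \forall n \near \oo, dot (fun x => f x - f_ n x) (fun x => f x - f_ n x) < e.
  exact: (cvgr_lt _ cf).
by exists (f_ n) => //; exact: (hn n (leqnn n)).
Qed.

(** Asking that the indicator multiply the whole class into itself, rather than merely belong to it,
    makes stability under intersections a composition. The multipliers then form a sigma-algebra
    without any monotone class argument. *)
Definition multiplier (S : set V) : Prop :=
  forall f, approx_poly f -> approx_poly (fun x => \1_S x * f x).

Lemma indicI (S S' : set V) x : \1_(S `&` S') x = \1_S x * \1_S' x :> R.
Proof. by rewrite !indicE in_setI; case: (_ \in S); rewrite ?mul1r ?mul0r. Qed.

Lemma indicC (S : set V) x : \1_(~` S) x = 1 - \1_S x :> R.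
Proof. by rewrite !indicE in_setC; case: (_ \in S); rewrite ?subrr ?subr0. Qed.

Lemma multiplierC S : multiplier S -> multiplier (~` S).
Proof.
move=> mS f Af; rewrite (_ : (fun x => _) = fun x => f x + -1 * (\1_S x * f x)).
  by apply: approx_polyD => //; apply: approx_polyZ; exact: mS.
by apply/funext => x; rewrite indicC; ring.
Qed.

Lemma multiplierI S S' : multiplier S -> multiplier S' -> multiplier (S `&` S').
Proof.
move=> mS mS' f Af; under eq_fun do rewrite indicI -mulrA.
by apply: mS; exact: mS'.
Qed.

Lemma multiplierU S S' : multiplier S -> multiplier S' -> multiplier (S `|` S').
Proof.
by move=> mS mS'; rewrite -[S `|` S']setCK setCU; apply/multiplierC/multiplierI; exact: multiplierC.
Qed.

Lemma multiplier0 : multiplier set0.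
Proof.
move=> f Af; rewrite (_ : (fun x => _) = fun x => 0 * f x); first exact: approx_polyZ.
by apply/funext => x; rewrite indicE in_set0.
Qed.

(** Dominated convergence with [|f|] as dominating function; it serves both for countable unions and
    for the half-spaces. *)
Lemma multiplier_lim (m_ : nat -> V -> R) (S : set V) :
  (forall n f, approx_poly f -> approx_poly (fun x => m_ n x * f x)) ->
  (forall n x, B x -> `|m_ n x| <= 1) ->
  (forall x, B x -> m_ n x @[n --> \oo] --> (\1_S x : R)) -> multiplier S.
Proof.
move=> Am m1 mS f Af; have [[mf fi] _] := Af.
apply: (@approx_poly_lim (fun n x => m_ n x * f x) _ (fun x => `|f x|)).
- by move=> n; exact: Am.
- apply: (@L2w_le _ _ _ mu B w mB mw w_ge0 _ f); [exact: measurableT_comp|by []|].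
  by move=> x _; rewrite normr_id.
- by move=> n x Bx; rewrite normrM ler_piMl// m1.
- by move=> x Bx; apply: cvgMr_tmp; exact: mS.
Qed.

Lemma multiplier_bigcup (F : (set V)^nat) : (forall n, multiplier (F n)) ->
  multiplier (\bigcup_n F n).
Proof.
move=> mF; apply: (@multiplier_lim (fun n => \1_(\bigcup_(i < n) F i))).
- move=> n; rewrite bigcup_mkord; elim: n => [|n IH].
    by rewrite big_ord0; exact: multiplier0.
  by rewrite big_ord_recr; apply: multiplierU => //; exact: mF.
- by move=> n x _; rewrite indicE; case: (_ \in _); rewrite ?normr1 ?normr0.
- move=> x _; have [[m _ Fm]|nF] := pselect ((\bigcup_n F n) x).
    apply: cvg_near_cst; near=> n; rewrite !indicE !mem_set//; first by exists m.
    by exists m => //=; near: n; exact: nbhs_infty_gt.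
  apply: cvg_near_cst; apply: nearW => n; rewrite !indicE !memNset//.
  by move=> [m _ Fm]; apply: nF; exists m.
Unshelve. all: by end_near. Qed.

Lemma multiplier_halfspace i a : multiplier [set y : V | a < y ord0 i].
Proof.
have [r [r1 rc]] := @halfspace_poly R d i a.
apply: (@multiplier_lim (fun n => peval (r n))) => //.
by move=> n f; exact: approx_polyM.
Qed.

Lemma multiplier_coord i (Y : set (measurableTypeR R)) : measurable Y ->
  multiplier [set x : V | Y (x ord0 i)].
Proof.
move=> mY.
suff : <<s @RGenOInfty.G R >> `<=` [set Y : set R | multiplier [set x : V | Y (x ord0 i)]].
  by apply; move: mY; rewrite -[X in _ -> X](_ : (RGenOInfty.G (R := R)).-sigma.-measurable Y = _)// -RGenOInfty.measurableE.
apply: smallest_sub; last by move=> _ [a ->] /=; under eq_set do rewrite in_itv/= andbT; exact: multiplier_halfspace.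
split => /=.
- exact: multiplier0.
- move=> A mA; have := multiplierC mA; congr multiplier.
  by apply/seteqP; split => x /= => [nA|[]//]; split.
- by move=> F mF; exact: (multiplier_bigcup mF).
Qed.

(** The multipliers form a sigma-algebra, and preimages of Borel sets under the coordinates, which
    belong to it by way of half-spaces, generate the measurable sets. *)
Lemma multiplier_measurable (S : set V) : measurable S -> multiplier S.
Proof.
move=> [Y mY <-]; rewrite setTI.
suff : (@measurable _ (d.-tuple (measurableTypeR R))) `<=`
    [set Y | multiplier (@tuple_of_rV R d @^-1` Y)] by apply.
apply: smallest_sub.
  split => /=.
  - exact: multiplier0.
  - by move=> A mA; rewrite setTD preimage_setC; exact: (multiplierC mA).
  - by move=> F mF; rewrite preimage_bigcup; exact: (multiplier_bigcup mF).
move=> A; rewrite -bigcup_seq => -[i _ [Z mZ <-]] /=; rewrite setTI.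
have := @multiplier_coord i Z mZ; congr multiplier.
by apply/seteqP; split => x /=; rewrite tnth_mktuple.
Qed.

Import HBNNSimple.

(** A multiplier applied to the constant 1 puts its indicator in the closure, hence also simple
    functions; a nonnegative function is their increasing limit and dominates them. *)
Theorem polynomials_dense f : L2 f -> approx_poly f.
Proof.
suff pos g : L2 g -> (forall x, 0 <= g x) -> approx_poly g.
  move=> Lf; have [mf _] := Lf.
  rewrite (_ : f = fun x => f^\+ x + -1 * f^\- x); last first.
    by rewrite -[LHS](funrposBneg f); apply/funext => x /=; rewrite mulN1r.
  apply: approx_polyD; [|apply: approx_polyZ]; apply: pos => //.
  - apply: (L2w_le mB mw w_ge0 _ Lf); first exact: measurable_funrpos.
    by move=> x _; rewrite ger0_norm ?funrpos_ge0// ge_max ler_norm normr_ge0.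
  - apply: (L2w_le mB mw w_ge0 _ Lf); first exact: measurable_funrneg.
    by move=> x _; rewrite ger0_norm ?funrneg_ge0// ge_max -normrN ler_norm normr_ge0.
move=> Lg g0; have [mg _] := Lg.
have meg : measurable_fun B (EFin \o g) by exact/measurable_EFinP.
pose hh := nnsfun_approx mB meg.
pose h n : V -> R := hh n.
have hc x : B x -> h n x @[n --> \oo] --> g x.
  move=> Bx; have : (EFin \o h ^~ x) @ \oo --> (EFin \o g) x.
    by apply: cvg_nnsfun_approx => // y _; rewrite /= lee_fin.
  by move/fine_cvgP => [].
apply: (@approx_poly_lim (fun n => h n) _ g) => //.
- move=> n.
  have -> : h n = _ := funext (fimfunEord (hh n)).
  apply: approx_poly_sum => i; apply: approx_polyZ.
  have mS r : measurable (hh n @^-1` [set r]) by exact: measurable_sfunP.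
  have mul r : approx_poly (\1_(hh n @^-1` [set r]) : V -> R).
    have := multiplier_measurable (mS r) (approx_poly_peval 1).
    by congr approx_poly; apply/funext => x; rewrite peval1 mulr1.
  exact: mul.
- move=> n x Bx; rewrite ger0_norm; last exact: fun_ge0.
  rewrite -(cvg_lim _ (hc _ Bx))//; apply: nondecreasing_cvgn_le.
    by move=> i j ij; have /lefP := nd_nnsfun_approx mB meg ij; apply.
  by apply/cvg_ex; exists (g x); exact: hc.
Qed.

End density_of_polynomials.

(** * Local integrability and weak derivatives of real functions *)

Section real_weak_derivatives.
Context {R : realType} {d : nat}.
Local Notation V := 'rV[R]_d.
Local Notation poly := (mpoly d R).
Local Notation mu := (@lebesgue_rV R d).
Local Notation B := (@unit_ball R d).
Local Notation h := (@harmonic R).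
Let mB := @measurable_unit_ball R d.

(** The sets [inner_ball dl] stand for all compact subsets of the ball, each of which lies in one of
    them. *)
Definition locally_integrable (f : V -> R) : Prop := measurable_fun B f /\
  forall dl, 0 < dl -> mu.-integrable (inner_ball dl) (EFin \o f).

Definition weak_derivative (j : 'I_d) (f g : V -> R) : Prop :=
  forall phi, test_function phi ->
    \int[mu]_(x in B) (f x * 'D_'e_j phi x) = - \int[mu]_(x in B) (g x * phi x).

Lemma measurable_inner_ball dl : measurable (@inner_ball R d dl).
Proof.
rewrite -[inner_ball dl]setCK; apply: measurableC; apply: open_measurable_rV.
by apply: closed_openC; exact: closed_inner_ball.
Qed.

(** The continuous function [1 - sqnorm x] attains a positive minimum on a nonempty compact subset
    of the ball. *)
Lemma compact_sub_inner_ball (K : set V) : compact K -> K `<=` B ->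
  exists2 dl, 0 < dl & K `<=` inner_ball dl.
Proof.
move=> cK KB; have [->|/set0P K0] := eqVneq K set0; first by exists 1.
have [|c cK' cmin] := @EVT_min_rV _ _ (peval (1 - psq)) _ K0 cK.
  by apply: continuous_subspaceT; exact: continuous_peval.
exists (1 - sqnorm c).
  by move: cK'; rewrite inE => /KB /ball_ge0/andP[].
by move=> x Kx; rewrite /inner_ball /= !sqnorm_peval cmin// inE.
Qed.

Lemma test_function_supp (phi : V -> R) : test_function phi ->
  exists2 dl, 0 < dl & forall x, 1 - sqnorm x < dl ->
    phi x = 0 /\ forall j, 'D_'e_j phi x = 0.
Proof.
move=> tphi; have [_ cK KB] := tphi; have [dl dl0 Kdl] := compact_sub_inner_ball cK KB.
exists dl => // x xdl; have nx : \forall y \near x, phi y = 0.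
  have : nbhs x (~` closure [set x | phi x != 0]).
    apply: open_nbhs_nbhs; split; first by apply: closed_openC; exact: closed_closure.
    by move=> /Kdl; rewrite /inner_ball /= leNgt xdl.
  apply: filterS => y ny; apply: contrapT => py; apply: ny.
  by apply: subset_closure => /=; exact/eqP.
split=> [|j]; first exact: nbhs_singleton nx.
by rewrite (@near_eq_derive _ _ _ phi (cst 0))// derive_cst.
Qed.

Lemma locally_integrableM (f k : V -> R) dl M : locally_integrable f -> 0 < dl ->
  measurable_fun setT k -> (forall x, `|k x| <= M) ->
  (forall x, 1 - sqnorm x < dl -> k x = 0) ->
  mu.-integrable B (EFin \o (fun x => f x * k x)).
Proof.
move=> [mf fi] dl0 mk kM k0; have mI := measurable_inner_ball dl.
have IB := @inner_ball_unit_ball R d _ dl0.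
have i1 : mu.-integrable (inner_ball dl) (EFin \o (fun x => f x * k x)).
  have ia : mu.-integrable (inner_ball dl) (EFin \o (fun x => M * `|f x|)).
    by apply: integrable_EFinZ => //; exact: (integrable_norm (fi _ dl0)).
  apply: integrable_le ia _ => //.
    apply: measurable_funM; first exact: (measurable_funS mB IB mf).
    exact: measurable_funTS.
  by move=> x _; rewrite normrM mulrC ler_wpM2r.
apply/(integrable_mkcond _ mB); have /(integrable_mkcond _ mI) := i1.
congr (is_true (mu.-integrable setT _)); apply/funext => x; rewrite !patchE.
case: ifPn => [|xI]; first by rewrite inE => /IB xB; rewrite mem_set.
case: ifP => // _; rewrite /= k0 ?mulr0//.
by move: xI; rewrite notin_setE /inner_ball /= => /negP; rewrite -ltNge.
Qed.

Lemma locally_integrable_test (f phi : V -> R) : locally_integrable f -> test_function phi ->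
  mu.-integrable B (EFin \o (fun x => f x * phi x)).
Proof.
move=> lf tphi; have [dl dl0 h0] := test_function_supp tphi.
have [M hM] := test_function_bounded tphi.
apply: (locally_integrableM lf dl0 _ hM); last by move=> x /h0[].
exact/continuous_measurable_rV/test_function_continuous.
Qed.

Lemma locally_integrable_test_derive (f phi : V -> R) j : locally_integrable f -> test_function phi ->
  mu.-integrable B (EFin \o (fun x => f x * 'D_'e_j phi x)).
Proof.
move=> lf tphi; have [dl dl0 h0] := test_function_supp tphi.
have [M hM] := test_function_derive_bounded tphi j.
apply: (locally_integrableM lf dl0 _ hM); last by move=> x /h0[].
exact/continuous_measurable_rV/test_function_derive_continuous.
Qed.

Lemma locally_integrableB f g : locally_integrable f -> locally_integrable g ->
  locally_integrable (fun x => f x - g x).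
Proof.
move=> [mf fi] [mg gi]; split; first exact: measurable_funB.
move=> dl dl0; have mI := measurable_inner_ball dl.
exact: integrable_EFinB (fi _ dl0) (gi _ dl0).
Qed.

Lemma locally_integrable_peval p : locally_integrable (peval p).
Proof.
split; first exact/measurable_funTS/measurable_peval.
move=> dl dl0; have [M hM] := peval_bounded p.
apply: (@bounded_integrable _ _ _ mu _ _ M); first exact: measurable_inner_ball.
- apply: le_lt_trans (@lebesgue_rV_ball R d); apply: le_measure; rewrite ?inE//.
  + exact: measurable_inner_ball.
  + exact: inner_ball_unit_ball.
- exact/measurable_funTS/measurable_peval.
- by move=> x /(inner_ball_unit_ball dl0); exact: hM.
Qed.

Lemma weak_derivativeB j f1 g1 f2 g2 :
  locally_integrable f1 -> locally_integrable g1 ->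
  locally_integrable f2 -> locally_integrable g2 ->
  weak_derivative j f1 g1 -> weak_derivative j f2 g2 ->
  weak_derivative j (fun x => f1 x - f2 x) (fun x => g1 x - g2 x).
Proof.
move=> lf1 lg1 lf2 lg2 w1 w2 phi tphi.
under eq_Rintegral do rewrite mulrBl.
rewrite RintegralB//; [|exact: locally_integrable_test_derive..].
under [in RHS]eq_Rintegral do rewrite mulrBl.
rewrite RintegralB//; [|exact: locally_integrable_test..].
by rewrite w1// w2//; ring.
Qed.

Lemma weak_derivative_peval j p : weak_derivative j (peval p) (peval (mderiv j p)).
Proof. by move=> phi tphi; exact: peval_test_function_ibp. Qed.

(* The sign of [f] is approximated by polynomials in the space weighted by
   [`|f|] times a cutoff, where it is orthogonal to all of them. *)
Lemma test_orthogonal_ae0 (f : V -> R) : locally_integrable f ->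
  (forall phi, test_function phi -> \int[mu]_(x in B) (f x * phi x) = 0) ->
  {ae mu, forall x, B x -> f x = 0}.
Proof.
move=> lf f0; have [mf fi] := lf.
(* The cutoff with parameter [dl] is positive exactly where [dl < 1 - sqnorm x]; the parameters
   [1/(n+1)] exhaust the ball at the end. *)
have step dl : 0 < dl -> {ae mu, forall x, B x -> dl < 1 - sqnorm x -> f x = 0}.
  move=> dl0; pose k : V -> R := bump dl 1 0 0.
  have kE x : k x = cutoff dl 0 0 (1 - sqnorm x) by rewrite /k /bump peval1 mul1r.
  have tk (p : poly) : test_function (bump dl p 0 0) := test_function_bumpy dl0 (bumpy_bump dl p 0 0).
  have k0 x : 0 <= k x by rewrite kE cutoff_ge0.
  pose w x := `|f x| * k x; pose s x := Num.sg (f x).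
  have mk : measurable_fun B k by exact/measurable_funTS/continuous_measurable_rV/continuous_bump.
  have mw : measurable_fun B w by apply: measurable_funM => //; exact: measurableT_comp.
  have w0 x : B x -> 0 <= w x by move=> _; rewrite mulr_ge0.
  have iw : mu.-integrable B (EFin \o w).
    have := integrable_norm (locally_integrable_test lf (tk 1)).
    congr (is_true (mu.-integrable B _)); apply/funext => x.
    by rewrite /= normrM (ger0_norm (k0 x)).
  have ms : measurable_fun B s.
    apply: (measurableT_comp (f := @Num.sg R)) => //; apply: nondecreasing_measurable => // x y xy.
    case: (sgrP x) => [x0|x0|x0]; case: (sgrP y) => [y0|y0|y0] //; lra.
  have Ls : L2w mu B w s.
    apply: (L2w_bounded mw w0 iw (M := 1)) => // x _.
    by rewrite /s normr_sg; case: (_ != 0).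
  have [_ As] := polynomials_dense mw w0 iw Ls.
  (* The sign of [f] times the weight is [f * k], and [k] times a polynomial is a test function. *)
  have sp p : dot mu B w s (peval p) = 0.
    rewrite -[RHS](f0 _ (tk p)); apply: eq_Rintegral => x _.
    rewrite /w /s /bump -kE.
    by transitivity ((Num.sg (f x) * `|f x|) * (peval p x * k x)); [ring|rewrite -numEsg].
  (* By orthogonality the squared distance from [s] to a polynomial is at least the squared norm of
     [s], which equals the integral of [w]; density makes that distance arbitrarily small. *)
  have I0 : \int[mu]_(x in B) w x = 0.
    have Iw : \int[mu]_(x in B) w x = dot mu B w s s.
      apply: eq_Rintegral => x _; rewrite /s /w -expr2 sqr_sg.
      by case: eqVneq => [->|_]; rewrite ?normr0 ?mul0r ?mulr0 ?mul1r.
    apply/eqP; rewrite eq_le; apply/andP; split; last exact: Rintegral_ge0.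
    apply/ler_addgt0Pr => e e0; rewrite add0r; have [p hp] := As _ e0.
    have Lp := L2w_peval mw w0 iw p.
    move: hp; rewrite dotBl//; last exact: L2wB.
    rewrite !dotBr// (dotC _ _ _ (peval p) s) !sp Iw.
    rewrite subr0 sub0r opprK => /ltW; apply: le_trans.
    by rewrite lerDl; exact: dot_ge0.
  have : (\int[mu]_(x in B) `|(w x)%:E| = 0)%E.
    under eq_integral => x xB do rewrite gee0_abs ?lee_fin ?w0 -?[B _]inE//.
    by rewrite -[LHS]fineK ?[fine _]I0//; exact: integrable_fin_num.
  have mwE : measurable_fun B (EFin \o w) by exact/measurable_EFinP.
  move/(ae_eq_integral_abs mu mB mwE); apply: filterS => x wx Bx dlx.
  have /eqP : w x = 0 by case: (wx Bx).
  rewrite /w mulf_eq0 normr_eq0 => /orP[/eqP //|].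
  rewrite kE /cutoff powRr0 mul1r /flat subr_gt0 dlx mul1r.
  by rewrite gt_eqF ?expR_gt0.
have := ae_foralln (fun n => step _ (harmonic_gt0 n)).
apply: filterS => x hx Bx; have /andP[s0 _] := ball_ge0 Bx.
have [n _ hn] : \forall n \near \oo, h n < 1 - sqnorm x by exact: (cvgr_lt _ (@cvg_harmonic R)).
by apply: (hx n) => //; exact: (hn n (leqnn n)).
Qed.

End real_weak_derivatives.

Lemma measurable_sumR dT (T : measurableType dT) (R : realType) (D : set T)
    (I : Type) (s : seq I) (f : I -> T -> R) :
  (forall i, measurable_fun D (f i)) -> measurable_fun D (fun x => \sum_(i <- s) f i x).
Proof.
move=> mf; elim: s => [|i s IH].
  by under eq_fun do rewrite big_nil; exact: measurable_cst.
by under eq_fun do rewrite big_cons; exact: measurable_funD.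
Qed.

Lemma cvg_sumR (R : realType) (I : Type) (s : seq I) (f : I -> nat -> R) (l : I -> R) :
  (forall i, f i n @[n --> \oo] --> l i) ->
  \sum_(i <- s) f i n @[n --> \oo] --> \sum_(i <- s) l i.
Proof.
move=> fl; elim: s => [|i s IH].
  by under eq_fun do rewrite big_nil; rewrite big_nil; exact: cvg_cst.
by under eq_fun do rewrite big_cons; rewrite big_cons; exact: cvgD.
Qed.

Section weighted_L2_ae.
Context dT (T : measurableType dT) (R : realType) (mu : {measure set T -> \bar R}).
Variables (D : set T) (w : T -> R).
Hypotheses (mD : measurable D) (mw : measurable_fun D w).

Lemma L2w_ae (f g : T -> R) : measurable_fun D g -> {ae mu, forall x, D x -> f x = g x} ->
  L2w mu D w f -> L2w mu D w g.
Proof.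
move=> mg fg [mf /integrableP[mfw fi]]; split=> //.
have mgw : measurable_fun D (EFin \o (fun x => g x ^+ 2 * w x)).
  by apply/measurable_EFinP; apply: measurable_funM => //; exact: measurable_funX.
apply/integrableP; split => //; apply: le_lt_trans fi.
rewrite le_eqVlt; apply/orP; left; apply/eqP; apply: ae_eq_integral => //.
- exact: measurableT_comp.
- exact: measurableT_comp.
- by apply: filterS fg => x fg Dx; rewrite /= fg.
Qed.

Lemma dot_ae (f g h : T -> R) : measurable_fun D g -> {ae mu, forall x, D x -> f x = g x} ->
  measurable_fun D f -> measurable_fun D h -> dot mu D w f h = dot mu D w g h.
Proof.
move=> mg fg mf mh; rewrite /dot /Rintegral; congr fine; apply: ae_eq_integral => //.
- by apply/measurable_EFinP; apply: measurable_funM => //; apply: measurable_funM.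
- by apply/measurable_EFinP; apply: measurable_funM => //; apply: measurable_funM.
- by apply: filterS fg => x fg Dx; rewrite /= fg.
Qed.

End weighted_L2_ae.

(** * Integration by parts with the weight *)

Section weighted_integration_by_parts.
Context {R : realType} {d : nat} (alpha : R).
Hypothesis alpha_gtN1 : -1 < alpha.
Local Notation V := 'rV[R]_d.
Local Notation poly := (mpoly d R).
Local Notation "'X_ i" := (@mpolyX d R (mnm1 i)) (at level 8, i at level 2).
Local Notation mu := (@lebesgue_rV R d).
Local Notation B := (@unit_ball R d).
Local Notation h := (@harmonic R).
Local Notation W := (@weight R d alpha).
Local Notation L2a := (L2w mu B W).
Local Notation dota := (dot mu B W).
Let mB := @measurable_unit_ball R d.

Lemma measurable_weight_ball : measurable_fun B W.
Proof. exact/measurable_funTS/measurable_weight. Qed.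

Lemma weight_ge0 x : B x -> 0 <= W x.
Proof. by move=> _; exact: powR_ge0. Qed.

Let mW := measurable_weight_ball.
Let W0 := weight_ge0.
Let iW := @integrable_weight R d alpha alpha_gtN1.

(** The difference of the two candidates is orthogonal to all test functions. This is what permits
    replacing the representative chosen by [wgrad] with an explicit one. *)
Lemma weak_derivative_unique j f g1 g2 : locally_integrable g1 -> locally_integrable g2 ->
  weak_derivative j f g1 -> weak_derivative j f g2 ->
  {ae mu, forall x, B x -> g1 x = g2 x}.
Proof.
move=> lg1 lg2 w1 w2; have := test_orthogonal_ae0 (locally_integrableB lg1 lg2).
have o phi : test_function phi -> \int[mu]_(x in B) ((g1 x - g2 x) * phi x) = 0.
  move=> tphi; under eq_Rintegral do rewrite mulrBl.
  rewrite RintegralB//; [|exact: locally_integrable_test..].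
  by rewrite -[X in X - _]opprK -[X in _ - X]opprK -w1// -w2// subrr.
by move/(_ o); apply: filterS => x h Bx; apply/eqP; rewrite -subr_eq0 h.
Qed.

(** The divergence theorem for the field [F] times the weight. Differentiating the weight lowers its
    exponent to [alpha - 1], which need not be integrable; the factor [1 - psq] in the radial
    component restores [alpha] and leaves [2 alpha r]. *)
Lemma weighted_ibp (f : V -> R) (g : 'I_d -> V -> R) (F : 'I_d -> poly) (r : poly) :
  locally_integrable f -> (forall j, locally_integrable (g j)) ->
  L2a f -> (forall j, L2a (g j)) -> (forall j, weak_derivative j f (g j)) ->
  \sum_j 'X_j * F j = (1 - psq) * r ->
  \sum_j dota (g j) (peval (F j)) =
  dota f (peval ((2 * alpha) *: r - \sum_j mderiv j (F j))).
Proof.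
move=> lf lg Lf Lg wfg Fr; pose divF := \sum_j mderiv j (F j).
pose phi n j : V -> R := bump (h n) (F j) alpha 0.
have tphi n j : test_function (phi n j) := test_function_bumpy (harmonic_gt0 n) (bumpy_bump _ _ _ _).
(* [a] is the truncated weight and [b] the error from differentiating the exponential: it tends to 0
   pointwise and stays below 5 times the weight, so it disappears in the limit. *)
pose a n (x : V) := cutoff (h n) alpha 0 (1 - sqnorm x).
pose b n (x : V) := (1 - sqnorm x) * (h n * cutoff (h n) alpha 2 (1 - sqnorm x)).
have divphi n x : B x -> \sum_j 'D_'e_j (phi n j) x =
    peval (divF - (2 * alpha) *: r) x * a n x - 2 * peval r x * b n x.
  move=> Bx; have /andP[s0 s1] := ball_ge0 Bx.
  have Dphi j : 'D_'e_j (phi n j) x = peval (mderiv j (F j)) x * a n x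
      - peval ('X_j * F j) x * (2 * alpha * cutoff (h n) (alpha - 1) 0 (1 - sqnorm x)
         + 2 * (h n * cutoff (h n) alpha 2 (1 - sqnorm x))).
    have D := is_derive_bump (F j) alpha 0 j x (@harmonic_gt0 R n).
    by rewrite derive_val /bump !pevalE /a; ring.
  under eq_bigr do rewrite Dphi.
  rewrite sumrB -!mulr_suml -!peval_sum Fr pevalM -sqnorm_peval !pevalE /b -/divF.
  (* Here the factor [1 - psq] of the hypothesis on [F] raises the exponent back to [alpha]. *)
  have E : (1 - sqnorm x) * cutoff (h n) (alpha - 1) 0 (1 - sqnorm x) = a n x.
    rewrite /a /cutoff mulrA; congr (_ * _); rewrite -{1}(powRr1 (ltW s0)) -powRD.
      by congr (_ `^ _); ring.
    by apply/implyP => _; rewrite gt_eqF.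
  by rewrite -E; ring.
have eqn n : \int[mu]_(x in B) (f x * (peval (divF - (2 * alpha) *: r) x * a n x - 2 * peval r x * b n x))
    = - \int[mu]_(x in B) \sum_j (g j x * (peval (F j) x * a n x)).
  rewrite Rintegral_sum//; last by move=> j; exact: locally_integrable_test (tphi n j).
  rewrite -sumrN; under [RHS]eq_bigr do rewrite -(wfg _ _ (tphi n _)).
  rewrite -Rintegral_sum//; last by move=> j; exact: locally_integrable_test_derive (tphi n j).
  by apply: eq_Rintegral => x /[!inE] Bx; rewrite -divphi// mulr_sumr.
have ac x : B x -> a n x @[n --> \oo] --> W x.
  move=> Bx; have /andP[s0 _] := ball_ge0 Bx.
  by have := @cutoff_cvg R alpha 0 _ s0; rewrite expr0 mulr1.
have bc x : B x -> b n x @[n --> \oo] --> (0 : R).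
  move=> Bx; have /andP[s0 _] := ball_ge0 Bx.
  suff : b n x @[n --> \oo] --> (1 - sqnorm x) * (0 * ((1 - sqnorm x) `^ alpha * (1 - sqnorm x)^-1 ^+ 2)).
    by rewrite mul0r mulr0.
  apply: cvgMl_tmp; apply: cvgM; first exact: cvg_harmonic.
  exact: cutoff_cvg.
have aW n x : 0 <= a n x <= W x.
  by rewrite cutoff_ge0 cutoff_le_powR// harmonic_gt0.
have bW n x : B x -> 0 <= b n x <= 5 * W x.
  move=> /ball_ge0/andP[s0 _].
  apply/andP; split; last exact: cutoff2_le (harmonic_gt0 n).
  by rewrite /b mulr_ge0//; [exact: ltW|rewrite mulr_ge0 ?cutoff_ge0// ltW// harmonic_gt0].
have mbump n p k : measurable_fun B (bump (h n) p alpha k : V -> R).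
  exact/measurable_funTS/continuous_measurable_rV/continuous_bump/harmonic_gt0.
have ma n : measurable_fun B (a n).
  have := mbump n 1 0%N; congr (measurable_fun B _).
  by apply/funext => x; rewrite /bump peval1 mul1r.
have mb n : measurable_fun B (b n).
  have := mbump n (h n *: (1 - psq)) 2%N; congr (measurable_fun B _).
  by apply/funext => x; rewrite /bump /b pevalZ -sqnorm_peval; ring.
have mp p : measurable_fun B (peval p) by exact/measurable_funTS/measurable_peval.
have [M1 hM1] := peval_bounded (divF - (2 * alpha) *: r).
have [M2 hM2] := peval_bounded r.
have mf : measurable_fun B f by case: Lf.
have mg j : measurable_fun B (g j) by case: (Lg j).
have ifW (k : V -> R) : L2a k -> mu.-integrable B (EFin \o (fun x => `|k x| * W x)).
  move=> Lk; have i1 := integrable_norm (integrable_dot mB mW W0 Lk (L2w_peval mW W0 iW 1)).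
  apply: (integrable_le mB _ i1).
    by apply: measurable_funM => //; apply: measurableT_comp => //; case: Lk.
  by move=> x Bx; rewrite /= peval1 mulr1 !normrM normr_id.
(* The constant 10 is the coefficient 2 of [b] times the 5 in its bound. *)
have [||||_ c1] := @dominated_convergence_Rintegral _ _ _ mu B
   (fun n x => f x * (peval (divF - (2 * alpha) *: r) x * a n x - 2 * peval r x * b n x))
   (fun x => f x * (peval (divF - (2 * alpha) *: r) x * W x - 2 * peval r x * 0))
   (fun x => (M1 + 10 * M2) * (`|f x| * W x)) mB.
- move=> n; apply: measurable_funM => //; apply: measurable_funB; apply: measurable_funM => //.
  exact: measurable_funM.
- move=> x Bx; apply: cvgMl_tmp; apply: cvgB; apply: cvgMl_tmp; [exact: ac|exact: bc].
- by apply: integrable_EFinZ => //; exact: ifW.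
- move=> n x Bx; rewrite normrM [leRHS]mulrCA ler_wpM2l//.
  have /andP[a0 a1] := aW n x; have /andP[b0 b1] := bW n x Bx.
  apply: le_trans (ler_normB _ _) _; rewrite [leRHS]mulrDl lerD//.
    by rewrite normrM (ger0_norm a0) ler_pM ?hM1.
  rewrite 2!normrM (ger0_norm b0) (@ger0_norm _ 2)// (_ : 10 * M2 * _ = 2 * M2 * (5 * W x)); last by ring.
  by apply: ler_pM => //; rewrite ler_pM2l// hM2.
have [||||_ c2] := @dominated_convergence_Rintegral _ _ _ mu B
   (fun n x => \sum_j (g j x * (peval (F j) x * a n x)))
   (fun x => \sum_j (g j x * (peval (F j) x * W x)))
   (fun x => \sum_j `|g j x * peval (F j) x * W x|) mB.
- move=> n; apply: measurable_sumR => j; apply: measurable_funM => //.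
  exact: measurable_funM.
- move=> x Bx; apply: cvg_sumR => j; apply: cvgMl_tmp; apply: cvgMl_tmp; exact: ac.
- apply: integrable_sum_EFin => // j; apply: integrable_norm.
  exact: integrable_dot (Lg j) (L2w_peval mW W0 iW _).
- move=> n x Bx; apply: le_trans (ler_norm_sum _ _ _) _; apply: ler_sum => j _.
  rewrite mulrA [`|_ * a n x|]normrM [`|_ * W x|]normrM ler_wpM2l//; have /andP[a0 a1] := aW n x.
  by rewrite ger0_norm// (le_trans a1)// ler_norm.
have lim : \int[mu]_(x in B) (f x * (peval (divF - (2 * alpha) *: r) x * W x - 2 * peval r x * 0))
    = - \int[mu]_(x in B) \sum_j (g j x * (peval (F j) x * W x)).
  rewrite -(cvg_lim (@Rhausdorff R) c1); apply: cvg_lim => //.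
  by under eq_fun do rewrite eqn; exact: cvgN.
transitivity (\int[mu]_(x in B) \sum_j (g j x * (peval (F j) x * W x))).
  rewrite Rintegral_sum//; last first.
    move=> j; have := integrable_dot mB mW W0 (Lg j) (L2w_peval mW W0 iW (F j)).
    by congr (is_true (mu.-integrable B _)); apply/funext => x; rewrite /= mulrA.
  by apply: eq_bigr => j _; apply: eq_Rintegral => x _; rewrite mulrA.
rewrite -[LHS]opprK -lim -mulN1r -RintegralZl//.
  by apply: eq_Rintegral => x _; rewrite !pevalE; ring.
have := integrable_dot mB mW W0 Lf (L2w_peval mW W0 iW (divF - (2 * alpha) *: r)).
congr (is_true (mu.-integrable B _)); apply/funext => x /=.
by rewrite mulr0 subr0 mulrA.
Qed.

End weighted_integration_by_parts.

(** * Euler operator, Laplacian, homogeneity and degree *)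

Lemma msize_leP (K : nzRingType) (d n : nat) (p : mpoly d K) :
  (msize p <= n.+1)%N <-> forall m, (n < mdeg m)%N -> mcoeff m p = 0.
Proof.
split=> [h m nm|h]; first by apply: memN_msupp_eq0; apply: msize_mdeg_ge; exact: leq_trans nm.
rewrite msizeE; apply/bigmax_leqP_seq => m mp _; rewrite ltnS leqNgt.
by apply/negP => /h /eqP; rewrite mcoeff_eq0 mp.
Qed.

Section euler_laplace.
Context {R : realType} {d : nat}.
Local Notation poly := (mpoly d R).
Local Notation "'X_ i" := (@mpolyX d R (mnm1 i)) (at level 8, i at level 2).
Implicit Types (p q : poly) (c : R).

Definition euler p : poly := \sum_j 'X_j * mderiv j p.
Definition laplace p : poly := \sum_j mderiv j (mderiv j p).

Lemma eulerD p q : euler (p + q) = euler p + euler q.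
Proof. by rewrite /euler -big_split; apply: eq_bigr => j _; rewrite mderivD mulrDr. Qed.

Lemma eulerZ c p : euler (c *: p) = c *: euler p.
Proof.
rewrite /euler scaler_sumr; apply: eq_bigr => j _.
by rewrite mderivZ -!mul_mpolyC mulrCA.
Qed.

Lemma laplaceD p q : laplace (p + q) = laplace p + laplace q.
Proof. by rewrite /laplace -big_split; apply: eq_bigr => j _; rewrite !mderivD. Qed.

Lemma laplaceZ c p : laplace (c *: p) = c *: laplace p.
Proof. by rewrite /laplace scaler_sumr; apply: eq_bigr => j _; rewrite !mderivZ. Qed.

Lemma eulerM p q : euler (p * q) = euler p * q + p * euler q.
Proof.
rewrite /euler mulr_suml mulr_sumr -big_split; apply: eq_bigr => j _ /=.
by rewrite mderivM; ring.
Qed.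

Lemma mderiv1 (j : 'I_d) : mderiv j 1 = 0 :> poly.
Proof. by rewrite -mpolyC1 mderivC. Qed.

Lemma euler_psq : euler psq = 2 *: psq.
Proof.
rewrite /euler /psq scaler_sumr; apply: eq_bigr => j _.
by rewrite -/psq mderiv_psq -!mul_mpolyC mulrCA.
Qed.

Lemma laplace_psqM p :
  laplace (psq * p) = (2 * d%:R) *: p + 4 *: euler p + psq * laplace p.
Proof.
rewrite /laplace /euler scaler_sumr mulr_sumr.
have -> : (2 * d%:R) *: p = \sum_(j < d) 2 *: p.
  by rewrite sumr_const card_ord -[RHS]scaler_nat scalerA mulrC.
rewrite -!big_split; apply: eq_bigr => j _ /=.
rewrite mderivM mderiv_psq mderivD !mderivM mderivZ mderivXU eqxx mderiv_psq.
by rewrite -!mul_mpolyC !rmorph_nat [true%:R]mulr1n; ring.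
Qed.

Lemma euler_mderiv j p : euler (mderiv j p) = mderiv j (euler p) - mderiv j p.
Proof.
apply/eqP; rewrite eq_sym subr_eq; apply/eqP.
rewrite /euler (big_morph _ (mderivD j) (mderiv0 _ j)).
rewrite (eq_bigr (fun i => 'X_i * mderiv i (mderiv j p) + (j == i)%:R * mderiv i p)); last first.
  by move=> i _; rewrite mderivM mderivXU mderiv_comm addrC.
rewrite big_split /=; congr (_ + _).
rewrite (bigD1 j)//= eqxx mul1r big1 ?addr0// => i ij.
by rewrite eq_sym (negPf ij) mul0r.
Qed.

Lemma euler_laplace p : euler (laplace p) = laplace (euler p) - 2 *: laplace p.
Proof.
rewrite {1}/laplace (big_morph euler (id1 := 0) (op1 := +%R) eulerD); last first.
  by rewrite -(scale0r (0 : poly)) eulerZ !scale0r.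
rewrite (eq_bigr (fun j => mderiv j (mderiv j (euler p)) - 2 *: mderiv j (mderiv j p))).
  by rewrite sumrB -scaler_sumr.
move=> j _; rewrite euler_mderiv euler_mderiv mderivB.
by rewrite -mul_mpolyC rmorph_nat; ring.
Qed.

(** Monomials are eigenvectors of the Euler operator, with their degree as eigenvalue; this connects
    the differential operators with [mdeg]. *)
Lemma mcoeff_euler p (m : multinom d) : mcoeff m (euler p) = (mdeg m)%:R * mcoeff m p.
Proof.
have EX (k : multinom d) : euler (mpolyX R k) = (mdeg k)%:R *: mpolyX R k.
  rewrite /euler mdegE natr_sum scaler_suml; apply: eq_bigr => i _.
  rewrite mderivX -mul_mpolyC mulrCA mul_mpolyC -mpolyXD.
  have [k0|k0] := posnP (k i); first by rewrite k0 !scale0r.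
  by rewrite addmC submK// lep1mP -lt0n.
have E0 : euler 0 = 0 by rewrite -(scale0r (0 : poly)) eulerZ !scale0r.
elim/mpolyind: p => [|c k p _ _ IH]; first by rewrite E0 !mcoeff0 mulr0.
rewrite eulerD eulerZ EX !mcoeffD !mcoeffZ mcoeffX IH mulrDr; congr (_ + _).
by case: eqVneq => [->|_]; rewrite ?mulr0 ?mulr1// mulrC.
Qed.

(* Euler's identity serves as the definition of homogeneity. *)
Definition homog c p := euler p = c *: p.

Lemma homog_mcoeff c p m : homog c p -> mcoeff m p != 0 -> (mdeg m)%:R = c.
Proof.
move=> hp pm; have := mcoeff_euler p m; rewrite hp mcoeffZ => /eqP.
by rewrite (inj_eq (mulIf pm)) => /eqP.
Qed.

(** Degrees of homogeneity are real numbers, so iterated Laplacians lower them without truncation;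
    below zero only the polynomial 0 is left. *)
Lemma homog_lt0 c p : homog c p -> c < 0 -> p = 0.
Proof.
move=> hp c0; apply/mpolyP => m; rewrite mcoeff0; apply/eqP; apply: contraTT c0.
by move/(homog_mcoeff hp) <-; rewrite -leNgt.
Qed.

Lemma homog_mpolyX m : homog (mdeg m)%:R (mpolyX R m).
Proof.
apply/mpolyP => k; rewrite mcoeff_euler mcoeffZ mcoeffX.
by case: eqVneq => [->|]//; rewrite !mulr0.
Qed.

Lemma homog_laplace c p : homog c p -> homog (c - 2) (laplace p).
Proof. by move=> hp; rewrite /homog euler_laplace hp laplaceZ scalerBl. Qed.

Lemma homog_psqM c p : homog c p -> homog (c + 2) (psq * p).
Proof.
move=> hp; rewrite /homog eulerM hp euler_psq -!mul_mpolyC rmorphD/=; ring.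
Qed.

Lemma homog_psqXM j c p : homog c p -> homog (c + 2 * j%:R) (psq ^+ j * p).
Proof.
move=> hp; elim: j => [|j IH]; first by rewrite mulr0 addr0 expr0 mul1r.
rewrite exprS -mulrA -[j.+1%:R]natr1 mulrDr mulr1 addrA; exact: homog_psqM.
Qed.

(** The classical formula for the Laplacian of [|x|^(2j) p], multiplied by [|x|^2] so that [j = 0]
    is no exception. *)
Lemma laplace_psqXM j c p : homog c p ->
  psq * laplace (psq ^+ j * p) =
  (2 * j%:R * (2 * j%:R + 2 * c + d%:R - 2)) *: (psq ^+ j * p) + psq ^+ j.+1 * laplace p.
Proof.
move=> hp; elim: j => [|j IH].
  by rewrite mulr0 mul0r scale0r add0r expr0 mul1r expr1.
rewrite exprS -mulrA laplace_psqM (homog_psqXM j hp) IH [psq ^+ j.+2]exprS.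
set P := psq ^+ j * p; rewrite -[j.+1%:R]natr1 -!mul_mpolyC !(rmorphM, rmorphD, rmorphB, rmorph_nat)/=.
rewrite exprS; ring.
Qed.

(** A condition on coefficients, which makes stability under linear combinations immediate; [degleP]
    is the link to [msize]. *)
Definition degle n p : Prop := forall m, (n < mdeg m)%N -> mcoeff m p = 0.

Lemma degleP n p : degle n p <-> (msize p <= n.+1)%N.
Proof. exact: iff_sym (msize_leP n p). Qed.

Lemma degleD n p q : degle n p -> degle n q -> degle n (p + q).
Proof. by move=> hp hq m nm; rewrite mcoeffD hp// hq// addr0. Qed.

Lemma degleZ n c p : degle n p -> degle n (c *: p).
Proof. by move=> hp m nm; rewrite mcoeffZ hp// mulr0. Qed.

Lemma degleB n p q : degle n p -> degle n q -> degle n (p - q).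
Proof. by move=> hp hq m nm; rewrite mcoeffB hp// hq// subrr. Qed.

Lemma degleW n k p : (n <= k)%N -> degle n p -> degle k p.
Proof. by move=> nk hp m km; apply: hp; exact: leq_ltn_trans km. Qed.

Lemma degle0 n : degle n 0.
Proof. by move=> m _; rewrite mcoeff0. Qed.

Lemma degleC n c : degle n (mpolyC d c).
Proof.
move=> m nm; rewrite mcoeffC; case: eqVneq => [m0|]; last by rewrite mulr0.
by move: nm; rewrite m0 mdeg0.
Qed.

Lemma degle0_const p : degle 0 p -> exists c, p = mpolyC d c.
Proof. by move=> /degleP/msize1_polyC ->; eexists. Qed.

Lemma homog_degle n p : homog n%:R p -> degle n p.
Proof.
move=> hp m nm; apply/eqP; apply: contraLR nm => /(homog_mcoeff hp)/eqP.
by rewrite eqr_nat -leqNgt => /eqP ->.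
Qed.

Lemma degle_ind n (Z : poly -> Prop) : Z 0 -> (forall p q, Z p -> Z q -> Z (p + q)) ->
  (forall c p, Z p -> Z (c *: p)) ->
  (forall m, (mdeg m <= n)%N -> Z (mpolyX R m)) -> forall p, degle n p -> Z p.
Proof.
move=> Z0 ZD ZZ ZX p hp; rewrite [p]mpolyE big_seq.
apply: (big_ind Z) => // m mp; apply: ZZ; apply: ZX; rewrite leqNgt; apply/negP => /hp/eqP.
by rewrite mcoeff_eq0 mp.
Qed.

End euler_laplace.

(** * The range of the Neumann operator *)

Section neumann_range.
Context {R : realType} {d : nat} (alpha : R).
Hypotheses (d_gt0 : (0 < d)%N) (alpha_gtN1 : -1 < alpha).
Local Notation poly := (mpoly d R).

(* [- s^-alpha div (s^alpha grad q)] for [w] homogeneous of degree [n],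
   [s = 1 - |x|^2] and [q = w + n/2 s w]: the term in [n/2] makes the radial
   derivative of [q] vanish on the sphere, so that the result is a polynomial. *)
Definition neumann (n : nat) (w : poly) : poly :=
  (- (1 + n%:R / 2)) *: laplace w + (n%:R / 2) *: (psq * laplace w)
  + (n%:R * (d%:R + 2 * n%:R + 2 * alpha + alpha * n%:R)) *: w.

(* On the forms [psq ^+ j * laplace^j w] the operator [psq * laplace] is upper
   triangular with nonnegative diagonal entries, whence the descent on [j]. *)
Lemma degle_neumann (k : nat) (Z : poly -> Prop) :
  Z 1 -> (forall p q, Z p -> Z q -> Z (p + q)) -> (forall c p, Z p -> Z (c *: p)) ->
  (forall n w, (n <= k)%N -> homog n%:R w -> Z (neumann n w)) ->
  forall p, degle k p -> Z p.
Proof.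
move=> Z1 ZD ZZ ZS; have Z0 : Z 0 by rewrite -(scale0r (1 : poly)); exact: ZZ.
have ZB p q : Z p -> Z q -> Z (p - q).
  by move=> Zp Zq; apply: ZD => //; rewrite -scaleN1r; exact: ZZ.
suff Zh n : (n <= k)%N -> forall w, homog n%:R w -> Z w.
  by apply: degle_ind => // m mk; exact: Zh mk _ (homog_mpolyX m).
elim/ltn_ind: n => n IH nk w hw.
have [n0|n0] := posnP n.
  have [c ->] : exists c, w = mpolyC d c by apply: degle0_const; rewrite -n0; exact: homog_degle.
  by rewrite -[mpolyC d c]mulr1 mul_mpolyC; exact: ZZ.
have n1 : 1 <= n%:R :> R by rewrite ler1n.
have d1 : 1 <= d%:R :> R by rewrite ler1n.
(* The Laplacian has degree [n - 2], or vanishes for [n < 2], so the outer induction on the degree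
   already places it in [Z]. Modulo [Z] only [psq * laplace] and the multiple of [w] remain. *)
have Zlap q : homog n%:R q -> Z (laplace q).
  move=> hq; have hl := homog_laplace hq.
  have [n2|n2] := leqP 2 n.
    by apply: (IH (n - 2)%N); [lia|lia|rewrite natrB].
  by rewrite (homog_lt0 hl)// subr_lt0 ltr_nat.
pose c := n%:R * (d%:R + 2 * n%:R + 2 * alpha + alpha * n%:R).
have a1 : 0 < alpha + 1 by rewrite -ltrBlDr sub0r.
have an : 0 < (alpha + 1) * (n%:R + 2) by rewrite mulr_gt0// ltr_wpDl.
(* The rewriting isolates [(alpha + 1) (n + 2)]; what is left, [d + n - 2], is nonnegative as [d]
   and [n] are at least 1. *)
have c0 : 0 < c.
  rewrite /c mulr_gt0 ?ltr0n//.
  rewrite (_ : _ + alpha * n%:R = (alpha + 1) * (n%:R + 2) + (d%:R + n%:R - 2)); last by ring.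
  by rewrite ltr_wpDr//; lra.
have step q : homog n%:R q -> Z ((n%:R / 2) *: (psq * laplace q) + c *: q).
  move=> hq; have := ZB _ _ (ZS n q nk hq) (ZZ (- (1 + n%:R / 2)) _ (Zlap _ hq)).
  by congr Z; rewrite /neumann -/c; ring.
pose g j := psq ^+ j * iter j laplace w.
have hlap j : homog (n%:R - 2 * j%:R) (iter j laplace w).
  elim: j => [|j IHj]; first by rewrite mulr0 subr0.
  by rewrite -[j.+1%:R]natr1 mulrDr mulr1 opprD addrA; exact: homog_laplace.
have hg j : homog n%:R (g j).
  by have := homog_psqXM j (hlap j); rewrite subrK.
(* [i] bounds how far [j] is below [n.+1], where the iterated Laplacian has negative degree and
   vanishes. *)
suff : forall i j, (n.+1 <= i + j)%N -> Z (g j).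
  by move=> /(_ n.+1 0%N); rewrite /g expr0 mul1r; apply; rewrite addn0.
elim=> [|i IHi] j ij.
  rewrite /g (homog_lt0 (hlap j)) ?mulr0// subr_lt0 -natrM ltr_nat; lia.
have [nj|nj] := ltnP n (2 * j).
  by rewrite /g (homog_lt0 (hlap j)) ?mulr0// subr_lt0 -natrM ltr_nat.
have := step _ (hg j); rewrite (laplace_psqXM j (hlap j)) -iterS.
set mu := 2 * j%:R * _; have mu0 : 0 <= mu.
  have nj' : 2 * j%:R <= n%:R :> R by rewrite -natrM ler_nat.
  rewrite /mu; case: (j) nj' => [|j'] nj'; first by rewrite mulr0 mul0r.
  have : 1 <= j'.+1%:R :> R by rewrite ler1n.
  by move=> j1; rewrite mulr_ge0 ?mulr_ge0//; lra.
rewrite -/(g j) -/(g j.+1) => h.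
(* The coefficient of [g j]; being positive, it can be divided out once [g j.+1] is known to lie in
   [Z]. *)
have e0 : 0 < n%:R / 2 * mu + c by apply: ltr_wpDl => //; apply: mulr_ge0 => //; exact: divr_ge0.
have := ZZ (n%:R / 2 * mu + c)^-1 _ (ZB _ _ h (ZZ (n%:R / 2) _ (IHi j.+1 _))).
rewrite -addSnnS => /(_ ij); congr Z.
rewrite (_ : _ + _ - _ = (n%:R / 2 * mu + c) *: g j).
  by rewrite scalerA mulVf ?scale1r// gt_eqF.
by rewrite scalerDr scalerA scalerDl; ring.
Qed.

End neumann_range.

(** * Projection for positive semidefinite forms *)

Section projection.
Context {R : realType} {d : nat}.
Local Notation poly := (mpoly d R).

Fixpoint lspan (s : seq poly) (p : poly) : Prop :=
  if s is q :: s' then exists c p', lspan s' p' /\ p = c *: q + p' else p = 0.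

Variables (b : poly -> poly -> R) (l : poly -> R).
Hypotheses (bC : forall p q, b p q = b q p)
  (bD : forall p q r, b (p + q) r = b p r + b q r)
  (bZ : forall c p r, b (c *: p) r = c * b p r)
  (lD : forall p q, l (p + q) = l p + l q) (lZ : forall c p, l (c *: p) = c * l p)
  (l0 : forall q, b q q = 0 -> l q = 0).

Lemma lspan_eq0 s p q : (forall t, t \in s -> b p t = l t) -> lspan s q -> b p q = l q.
Proof.
have b0 : b p 0 = 0 by rewrite bC -(scale0r (0 : poly)) bZ mul0r.
have l00 : l 0 = 0 by rewrite -(scale0r (0 : poly)) lZ mul0r.
elim: s q => [|t s IH] q h /=; first by move=> ->; rewrite b0 l00.
move=> [c [q' [sq' ->]]]; rewrite bC bD bZ lD lZ -!(bC p).
rewrite h ?mem_head// IH// => u us; apply: h; by rewrite in_cons us orbT.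
Qed.

End projection.

Section projection_exists.
Context {R : realType} {d : nat}.
Local Notation poly := (mpoly d R).

Lemma lspanD (s : seq poly) p q : lspan s p -> lspan s q -> lspan s (p + q).
Proof.
elim: s p q => [|t s IH] p q /=; first by move=> -> ->; rewrite addr0.
move=> [c [p' [sp ->]]] [c' [q' [sq ->]]]; exists (c + c'), (p' + q').
by split; [exact: IH|rewrite scalerDl; ring].
Qed.

Lemma lspanZ (s : seq poly) c p : lspan s p -> lspan s (c *: p).
Proof.
elim: s p => [|t s IH] p /=; first by move=> ->; rewrite scaler0.
move=> [c' [p' [sp ->]]]; exists (c * c'), (c *: p').
by split; [exact: IH|rewrite scalerDr scalerA].
Qed.

Lemma lspan_cons (s : seq poly) t p : lspan s p -> lspan (t :: s) p.
Proof. by move=> sp; exists 0, p; rewrite scale0r add0r. Qed.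

Variable b : poly -> poly -> R.
Hypotheses (bC : forall p q, b p q = b q p)
  (bD : forall p q r, b (p + q) r = b p r + b q r)
  (bZ : forall c p r, b (c *: p) r = c * b p r)
  (b_ge0 : forall p, 0 <= b p p).

Lemma psd_null p q : b q q = 0 -> b p q = 0.
Proof.
move=> q0; apply: (@affine_ge0_eq0 _ (b p p)) => t.
have bZr c x y : b y (c *: x) = c * b y x by rewrite bC bZ bC.
have := b_ge0 (p + (- (t / 2)) *: q); rewrite bD bZ !(bC _ (_ + _)) !bD !bZ q0 (bC q p).
by congr (0 <= _); field.
Qed.

(** Riesz representation by Gram-Schmidt, one vector at a time. Definiteness is replaced by the
    condition that [l] vanish on null vectors; [psd_null] shows that [b q] meets it, so the
    induction hypothesis also projects the new vector [q]. *)
Lemma projection_seq (l : poly -> R) (s : seq poly) :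
  (forall p q, l (p + q) = l p + l q) -> (forall c p, l (c *: p) = c * l p) ->
  (forall q, b q q = 0 -> l q = 0) ->
  exists2 p, lspan s p & forall t, t \in s -> b p t = l t.
Proof.
elim: s l => [|q s IH] l lD lZ l0; first by exists 0.
have [p sp hp] := IH l lD lZ l0.
have [q' sq hq] := IH (b q) (fun x y => etrans (bC _ _) (etrans (bD _ _ _) (congr2 _ (bC _ _) (bC _ _))))
  (fun c x => etrans (bC _ _) (etrans (bZ _ _ _) (congr1 _ (bC _ _)))) (@psd_null q).
pose r := q - q'.
have rs t : t \in s -> b r t = 0 by move=> ts; rewrite /r -scaleN1r bD bZ hq//; ring.
have lB x y : l (x - y) = l x - l y by rewrite -scaleN1r lD lZ mulN1r.
have rp p' : lspan s p' -> b r p' = 0.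
  move=> sp'; apply: (@lspan_eq0 _ _ b (fun=> 0) bC bD bZ _ _ s r p' _ sp') => //.
  - by move=> *; rewrite addr0.
  - by move=> *; rewrite mulr0.
have qE : q = r + q' by rewrite subrK.
have bq' p' : lspan s p' -> b p' q = b p' q' .
  by move=> sp'; rewrite {1}qE bC bD (rp _ sp') add0r bC.
(* A null residual imposes no new condition, because [l] vanishes on it. *)
have [r0|r0] := eqVneq (b r r) 0.
  exists p; first exact: lspan_cons.
  move=> t; rewrite in_cons => /orP[/eqP ->|]; last exact: hp.
  rewrite bq'// (@lspan_eq0 _ _ b l bC bD bZ lD lZ s p q' hp sq).
  by have := l0 _ r0; rewrite lB => /eqP; rewrite subr_eq0 => /eqP.
(* The residual is orthogonal to the span of [s], so this multiple corrects the value at [r] and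
   leaves the earlier conditions intact. *)
exists (p + (l r / b r r) *: r).
  exists (l r / b r r), (p - (l r / b r r) *: q'); split.
    by apply: lspanD => //; rewrite -scaleNr; exact: lspanZ.
  by rewrite /r scalerBr; ring.
move=> t; rewrite in_cons => /orP[/eqP ->|ts]; last by rewrite bD bZ (rs _ ts) mulr0 addr0 hp.
rewrite bD bZ bq'// (@lspan_eq0 _ _ b l bC bD bZ lD lZ s p q' hp sq).
have -> : b r q = b r r by rewrite bC qE bD (bC q') (rp _ sq) addr0.
by rewrite divfK// lB; ring.
Qed.

(** In this form no proof is required that a polynomial of norm 0 is the polynomial 0. *)
Lemma projection_exists (n : nat) (l : poly -> R) :
  (forall p q, l (p + q) = l p + l q) -> (forall c p, l (c *: p) = c * l p) ->
  (forall q, b q q = 0 -> l q = 0) ->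
  exists2 p, degle n p & forall q, degle n q -> b p q = l q.
Proof.
move=> lD lZ l0.
(* The bound in [bmultinom] is strict, hence [n.+1]. *)
pose s := [seq mpolyX R (bmnm m) | m <- enum {: bmultinom d n.+1}].
have sX m : (mdeg m <= n)%N -> mpolyX R m \in s.
  by move=> mn; apply/mapP; exists (BMultinom (mn : (mdeg m < n.+1)%N)); rewrite ?mem_enum.
have [p sp hp] := projection_seq s lD lZ l0; exists p.
  have : forall t, t \in s -> degle n t.
    move=> _ /mapP[m _ ->]; apply: degleW (homog_degle (homog_mpolyX _)).
    by rewrite -ltnS; exact: bmdeg.
  elim: (s) p sp {hp} => [|t s' IH] p /=; first by move=> -> _; exact: degle0.
  move=> [c [p' [sp' ->]]] h; apply: degleD.
    by apply: degleZ; apply: h; rewrite mem_head.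
  by apply: IH => // u us; apply: h; rewrite in_cons us orbT.
apply: degle_ind.
- by rewrite bC -(scale0r (0 : poly)) bZ lZ !mul0r.
- by move=> q r hq hr; rewrite bC bD lD !(bC _ p) hq hr.
- by move=> c q hq; rewrite bC bZ lZ bC hq.
- by move=> m mn; apply: hp; exact: sX.
Qed.

End projection_exists.

(** * The spectral inequality *)

Section spectral_inequality.
Context {R : realType} {d : nat} (alpha : R).
Hypotheses (d_gt0 : (0 < d)%N) (alpha_gtN1 : -1 < alpha).
Local Notation V := 'rV[R]_d.
Local Notation poly := (mpoly d R).
Local Notation "'X_ i" := (@mpolyX d R (mnm1 i)) (at level 8, i at level 2).
Local Notation mu := (@lebesgue_rV R d).
Local Notation B := (@unit_ball R d).
Local Notation W := (@weight R d alpha).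
Local Notation L2a := (L2w mu B W).
Local Notation dota := (dot mu B W).
Let mB := @measurable_unit_ball R d.
Let mW := @measurable_weight_ball R d alpha.
Let W0 := @weight_ge0 R d alpha.
Let iW := @integrable_weight R d alpha alpha_gtN1.
Let Lp (p : poly) : L2a (peval p) := L2w_peval mW W0 iW p.

(** The weak gradient is part of the data, so that no representative has to be chosen. *)
Definition sobolev (f : V -> R) (g : 'I_d -> V -> R) : Prop :=
  [/\ locally_integrable f, forall j, locally_integrable (g j),
      L2a f, forall j, L2a (g j) & forall j, weak_derivative j f (g j)].

Definition pgrad (p : poly) (j : 'I_d) : V -> R := peval (mderiv j p).

Lemma sobolev_peval p : sobolev (peval p) (pgrad p).
Proof.
split=> [|j||j|j]; [exact: locally_integrable_peval|exact: locally_integrable_peval|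
  exact: Lp|exact: Lp|exact: weak_derivative_peval].
Qed.

Lemma dota_pevalD f p q : L2a f ->
  dota f (peval (p + q)) = dota f (peval p) + dota f (peval q).
Proof.
move=> Lf; rewrite -dotDr//; congr (dot _ _ _ f _).
by apply/funext => x; rewrite pevalD.
Qed.

Lemma dota_pevalZ f c p : L2a f -> dota f (peval (c *: p)) = c * dota f (peval p).
Proof.
move=> Lf; rewrite -dotZr//; congr (dot _ _ _ f _).
by apply/funext => x; rewrite pevalZ.
Qed.

Lemma dota_pevalB f p q : L2a f ->
  dota f (peval (p - q)) = dota f (peval p) - dota f (peval q).
Proof. by move=> Lf; rewrite -scaleN1r dota_pevalD// dota_pevalZ// mulN1r. Qed.

(** [degle_neumann] is applied to the polynomials orthogonal to [f]. Constants need the separate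
    hypothesis on [peval 1], as [neumann] sends them to 0. *)
Lemma sobolev_orthogonal_low f g N : sobolev f g -> (2 <= N)%N ->
  dota f (peval 1) = 0 ->
  (forall q, degle N q -> \sum_j dota (g j) (pgrad q j) = 0) ->
  forall p, degle (N - 2) p -> dota f (peval p) = 0.
Proof.
move=> [lf lg Lf Lg wfg] N2 f1 gq; apply: (@degle_neumann R d alpha d_gt0 alpha_gtN1) => //.
- by move=> p q fp fq; rewrite dota_pevalD// fp fq addr0.
- by move=> c p fp; rewrite dota_pevalZ// fp mulr0.
move=> n w nN hw.
pose c : R := n%:R / 2; have nE : n%:R = 2 * c by rewrite /c; field.
(* This is [w + c s w], expanded. Its Euler derivative has coefficients [(1 + c) n] on [w] and
   [- c (n + 2)] on [psq * w], opposite because [n = 2 c]; their common size is the factor in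
   [r]. *)
pose q := (1 + c) *: w - c *: (psq * w).
pose r := (n%:R + n%:R * c) *: w.
(* The correction has degree [n + 2], which is why [n] stops at [N - 2]. *)
have dq : degle N q.
  apply: degleB; apply: degleZ.
    by apply: degleW (homog_degle hw); lia.
  have := homog_psqM hw; rewrite -natrD => /homog_degle; apply: degleW; lia.
have Eq : \sum_j 'X_j * mderiv j q = (1 - psq) * r.
  rewrite -/(euler q) /q -scaleNr eulerD !eulerZ hw (homog_psqM hw) /r.
  move: (c) nE => k ->.
  by rewrite -!mul_mpolyC !(rmorphD, rmorphN, rmorphM, rmorph1, rmorph_nat)/=; ring.
rewrite -(gq q dq) (weighted_ibp alpha_gtN1 lf lg Lf Lg wfg Eq).
congr (dota f (peval _)).
rewrite -/(laplace q) /q -scaleNr laplaceD !laplaceZ laplace_psqM hw /neumann /r -/c.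
move: (c) nE => k ->.
by rewrite -!mul_mpolyC !(rmorphD, rmorphN, rmorphM, rmorph1, rmorph_nat)/=; ring.
Qed.

(* [- s^-alpha div (s^alpha (grad q - x (x . grad q)))] with [s = 1 - |x|^2]. *)
Definition elliptic (q : poly) : poly :=
  euler (euler q) + (d%:R + 2 * alpha) *: euler q - laplace q.

Definition radial (g : 'I_d -> V -> R) (x : V) : R := \sum_j x ord0 j * g j x.

(** The form [a], taken on gradient fields, so that it applies to any representative of a weak
    gradient. *)
Definition energy (g k : 'I_d -> V -> R) : R :=
  \sum_j dota (g j) (k j) - dota (radial g) (radial k).

Lemma L2a_radial g : (forall j, L2a (g j)) -> L2a (radial g).
Proof.
move=> Lg; apply: L2w_sum => //; first exact: L2w0.
move=> j; apply: (L2w_le mB mW W0 _ (Lg j)).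
  apply: measurable_funM; last by case: (Lg j).
  exact/measurable_funTS/measurable_coord.
move=> x Bx; rewrite normrM ler_piMl//; exact/ltW/unit_ball_coord.
Qed.

Lemma L2a_pgrad q j : L2a (pgrad q j). Proof. exact: Lp. Qed.

Lemma energyC g k : energy g k = energy k g.
Proof. by rewrite /energy dotC; congr (_ - _); apply: eq_bigr => j _; rewrite dotC. Qed.

Lemma radial_pgrad q : radial (pgrad q) = peval (euler q).
Proof.
apply/funext => x; rewrite /radial /euler peval_sum; apply: eq_bigr => j _.
by rewrite pevalM pevalX.
Qed.

Lemma dota_radial g q : (forall j, L2a (g j)) ->
  dota (radial g) (peval q) = \sum_j dota (g j) (peval ('X_j * q)).
Proof.
move=> Lg; rewrite /dot -Rintegral_sum//; last by move=> j; exact: integrable_dot.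
apply: eq_Rintegral => x _; rewrite /radial !mulr_suml; apply: eq_bigr => j _.
by rewrite pevalM pevalX; ring.
Qed.

(** The field [grad q - x (x . grad q)] has radial component [(1 - psq) * euler q], so
    [weighted_ibp] applies to every [q] with [r = euler q]. *)
Lemma energy_elliptic f g q : sobolev f g ->
  energy g (pgrad q) = dota f (peval (elliptic q)).
Proof.
move=> [lf lg Lf Lg wfg].
rewrite /energy radial_pgrad dota_radial// -sumrB.
transitivity (\sum_j dota (g j) (peval (mderiv j q - 'X_j * euler q))).
  by apply: eq_bigr => j _; rewrite -dota_pevalB.
rewrite (weighted_ibp alpha_gtN1 lf lg Lf Lg wfg (r := euler q)).
  congr (dota f (peval _)).
  rewrite /elliptic; under eq_bigr do rewrite mderivB mderivM mderivXU eqxx.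
  rewrite sumrB big_split /= -/(laplace q) -/(euler (euler q)).
  rewrite sumr_const card_ord [true%:R]mulr1n mul1r -[_ *+ d]scaler_nat scalerDl -!mul_mpolyC.
  by ring.
under eq_bigr do rewrite mulrBr mulrA.
by rewrite sumrB -mulr_suml mulrBl mul1r.
Qed.

(** Cauchy-Schwarz: with [b] the radial component, the square of [g - b x] is nonnegative, so the
    right-hand side is at least [b ^+ 2 * (2 - sqnorm x)]. *)
Lemma radial_sqr_le g x : B x -> radial g x ^+ 2 <= \sum_j g j x ^+ 2.
Proof.
have E (b : R) : \sum_j (g j x - b * x ord0 j) ^+ 2 =
    \sum_j g j x ^+ 2 - 2 * b * radial g x + b ^+ 2 * sqnorm x.
  rewrite /radial /sqnorm !mulr_sumr -sumrB -big_split.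
  by apply: eq_bigr => j _ /=; ring.
rewrite /unit_ball /= => x1; have := E (radial g x); set b := radial g x.
have : 0 <= \sum_j (g j x - b * x ord0 j) ^+ 2 by apply: sumr_ge0 => j _; exact: sqr_ge0.
move=> /[swap] -> {E}; have := sqnorm_ge0 x; have := sqr_ge0 b; nra.
Qed.

Lemma energy_le g : (forall j, L2a (g j)) -> energy g g <= \sum_j dota (g j) (g j).
Proof. by move=> Lg; rewrite /energy gerBl dot_ge0. Qed.

Lemma energy_ge0 g : (forall j, L2a (g j)) -> 0 <= energy g g.
Proof.
move=> Lg; rewrite /energy subr_ge0 /dot -Rintegral_sum//; last first.
  by move=> j; exact: integrable_dot.
apply: le_Rintegral => //.
- exact: integrable_dot (L2a_radial Lg) (L2a_radial Lg).
- by apply: integrable_sum_EFin => // j; exact: integrable_dot.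
move=> x Bx; rewrite -mulr_suml ler_wpM2r ?W0// -expr2.
under [leRHS]eq_bigr do rewrite -expr2.
exact: radial_sqr_le.
Qed.

Lemma energyBB g q : (forall j, L2a (g j)) ->
  energy (fun j x => g j x - pgrad q j x) (fun j x => g j x - pgrad q j x) =
  energy g g - 2 * energy g (pgrad q) + energy (pgrad q) (pgrad q).
Proof.
move=> Lg; have Lq := L2a_pgrad q.
have rE : radial (fun j x => g j x - pgrad q j x) = fun x => radial g x - radial (pgrad q) x.
  by apply/funext => x; rewrite /radial -sumrB; apply: eq_bigr => j _; ring.
have sq f k : L2a f -> L2a k ->
    dota (fun x => f x - k x) (fun x => f x - k x) = dota f f - 2 * dota f k + dota k k.
  move=> Lf Lk; rewrite dotBl//; last exact: L2wB.
  by rewrite !dotBr// (dotC _ _ _ k f); ring.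
rewrite /energy rE sq; [|exact: L2a_radial..].
under eq_bigr do rewrite sq//.
rewrite big_split sumrB /= -mulr_sumr; ring.
Qed.

(** The Laplacian lowers the degree by two, so it does not reach the coefficients of degree [n - 1]
    and above; on these only the Euler part acts, diagonally. *)
Lemma elliptic_mcoeff q m n : degle n q -> (n.-1 <= mdeg m)%N ->
  mcoeff m (elliptic q) = (mdeg m)%:R * ((mdeg m)%:R + d%:R + 2 * alpha) * mcoeff m q.
Proof.
move=> dq nm; rewrite /elliptic mcoeffB mcoeffD mcoeffZ !mcoeff_euler.
have -> : mcoeff m (laplace q) = 0.
  rewrite /laplace raddf_sum big1// => j _ /=; rewrite !mcoeff_deriv dq ?mul0rn//.
  by rewrite !mdegD !mdeg1; lia.
by ring.
Qed.

Lemma degle_elliptic n q : degle n q -> degle n (elliptic q).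
Proof.
move=> dq m nm; rewrite (elliptic_mcoeff dq); last by lia.
by rewrite dq// mulr0.
Qed.

Lemma elliptic_lambda n q : degle n.+1 q ->
  degle n (elliptic q - lambda d alpha n.+1 *: q).
Proof.
move=> dq m nm; rewrite mcoeffB mcoeffZ (elliptic_mcoeff dq); last by lia.
have [nm'|nm'] := ltnP n.+1 (mdeg m); first by rewrite dq// !mulr0 subrr.
by rewrite (_ : mdeg m = n.+1); [rewrite /lambda; ring|lia].
Qed.

(** Consecutive values differ by [2 n + 1 + d + 2 alpha], positive since [d >= 1] and
    [alpha > -1]. *)
Lemma lambda_le m n : (m <= n)%N -> lambda d alpha m <= lambda d alpha n.
Proof.
have a1 : 0 < alpha + 1 by rewrite -ltrBlDr sub0r.
have d1 : 1 <= d%:R :> R by rewrite ler1n.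
elim: n => [|n IH]; first by rewrite leqn0 => /eqP ->.
rewrite leq_eqVlt => /orP[/eqP -> //|]; rewrite ltnS => /IH /le_trans; apply.
rewrite /lambda -[n.+1%:R]natr1; have : 0 <= n%:R :> R by []; nra.
Qed.

Lemma poly_projection f n : L2a f -> exists2 p, degle n p &
  forall q, degle n q -> dota (peval p) (peval q) = dota f (peval q).
Proof.
move=> Lf; have := @projection_exists R d (fun p q => dota (peval p) (peval q)) _ _ _ _ n
  (fun q => dota f (peval q)).
apply.
- by move=> p q; rewrite dotC.
- by move=> p q r; rewrite !(dotC _ _ _ _ (peval r)) dota_pevalD.
- by move=> c p r; rewrite !(dotC _ _ _ _ (peval r)) dota_pevalZ.
- by move=> p; exact: dot_ge0.
- by move=> p q; exact: dota_pevalD.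
- by move=> c p; exact: dota_pevalZ.
by move=> q; exact: dot_null.
Qed.

(** Induction on the excess of the degree over [K]: splitting off the part [h] orthogonal to lower
    degrees is orthogonal for the inner product and for the elliptic form alike, and on [h] the form
    is an exact multiple of the squared norm. *)
Lemma elliptic_ge K i p : degle (K + i) p ->
  (forall q, degle K q -> dota (peval p) (peval q) = 0) ->
  lambda d alpha K.+1 * dota (peval p) (peval p) <= dota (peval p) (peval (elliptic p)).
Proof.
elim: i p => [|i IH] p dp pK.
  rewrite addn0 in dp; rewrite (pK p dp) (pK (elliptic p)) ?mulr0//.
  exact: degle_elliptic.
rewrite addnS in dp.
have [p' dp' hp'] := poly_projection (K + i) (Lp p).
pose h := p - p'.
have hE q : degle (K + i) q -> dota (peval h) (peval q) = 0.
  by move=> dq; rewrite dotC dota_pevalB// !(dotC _ _ _ (peval q)) hp'// subrr.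
have dh : degle (K + i).+1 h by apply: degleB => //; apply: degleW dp'.
have pE : p = p' + h by rewrite /h addrC subrK.
clearbody h.
have ellD q r : elliptic (q + r) = elliptic q + elliptic r.
  by rewrite /elliptic !eulerD laplaceD scalerDr; ring.
(* Symmetry of the operator is inherited from that of [energy]. *)
have sym q r : dota (peval q) (peval (elliptic r)) = dota (peval r) (peval (elliptic q)).
  by rewrite -!(energy_elliptic _ (sobolev_peval _)) energyC.
have dDl q r s : dota (peval (q + r)) (peval s) = dota (peval q) (peval s) + dota (peval r) (peval s).
  by rewrite !(dotC _ _ _ _ (peval s)) dota_pevalD.
have hell : dota (peval h) (peval (elliptic h)) = lambda d alpha (K + i).+1 * dota (peval h) (peval h).
  have := hE _ (elliptic_lambda dh); rewrite dota_pevalB// dota_pevalZ//.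
  by move=> /eqP; rewrite subr_eq0 => /eqP.
have e1 : dota (peval h) (peval (elliptic p')) = 0 by apply: hE; exact: degle_elliptic.
have e2 : dota (peval p') (peval (elliptic h)) = 0 by rewrite sym.
have e3 : dota (peval h) (peval p') = 0 by exact: hE.
have -> : dota (peval p) (peval (elliptic p)) =
    dota (peval p') (peval (elliptic p')) + lambda d alpha (K + i).+1 * dota (peval h) (peval h).
  by rewrite pE ellD dDl !(dota_pevalD (elliptic p') (elliptic h))// e1 e2 hell; ring.
have -> : dota (peval p) (peval p) = dota (peval p') (peval p') + dota (peval h) (peval h).
  by rewrite pE dDl !dota_pevalD// (dotC _ _ _ (peval p') (peval h)) e3; ring.
rewrite mulrDr lerD//.
  apply: IH => // q dq; rewrite hp' ?pK//; apply: degleW dq; lia.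
by apply: ler_wpM2r; [exact: dot_ge0|apply: lambda_le; lia].
Qed.

(** The inequality passes from the projections [p] of [f] by Bessel's inequality for [energy], so
    only the norms of the [p] have to converge, not their gradients. *)
Theorem spectral_inequality f g K : sobolev f g ->
  (forall q, degle K q -> dota f (peval q) = 0) ->
  lambda d alpha K.+1 * dota f f <= \sum_j dota (g j) (g j).
Proof.
move=> sfg fK; have [lf lg Lf Lg wfg] := sfg.
have l0 : 0 <= lambda d alpha K.+1.
  by apply: le_trans (lambda_le (leq0n _)); rewrite /lambda mul0r.
apply/ler_addgt0Pr => e e0; pose e' := e / (lambda d alpha K.+1 + 1).
have l1 : 0 < lambda d alpha K.+1 + 1 by rewrite ltr_wpDl.
have e'0 : 0 < e' by rewrite divr_gt0.
have [_ /(_ _ e'0)[p0 hp0]] := polynomials_dense mW W0 iW Lf.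
(* Degree at least that of [p0], so that [p] approximates as well, and at least [K], so that [p]
   inherits the orthogonality of [f]. *)
pose M := (K + msize p0)%N.
have [p dp hp] := poly_projection M Lf.
have dp0 : degle M p0 by apply/degleP; rewrite /M; lia.
(* Pythagoras: the left-hand side is the squared distance from [f] to [p0] minus that from [p] to
   [p0]. *)
have fp : dota f f - dota (peval p) (peval p) < e'.
  apply: le_lt_trans hp0; have Lfp0 := L2wB mB mW W0 Lf (Lp p0).
  rewrite dotBl// !dotBr// (dotC _ _ _ (peval p0) f) -!hp//.
  have := dot_ge0 mu W0 (fun x => peval p x - peval p0 x).
  rewrite dotBl//; last exact: L2wB.
  rewrite !dotBr// (dotC _ _ _ (peval p0) (peval p)).
  move: (dota _ _) (dota _ _) (dota _ _) (dota _ _) => a1 a2 a3 a4; lra.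
(* [elliptic p] still has degree at most [M], so [f] may be replaced by its projection [p] in the
   pairing. *)
have ep : energy g (pgrad p) = energy (pgrad p) (pgrad p).
  rewrite (energy_elliptic _ sfg) (energy_elliptic _ (sobolev_peval p)) hp//.
  exact: degle_elliptic.
have eg : energy (pgrad p) (pgrad p) <= energy g g.
  have := energy_ge0 (fun j => L2wB mB mW W0 (Lg j) (L2a_pgrad p j)).
  by rewrite energyBB// ep; lra.
have h : lambda d alpha K.+1 * dota (peval p) (peval p) <= dota (peval p) (peval (elliptic p)).
  apply: elliptic_ge dp _ => q dq; rewrite hp; first exact: fK.
  by apply: degleW dq; rewrite /M; lia.
rewrite -(energy_elliptic _ (sobolev_peval p)) in h.
have el := energy_le Lg.
have le' : lambda d alpha K.+1 * e' <= e.
  by rewrite /e' mulrCA ger_pMr// ler_pdivrMr// mul1r lerDl.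
have := ler_wpM2l l0 (ltW fp); rewrite mulrBr.
move: h eg el le'; move: (lambda _ _ _ * dota f f) (lambda _ _ _ * dota _ _).
by move: (lambda _ _ _ * e') (energy g g) (energy _ _) => *; lra.
Qed.

End spectral_inequality.

(** * Real and imaginary parts *)

Section complex_parts.
Context {R : realType} {d : nat}.
Local Notation V := 'rV[R]_d.
Local Notation mu := (@lebesgue_rV R d).
Local Notation B := (@unit_ball R d).
Implicit Types u v g : V -> R[i].
Local Notation re u := (fun x => complex.Re (u x)).
Local Notation im u := (fun x => complex.Im (u x)).
Let mB := @measurable_unit_ball R d.

Lemma conjE (z : R[i]) : z^* = Complex (complex.Re z) (- complex.Im z).
Proof. by case: z. Qed.

Lemma complexE (z : R[i]) : z = Complex (complex.Re z) (complex.Im z).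
Proof. by case: z. Qed.

Lemma ReM (z t : R[i]) : complex.Re (z * t) =
  complex.Re z * complex.Re t - complex.Im z * complex.Im t.
Proof. by case: z t => [a b] [c e]. Qed.

Lemma ImM (z t : R[i]) : complex.Im (z * t) =
  complex.Re z * complex.Im t + complex.Im z * complex.Re t.
Proof. by case: z t => [a b] [c e]. Qed.

Lemma ReD (z t : R[i]) : complex.Re (z + t) = complex.Re z + complex.Re t.
Proof. by case: z t => [a b] [c e]. Qed.

Lemma ImD (z t : R[i]) : complex.Im (z + t) = complex.Im z + complex.Im t.
Proof. by case: z t => [a b] [c e]. Qed.

Lemma ReN (z : R[i]) : complex.Re (- z) = - complex.Re z. Proof. by case: z. Qed.
Lemma ImN (z : R[i]) : complex.Im (- z) = - complex.Im z. Proof. by case: z. Qed.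

Lemma Re_sum (I : Type) (s : seq I) (F : I -> R[i]) :
  complex.Re (\sum_(i <- s) F i) = \sum_(i <- s) complex.Re (F i).
Proof. exact: (big_morph _ ReD). Qed.

Lemma Im_sum (I : Type) (s : seq I) (F : I -> R[i]) :
  complex.Im (\sum_(i <- s) F i) = \sum_(i <- s) complex.Im (F i).
Proof. exact: (big_morph _ ImD). Qed.

Lemma normc_sqr (z : R[i]) : Normc.normc z ^+ 2 = complex.Re z ^+ 2 + complex.Im z ^+ 2.
Proof. by case: z => a b /=; rewrite sqr_sqrtr// addr_ge0 ?sqr_ge0. Qed.

Lemma normc_ge0 (z : R[i]) : 0 <= Normc.normc z.
Proof. by case: z => a b; exact: sqrtr_ge0. Qed.

Lemma Re_le_normc (z : R[i]) : `|complex.Re z| <= Normc.normc z.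
Proof.
rewrite -(@ler_pXn2r _ 2) ?nnegrE ?normc_ge0// normc_sqr real_normK ?num_real//.
by rewrite lerDl sqr_ge0.
Qed.

Lemma Im_le_normc (z : R[i]) : `|complex.Im z| <= Normc.normc z.
Proof.
rewrite -(@ler_pXn2r _ 2) ?nnegrE ?normc_ge0// normc_sqr real_normK ?num_real//.
by rewrite lerDr sqr_ge0.
Qed.

Lemma normc_le (z : R[i]) : Normc.normc z <= `|complex.Re z| + `|complex.Im z|.
Proof.
rewrite -(@ler_pXn2r _ 2) ?nnegrE ?normc_ge0 ?addr_ge0// normc_sqr sqrrD !real_normK ?num_real//.
by rewrite addrAC lerDl mulrn_wge0// mulr_ge0.
Qed.

Lemma measurable_normc u : cmeasurable u -> measurable_fun B (fun x => Normc.normc (u x)).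
Proof.
move=> [mr mi]; have m2 : measurable_fun B (fun x => complex.Re (u x) ^+ 2 + complex.Im (u x) ^+ 2).
  by apply: measurable_funD; exact: measurable_funX.
have := measurableT_comp (@measurable_powR R 2^-1) m2; congr (measurable_fun B _).
apply/funext => x /=; rewrite -normc_sqr powR12_sqrt ?sqr_ge0// sqrtr_sqr ger0_norm//.
exact: normc_ge0.
Qed.

Lemma L1locP u : L1loc u <-> locally_integrable (re u) /\ locally_integrable (im u).
Proof.
split=> [[mu' ui]|[[mr ri] [mi ii]]].
  have [mr mi] := mu'.
  have key (f : V -> R) : measurable_fun B f -> (forall x, `|f x| <= Normc.normc (u x)) ->
      locally_integrable f.
    move=> mf fu; split=> // dl dl0; have mI := @measurable_inner_ball R d dl.
    have IB := @inner_ball_unit_ball R d _ dl0.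
    have mfI := measurable_funS mB IB mf.
    apply/integrableP; split; first exact/measurable_EFinP.
    apply: le_lt_trans (ui _ (compact_inner_ball dl0) IB).
    apply: ge0_le_integral => //.
    - by apply: measurableT_comp => //; exact/measurable_EFinP.
    - by apply/measurable_EFinP; apply: (measurable_funS mB IB); exact: measurable_normc.
    - by move=> x _; rewrite /= lee_fin.
  by split; apply: key => // x; [exact: Re_le_normc|exact: Im_le_normc].
split=> // K cK KB; have [dl dl0 Kdl] := compact_sub_inner_ball cK KB.
have IB := @inner_ball_unit_ball R d _ dl0.
have mI := @measurable_inner_ball R d dl.
have mn : measurable_fun (inner_ball dl) (fun x => (Normc.normc (u x))%:E).
  by apply/measurable_EFinP; apply: (measurable_funS mB IB); exact: measurable_normc.
have mK : measurable K.
  rewrite -[K]setCK; apply: measurableC; apply: open_measurable_rV; apply: closed_openC.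
  by apply: compact_closed => //; exact: norm_hausdorff.
apply: le_lt_trans (_ : \int[mu]_(x in inner_ball dl) (Normc.normc (u x))%:E < +oo)%E.
  by apply: ge0_subset_integral => // x _; rewrite lee_fin normc_ge0.
have := integrable_EFinD mI (integrable_norm (ri _ dl0)) (integrable_norm (ii _ dl0)).
move=> /integrableP[ms]; apply: le_lt_trans; apply: ge0_le_integral => //.
- by move=> x _; rewrite lee_fin normc_ge0.
- by apply: measurableT_comp.
- by move=> x _; rewrite /= lee_fin (le_trans (normc_le _))// ler_norm.
Qed.

Lemma L2P alpha u : L2 alpha u <->
  L2w mu B (weight alpha) (re u) /\ L2w mu B (weight alpha) (im u).
Proof.
have mW := @measurable_weight_ball R d alpha.
have W0 := @weight_ge0 R d alpha.
split=> [[[mr mi] ui]|[[mr ri] [mi ii]]].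
  have mn : measurable_fun B (fun x => (Normc.normc (u x) ^+ 2 * weight alpha x)%:E).
    apply/measurable_EFinP; apply: measurable_funM => //; apply: measurable_funX.
    exact: measurable_normc.
  have key (f : V -> R) : measurable_fun B f -> (forall x, `|f x| <= Normc.normc (u x)) ->
      L2w mu B (weight alpha) f.
    move=> mf fu; split=> //.
    have mfw : measurable_fun B (EFin \o (fun x => f x ^+ 2 * weight alpha x)).
      by apply/measurable_EFinP; apply: measurable_funM => //; exact: measurable_funX.
    apply/integrableP; split => //; apply: le_lt_trans ui.
    apply: ge0_le_integral => //.
    - exact: measurableT_comp.
    - move=> x Bx; rewrite /= lee_fin normrM (ger0_norm (W0 x Bx)) ler_wpM2r ?W0//.
      by rewrite normrX lerXn2r ?nnegrE ?normc_ge0.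
  by split; apply: key => // x; [exact: Re_le_normc|exact: Im_le_normc].
split=> //; have /integrableP[_] := integrable_EFinD mB ri ii.
apply: le_lt_trans; apply: ge0_le_integral => //.
- by move=> x Bx; rewrite lee_fin mulr_ge0 ?sqr_ge0 ?W0.
- apply/measurable_EFinP; apply: measurable_funM => //; apply: measurable_funX.
  exact: measurable_normc.
- apply: measurableT_comp => //; apply/measurable_EFinP.
  by apply: measurable_funD; apply: measurable_funM => //; exact: measurable_funX.
- by move=> x Bx; rewrite /= lee_fin normc_sqr mulrDl ler_norm.
Qed.

(** Test functions are real, so the defining identity separates into its real and imaginary
    parts. *)
Lemma weak_derivP j u g : is_weak_deriv j u g <->
  [/\ L1loc u, L1loc g, weak_derivative j (re u) (re g) & weak_derivative j (im u) (im g)].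
Proof.
have E v (phi : V -> R) : cintegral (fun x => v x * (phi x)%:C%C) =
    Complex (\int[mu]_(x in B) (complex.Re (v x) * phi x)) (\int[mu]_(x in B) (complex.Im (v x) * phi x)).
  rewrite /cintegral; congr Complex; apply: eq_Rintegral => x _.
    by rewrite ReM /= mulr0 subr0.
  by rewrite ImM /= mulr0 add0r.
split=> [[lu lg h]|[lu lg h1 h2]]; split=> //.
- by move=> phi /h; rewrite !E => -[].
- by move=> phi /h; rewrite !E => -[].
- by move=> phi t; rewrite !E h1// h2.
Qed.

End complex_parts.

(** * The Sobolev projection for real functions *)

Section sobolev_projection.
Context {R : realType} {d : nat} (alpha : R).
Hypotheses (d_gt0 : (0 < d)%N) (alpha_gtN1 : -1 < alpha).
Local Notation V := 'rV[R]_d.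
Local Notation poly := (mpoly d R).
Local Notation mu := (@lebesgue_rV R d).
Local Notation B := (@unit_ball R d).
Local Notation W := (@weight R d alpha).
Local Notation L2a := (L2w mu B W).
Local Notation dota := (dot mu B W).
Local Notation re u := (fun x => complex.Re (u x)).
Local Notation im u := (fun x => complex.Im (u x)).
Let mB := @measurable_unit_ball R d.
Let mW := @measurable_weight_ball R d alpha.
Let W0 := @weight_ge0 R d alpha.
Let iW := @integrable_weight R d alpha alpha_gtN1.
Let Lp (p : poly) : L2a (peval p) := L2w_peval mW W0 iW p.
Let c : R := dota (peval 1) (peval 1).

(** The real counterpart of [ip1], with the gradients as arguments. *)
Definition h1dot (f : V -> R) (g : 'I_d -> V -> R) (h : V -> R) (k : 'I_d -> V -> R) : R :=
  \sum_j dota (g j) (k j) + c^-1 * dota f (peval 1) * dota h (peval 1).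

Definition sform f g (q : poly) : R := h1dot f g (peval q) (pgrad q).

Let c_ge0 : 0 <= c. Proof. exact: dot_ge0. Qed.

Lemma sformB f g f' g' q : L2a f -> L2a f' -> (forall j, L2a (g j)) -> (forall j, L2a (g' j)) ->
  sform (fun x => f x - f' x) (fun j x => g j x - g' j x) q = sform f g q - sform f' g' q.
Proof.
move=> Lf Lf' Lg Lg'; rewrite /sform /h1dot dotBl//.
rewrite (eq_bigr _ (fun j _ => dotBl mB mW W0 (Lg j) (Lg' j) (Lp (mderiv j q)))).
by rewrite sumrB; ring.
Qed.

Lemma pgradD (p q : poly) j : pgrad (p + q) j = fun x => pgrad p j x + pgrad q j x.
Proof. by apply/funext => x; rewrite /pgrad mderivD pevalD. Qed.

Lemma pgradZ a (p : poly) j : pgrad (a *: p) j = fun x => a * pgrad p j x.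
Proof. by apply/funext => x; rewrite /pgrad mderivZ pevalZ. Qed.

Lemma sformD f g p q : L2a f -> (forall j, L2a (g j)) ->
  sform f g (p + q) = sform f g p + sform f g q.
Proof.
move=> Lf Lg; rewrite /sform /h1dot !(dotC _ _ _ _ (peval 1)) dota_pevalD//.
under eq_bigr => j _ do rewrite pgradD (dotDr mB mW W0 (Lp (mderiv j p)) (Lp (mderiv j q)) (Lg j)).
by rewrite big_split /=; ring.
Qed.

Lemma sformZ f g a p : L2a f -> (forall j, L2a (g j)) -> sform f g (a *: p) = a * sform f g p.
Proof.
move=> Lf Lg; rewrite /sform /h1dot !(dotC _ _ _ _ (peval 1)) dota_pevalZ//.
under eq_bigr => j _ do rewrite pgradZ (dotZr mB mW W0 a (Lp (mderiv j p)) (Lg j)).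
by rewrite -mulr_sumr; ring.
Qed.

Lemma sformC (p q : poly) : sform (peval p) (pgrad p) q = sform (peval q) (pgrad q) p.
Proof.
rewrite /sform /h1dot; congr (_ + _); last by ring.
by apply: eq_bigr => j _; rewrite dotC.
Qed.

(** An instance of [projection_exists]; the substance is that the functional given by [f] vanishes
    on null polynomials, which again comes from nonnegativity of the form along a line. *)
Lemma sobolev_projection N f g : sobolev alpha f g -> exists2 p, degle N p &
  forall q, degle N q -> sform (peval p) (pgrad p) q = sform f g q.
Proof.
move=> [_ _ Lf Lg _].
apply: (@projection_exists R d (fun p q => sform (peval p) (pgrad p) q)).
- exact: sformC.
- by move=> p q r; rewrite !(sformC _ r); apply: sformD => // j; exact: Lp.
- by move=> a p r; rewrite !(sformC _ r); apply: sformZ => // j; exact: Lp.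
- move=> p; rewrite /sform /h1dot addr_ge0//; first by apply: sumr_ge0 => j _; exact: dot_ge0.
  by rewrite -mulrA -expr2 mulr_ge0 ?invr_ge0 ?sqr_ge0.
- by move=> p q; exact: sformD.
- by move=> a p; exact: sformZ.
move=> q q0; apply: (@affine_ge0_eq0 _
  (\sum_j dota (g j) (g j) + c^-1 * dota f (peval 1) ^+ 2)) => t.
have Lt (h : V -> R) : L2a h -> L2a (fun x => (t / 2) * h x) by move=> Lh; exact: L2wZ.
pose k j x := g j x - (t / 2) * pgrad q j x.
have Lk j : L2a (k j) by apply: L2wB => //; apply: Lt; exact: Lp.
have : 0 <= \sum_j dota (k j) (k j) + c^-1 * dota (fun x => f x - (t / 2) * peval q x) (peval 1) ^+ 2.
  rewrite addr_ge0//; first by apply: sumr_ge0 => j _; exact: dot_ge0.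
  by rewrite mulr_ge0 ?invr_ge0 ?sqr_ge0.
have E j : dota (k j) (k j) = dota (g j) (g j) - t * dota (g j) (pgrad q j)
    + (t / 2) ^+ 2 * dota (pgrad q j) (pgrad q j).
  have Lq : L2a (pgrad q j) by exact: Lp.
  have Ltq := Lt _ Lq.
  rewrite {1}/k dotBl//.
  by rewrite /k !dotBr// !dotZl// !dotZr// (dotC _ _ _ (pgrad q j) (g j)); field.
under eq_bigr do rewrite E.
rewrite big_split sumrB -!mulr_sumr /= dotBl//; last exact: Lt.
rewrite dotZl//; move: q0; rewrite /sform /h1dot => q0 h.
rewrite (_ : _ - _ = \sum_j dota (g j) (g j) - t * (\sum_j dota (g j) (pgrad q j)) +
   (t / 2) ^+ 2 * \sum_j dota (pgrad q j) (pgrad q j) +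
   c^-1 * (dota f (peval 1) - t / 2 * dota (peval q) (peval 1)) ^+ 2) //.
(* For a null [q] the gradient term is the negative of the mean term, so the quadratic part in [t]
   cancels. *)
rewrite (_ : \sum_j dota (pgrad q j) (pgrad q j) = - (c^-1 * dota (peval q) (peval 1) * dota (peval q) (peval 1))).
  by move: (c^-1) => c'; field.
by apply/eqP; rewrite -addr_eq0 q0.
Qed.

Theorem sobolev_orthogonal_le f g N : sobolev alpha f g -> (2 <= N)%N ->
  (forall q, degle N q -> sform f g q = 0) ->
  dota f (peval 1) = 0 /\ lambda d alpha N.-1 * dota f f <= \sum_j dota (g j) (g j).
Proof.
move=> sfg N2 S0; have [_ _ Lf Lg _] := sfg.
have f1 : dota f (peval 1) = 0.
  (* If [c] is 0, the constant 1 is a null vector and its pairing with [f] vanishes anyway;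
     otherwise the mean is read off by testing with 1, whose gradient is 0. *)
  have [c0|c0] := eqVneq c 0; first exact: dot_null.
  have d1 : degle N (1 : poly) by rewrite -mpolyC1; exact: degleC.
  have := S0 1 d1; rewrite /sform /h1dot big1 ?add0r.
    by rewrite -/c mulrAC mulVf// mul1r.
  by move=> j _; rewrite /pgrad mderiv1 -(scale0r (0 : poly)) dota_pevalZ ?mul0r//; exact: Lp.
(* Orthogonality up to degree [N - 2] yields the eigenvalue of the next degree. *)
split=> //; have -> : N.-1 = (N - 2).+1 by lia.
apply: spectral_inequality => //.
apply: (sobolev_orthogonal_low d_gt0 alpha_gtN1 sfg N2 f1) => // q dq.
by have := S0 q dq; rewrite /sform /h1dot f1 mulr0 mul0r addr0.
Qed.

End sobolev_projection.

Local Open Scope complex_scope.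

(** * Complex polynomials as pairs of real ones *)

Section complex_polynomials.
Context {R : realType} {d : nat}.
Local Notation V := 'rV[R]_d.
Local Notation poly := (mpoly d R).

Definition cpeval (p q : poly) (x : V) : R[i] := Complex (peval p x) (peval q x).

Lemma peval_mpolyX m (x : V) : peval (mpolyX R m) x = \prod_i x ord0 i ^+ m i.
Proof. exact: mevalX. Qed.

Lemma prod_real_complex (x : V) (m : multinom d) :
  \prod_i (x ord0 i)%:C ^+ m i = (peval (mpolyX R m) x)%:C.
Proof.
rewrite peval_mpolyX (rmorph_prod (real_complex R)); apply: eq_bigr => i _.
by rewrite (rmorphXn (real_complex R)).
Qed.

Lemma complex_mpoly N (p : poly) : degle N p -> exists2 P : mpoly d R[i],
  (forall m, (N < mdeg m)%N -> mcoeff m P = 0) &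
  forall x : V, meval (fun i => (x ord0 i)%:C) P = (peval p x)%:C.
Proof.
move: p; apply: degle_ind => [|p q [P dP eP] [Q dQ eQ]|c p [P dP eP]|m mN].
- by exists 0 => [m _|x]; rewrite ?mcoeff0 ?meval0 ?peval0.
- exists (P + Q) => [m Nm|x]; first by rewrite mcoeffD dP// dQ// addr0.
  by rewrite mevalD eP eQ pevalD -(rmorphD (real_complex R)).
- exists (c%:C *: P) => [m Nm|x]; first by rewrite mcoeffZ dP// mulr0.
  by rewrite mevalZ eP pevalZ -(rmorphM (real_complex R)).
exists (mpolyX _ m) => [k Nk|x]; last by rewrite mevalX prod_real_complex.
by rewrite mcoeffX; case: eqP => // mk; move: Nk; rewrite -mk ltnNge mN.
Qed.

(** The variables are real, so taking real and imaginary parts of the coefficients splits the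
    polynomial without raising its degree. *)
Lemma polyspaceP N (f : V -> R[i]) : polyspace N f <->
  exists p q, [/\ degle N p, degle N q & f = cpeval p q].
Proof.
split=> [[P sP ->]|[p [q [dp dq ->]]]].
  pose part (h : R[i] -> R) : poly := \sum_(m <- msupp P) h (mcoeff m P) *: mpolyX R m.
  have dpart h : degle N (part h).
    rewrite /part big_seq; apply: (big_ind (degle N)); [exact: degle0|exact: degleD|].
    move=> m mP; apply: degleZ; apply: degleW (homog_degle (homog_mpolyX m)).
    by have := leq_trans (msize_mdeg_lt mP) sP.
  exists (part (@complex.Re R)), (part (@complex.Im R)); split=> //; apply/funext => x.
  rewrite mevalE /cpeval !peval_sum [LHS]complexE Re_sum Im_sum.
  by congr Complex; apply: eq_bigr => m _; rewrite prod_real_complex pevalZ ?ReM ?ImM /= mulr0 ?subr0 ?add0r.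
have [[P dP eP] [Q dQ eQ]] := (complex_mpoly dp, complex_mpoly dq).
exists (P + Complex 0 1 *: Q).
  by apply/msize_leP => m Nm; rewrite mcoeffD mcoeffZ dP// dQ// mulr0 addr0.
apply/funext => x; rewrite mevalD mevalZ eP eQ.
by rewrite [RHS]complexE ReD ImD ReM ImM /= !(mul0r, mul1r, subr0, addr0, add0r).
Qed.

End complex_polynomials.

(** * The complex inner product and its projection *)

Section complex_sobolev.
Context {R : realType} {d : nat} (alpha : R).
Hypotheses (d_gt0 : (0 < d)%N) (alpha_gtN1 : -1 < alpha).
Local Notation V := 'rV[R]_d.
Local Notation poly := (mpoly d R).
Local Notation mu := (@lebesgue_rV R d).
Local Notation B := (@unit_ball R d).
Local Notation W := (@weight R d alpha).
Local Notation L2a := (L2w mu B W).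
Local Notation dota := (dot mu B W).
Local Notation re u := (fun x => complex.Re (u x)).
Local Notation im u := (fun x => complex.Im (u x)).
Implicit Types (u v : V -> R[i]) (f h : V -> R) (g k : 'I_d -> V -> R).
Let mB := @measurable_unit_ball R d.
Let mW := @measurable_weight_ball R d alpha.
Let W0 := @weight_ge0 R d alpha.
Let iW := @integrable_weight R d alpha alpha_gtN1.
Let Lp (p : poly) : L2a (peval p) := L2w_peval mW W0 iW p.

Lemma sobolevB f (g : 'I_d -> V -> R) f' g' : sobolev alpha f g -> sobolev alpha f' g' ->
  sobolev alpha (fun x => f x - f' x) (fun j x => g j x - g' j x).
Proof.
move=> [lf lg Lf Lg wg] [lf' lg' Lf' Lg' wg']; split=> [|j||j|j].
- exact: locally_integrableB.
- exact: locally_integrableB.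
- exact: L2wB.
- exact: L2wB.
- exact: weak_derivativeB.
Qed.

(** Two weak gradients of [f] agree almost everywhere, so the form does not see which one is
    chosen. *)
Lemma h1dot_grad_unique f g (g' : 'I_d -> V -> R) h k : sobolev alpha f g -> sobolev alpha f g' ->
  (forall j, L2a (k j)) -> h1dot alpha f g h k = h1dot alpha f g' h k.
Proof.
move=> [_ lg _ Lg wg] [_ lg' _ Lg' wg'] Lk; congr (_ + _); apply: eq_bigr => j _.
have [mg _] := Lg j; have [mg' _] := Lg' j; have [mk _] := Lk j.
by apply: dot_ae => //; exact: weak_derivative_unique (lg j) (lg' j) (wg j) (wg' j).
Qed.

Lemma h1dotC f g h k : h1dot alpha f g h k = h1dot alpha h k f g.
Proof.
rewrite /h1dot mulrAC; congr (_ + _); apply: eq_bigr => j _.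
exact: dotC.
Qed.

(** [xget] returns some weak derivative, while square integrability is given for a possibly
    different one; it is transferred by uniqueness almost everywhere. *)
Lemma H1_wgrad u : H1 alpha u ->
  sobolev alpha (re u) (fun j => re (wgrad u j)) /\
  sobolev alpha (im u) (fun j => im (wgrad u j)).
Proof.
move=> [/L2P[Lr Li] Hu].
have wu j : is_weak_deriv j u (wgrad u j).
  by have [g wg _] := Hu j; exact: (xgetPex (cst 0) (ex_intro _ g wg)).
have Lw j : L2a (re (wgrad u j)) /\ L2a (im (wgrad u j)).
  have [g /weak_derivP[_ /L1locP[lr li] wr wi] /L2P[Lgr Lgi]] := Hu j.
  have /weak_derivP[_ /L1locP[lr' li'] wr' wi'] := wu j.
  have [mr' _] := lr'; have [mi' _] := li'.
  by split; [apply: L2w_ae Lgr|apply: L2w_ae Lgi] => //;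
    apply: weak_derivative_unique; eassumption.
have lw j : [/\ locally_integrable (re u), locally_integrable (im u),
    locally_integrable (re (wgrad u j)) & locally_integrable (im (wgrad u j))].
  by have /weak_derivP[/L1locP[? ?] /L1locP[? ?] _ _] := wu j.
(* Local integrability of [u] is part of having a weak derivative, and [d_gt0] provides a
   direction. *)
have [lr li _ _] := lw (Ordinal d_gt0).
split; split=> // j; have [_ _ lgr lgi] := lw j; have [Lgr Lgi] := Lw j => //;
  by have /weak_derivP[] := wu j.
Qed.

Lemma sobolev_H1 u (g : 'I_d -> V -> R[i]) :
  sobolev alpha (re u) (fun j => re (g j)) -> sobolev alpha (im u) (fun j => im (g j)) ->
  H1 alpha u.
Proof.
move=> [lr lgr Lr Lgr wr] [li lgi Li Lgi wi]; split; first exact/L2P.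
move=> j; exists (g j); last by apply/L2P; split; [exact: Lgr|exact: Lgi].
by apply/weak_derivP; split; [exact/L1locP|apply/L1locP; split; [exact: lgr|exact: lgi]|exact: wr|exact: wi].
Qed.

Lemma reB u v : re (u \- v) = fun x => complex.Re (u x) - complex.Re (v x).
Proof. by apply/funext => x; rewrite ReD ReN. Qed.

Lemma imB u v : im (u \- v) = fun x => complex.Im (u x) - complex.Im (v x).
Proof. by apply/funext => x; rewrite ImD ImN. Qed.

Lemma H1B u v : H1 alpha u -> H1 alpha v -> H1 alpha (u \- v).
Proof.
move=> /H1_wgrad[ur ui] /H1_wgrad[vr vi].
apply: (@sobolev_H1 _ (fun j => wgrad u j \- wgrad v j)).
  rewrite reB (_ : (fun j => _) = fun j x => complex.Re (wgrad u j x) - complex.Re (wgrad v j x)).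
    exact: sobolevB.
  by apply/funext => j; rewrite reB.
rewrite imB (_ : (fun j => _) = fun j x => complex.Im (wgrad u j x) - complex.Im (wgrad v j x)).
  exact: sobolevB.
by apply/funext => j; rewrite imB.
Qed.

Lemma H1_cpeval (p q : poly) : H1 alpha (cpeval p q).
Proof.
apply: (@sobolev_H1 _ (fun j => cpeval (mderiv j p) (mderiv j q))).
  exact: (sobolev_peval alpha_gtN1 p).
exact: (sobolev_peval alpha_gtN1 q).
Qed.

Lemma ipE u v : L2 alpha u -> L2 alpha v -> ip alpha u v =
  Complex (dota (re u) (re v) + dota (im u) (im v)) (dota (im u) (re v) - dota (re u) (im v)).
Proof.
move=> /L2P[ur ui] /L2P[vr vi]; rewrite /ip /cintegral /dot; congr Complex.
  rewrite -RintegralD//; [|exact: integrable_dot..].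
  apply: eq_Rintegral => x _; rewrite !(ReM, ImM) conjE /=; ring.
rewrite -RintegralB//; [|exact: integrable_dot..].
by apply: eq_Rintegral => x _; rewrite !(ReM, ImM) conjE /=; ring.
Qed.

Lemma cpeval_one : @Defs.one R d = cpeval 1 0.
Proof. by apply/funext => x; rewrite /cpeval peval1 peval0. Qed.

Lemma ip_oneE u : L2 alpha u -> ip alpha u Defs.one =
  Complex (dota (re u) (peval 1)) (dota (im u) (peval 1)).
Proof.
move=> Lu; have [Lr Li] := (L2P alpha u).1 Lu; rewrite cpeval_one ipE//; last first.
  by apply/L2P; split; exact: Lp.
have z f : L2a f -> dota f (peval 0) = 0.
  by move=> Lf; rewrite -(scale0r (0 : poly)) dota_pevalZ// mul0r.
by congr Complex; rewrite z// ?addr0 ?subr0.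
Qed.

(** [P] and [Q] are to be real or imaginary part: the four real forms that make up [ip1]. *)
Definition h1part (P Q : R[i] -> R) u v : R := h1dot alpha
  (fun x => P (u x)) (fun j x => P (wgrad u j x)) (fun x => Q (v x)) (fun j x => Q (wgrad v j x)).

Lemma ip1E u v : H1 alpha u -> H1 alpha v -> ip1 alpha u v =
  Complex (h1part (@complex.Re R) (@complex.Re R) u v + h1part (@complex.Im R) (@complex.Im R) u v)
          (h1part (@complex.Im R) (@complex.Re R) u v - h1part (@complex.Re R) (@complex.Im R) u v).
Proof.
move=> Hu Hv; have [[_ _ _ Lur _] [_ _ _ Lui _]] := H1_wgrad Hu.
have [[_ _ _ Lvr _] [_ _ _ Lvi _]] := H1_wgrad Hv.
have [Lu _] := Hu; have [Lv _] := Hv.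
have L1 : L2 alpha (@Defs.one R d) by rewrite cpeval_one; apply/L2P; split; exact: Lp.
have Lwu j : L2 alpha (wgrad u j) by apply/L2P; split; [exact: Lur|exact: Lui].
have Lwv j : L2 alpha (wgrad v j) by apply/L2P; split; [exact: Lvr|exact: Lvi].
have invE : (ip alpha (@Defs.one R d) Defs.one)^-1 = ((dota (peval 1) (peval 1))^-1)%:C.
  rewrite ip_oneE// (fmorphV (real_complex R)) cpeval_one; congr (_ ^-1).
  by congr Complex; rewrite dotC -(scale0r (0 : poly)) dota_pevalZ ?mul0r//; exact: Lp.
rewrite /ip1 /ipv (eq_bigr _ (fun j _ => ipE (Lwu j) (Lwv j))) invE !ip_oneE// conjE.
rewrite [LHS]complexE ReD ImD Re_sum Im_sum !(ReM, ImM) /= big_split sumrB /=.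
by rewrite /h1part /h1dot; congr Complex; ring.
Qed.

(** The chosen weak gradient of a polynomial is exchanged for the formal one, which makes [ip1]
    against polynomials computable. *)
Lemma ip1_cpeval u p q : H1 alpha u ->
  let S1 := sform alpha (re u) (fun j => re (wgrad u j)) in
  let S2 := sform alpha (im u) (fun j => im (wgrad u j)) in
  ip1 alpha u (cpeval p q) = Complex (S1 p + S2 q) (S2 p - S1 q).
Proof.
move=> Hu /=; have [[_ _ _ Lr _] [_ _ _ Li _]] := H1_wgrad Hu.
have [s1 s2] := H1_wgrad (H1_cpeval p q).
have part f g k r : (forall j, L2a (g j)) -> sobolev alpha (peval r) k ->
    h1dot alpha f g (peval r) k = sform alpha f g r.
  by move=> Lg sk; rewrite /sform h1dotC [RHS]h1dotC; apply: h1dot_grad_unique => //; exact: sobolev_peval.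
rewrite (ip1E Hu (H1_cpeval p q)).
by congr (Complex (_ + _) (_ - _)); [exact: part Lr s1|exact: part Li s2|exact: part Li s1|exact: part Lr s2].
Qed.

(** [proj1] has its defining property once a candidate exists; the candidate is assembled from the
    real projections of the two parts of [u]. *)
Lemma proj1P N u : H1 alpha u -> polyspace N (proj1 alpha N u) /\
  forall q, polyspace N q -> ip1 alpha (u \- proj1 alpha N u) q = 0.
Proof.
move=> Hu; have [s1 s2] := H1_wgrad Hu.
have [p dp op] := sobolev_projection alpha_gtN1 N s1.
have [r dr or] := sobolev_projection alpha_gtN1 N s2.
apply: (@xgetPex _ (cst 0) [set p | polyspace N p /\
  forall q, polyspace N q -> ip1 alpha (u \- p) q = 0]).
exists (cpeval p r); split; first by apply/polyspaceP; exists p, r.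
move=> _ /polyspaceP[q1 [q2 [d1 d2 ->]]].
have He := H1B Hu (H1_cpeval p r); rewrite ip1_cpeval//.
have [e1 e2] := H1_wgrad He.
have [_ _ L1 Lg1 _] := s1; have [_ _ L2 Lg2 _] := s2.
have S1 q : degle N q -> sform alpha (re (u \- cpeval p r)) (fun j => re (wgrad (u \- cpeval p r) j)) q = 0.
  move=> dq; transitivity (sform alpha (fun x => complex.Re (u x) - peval p x)
    (fun j x => complex.Re (wgrad u j x) - pgrad p j x) q).
    rewrite reB in e1 *; apply: h1dot_grad_unique e1 _ _ => [|j]; last exact: Lp.
    by apply: sobolevB s1 _; exact: sobolev_peval.
  by rewrite sformB// ?op ?subrr// => j; exact: Lp.
have S2 q : degle N q -> sform alpha (im (u \- cpeval p r)) (fun j => im (wgrad (u \- cpeval p r) j)) q = 0.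
  move=> dq; transitivity (sform alpha (fun x => complex.Im (u x) - peval r x)
    (fun j x => complex.Im (wgrad u j x) - pgrad r j x) q).
    rewrite imB in e2 *; apply: h1dot_grad_unique e2 _ _ => [|j]; last exact: Lp.
    by apply: sobolevB s2 _; exact: sobolev_peval.
  by rewrite sformB// ?or ?subrr// => j; exact: Lp.
by rewrite !S1// !S2// addr0 subr0.
Qed.

End complex_sobolev.

(** * The error estimate *)

Lemma lambda_gt0 (R : realType) d (alpha : R) n : (0 < d)%N -> -1 < alpha -> (0 < n)%N ->
  0 < lambda d alpha n.
Proof.
move=> d_gt0 a_gtN1 n_gt0; have a1 : 0 < alpha + 1 by rewrite -ltrBlDr sub0r.
have d1 : (1 : R) <= d%:R by rewrite ler1n.
have n1 : (1 : R) <= n%:R by rewrite ler1n.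
by rewrite /lambda mulr_gt0 ?ltr0n//; lra.
Qed.

Local Close Scope classical_set_scope.

Theorem theorem4p6 (R : realType) (d : nat) (d_gt0 : (0 < d)%N)
    (alpha : R) (alpha_gtN1 : -1 < alpha)
    (u : 'rV[R]_d -> R[i]) (uH1 : H1 alpha u)
    (N : nat) (N_ge2 : (2 <= N)%N) :
  nrm alpha (u \- proj1 alpha N u) <=
  (lambda d alpha N.+1 `^ (- 2^-1) + lambda d alpha N.-1 `^ (- 2^-1)) *
  nrm1 alpha (u \- proj1 alpha N u).
Proof.
have [] := proj1P d_gt0 alpha_gtN1 N uH1.
(* From here on the projection is just some polynomial whose error [e] is orthogonal to
   [polyspace N]. *)
move: (proj1 alpha N u) => _ /polyspaceP[p [r [_ _ ->]]].
set e := u \- _ => oe.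
have He := H1B d_gt0 uH1 (H1_cpeval alpha_gtN1 p r); rewrite -/e in He.
have [s1 s2] := H1_wgrad d_gt0 He.
set e1 := (fun x => _) in s1; set g1 := (fun j => _) in s1.
set e2 := (fun x => _) in s2; set g2 := (fun j => _) in s2.
have z (f : 'rV[R]_d -> R) g : sobolev alpha f g -> sform alpha f g (0 : mpoly d R) = 0.
  by move=> [_ _ Lf Lg _]; rewrite -(scale0r (0 : mpoly d R)) sformZ// mul0r.
have o (q : mpoly d R) : degle N q -> sform alpha e1 g1 q = 0 /\ sform alpha e2 g2 q = 0.
  (* Testing with a real polynomial suffices: real and imaginary part of the one complex identity
     give the two real orthogonality relations. *)
  move=> dq; have /oe : polyspace N (cpeval q 0).
    by apply/polyspaceP; exists q, 0; split=> //; exact: degle0.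
  by rewrite ip1_cpeval// !z// addr0 subr0 => -[-> ->].
have [m1 l1] := sobolev_orthogonal_le d_gt0 alpha_gtN1 s1 N_ge2 (fun q dq => (o q dq).1).
have [m2 l2] := sobolev_orthogonal_le d_gt0 alpha_gtN1 s2 N_ge2 (fun q dq => (o q dq).2).
set L := lambda d alpha N.-1 in l1 l2 *.
have L0 : 0 < L by apply: lambda_gt0 => //; lia.
have D0 f : 0 <= dot lebesgue_rV (@unit_ball R d) (weight alpha) f f.
  by apply: dot_ge0; exact: weight_ge0.
(* Both parts of [e] have mean zero, so only the gradient terms of the norm remain. *)
have -> : nrm1 alpha e = Num.sqrt (
    \sum_j dot lebesgue_rV (@unit_ball R d) (weight alpha) (g1 j) (g1 j) +
    \sum_j dot lebesgue_rV (@unit_ball R d) (weight alpha) (g2 j) (g2 j)).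
  by rewrite /nrm1 ip1E//= /h1part /h1dot m1 m2 !mulr0 !addr0.
have [Le _] := He; rewrite /nrm ipE//=.
(* The summand with [N.+1] is nonnegative and is dropped; the one with [N.-1] carries the
   estimate. *)
rewrite mulrDl ler_wpDl ?mulr_ge0 ?powR_ge0 ?sqrtr_ge0//.
have L1 := ltW L0.
rewrite powRN powR12_sqrt// ler_pdivlMl ?sqrtr_gt0// -sqrtrM// ler_sqrt.
  by rewrite mulrDr lerD.
by rewrite addr_ge0// sumr_ge0.
Qed.
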